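(* Let $n\ge1$, $Q=4n+6$, $0<\lambda<4$ and $p=\frac{2Q}{2Q-\lambda}$. Then the constant function $1$ is a local extremizer of the Hardy-Littlewood-Sobolev inequality on $S$ in the following sense: the second variation of the associated functional at $h=1$ is strictly negative, i.e. for every nonzero $\varphi\in L^2(S)$ satisfying $\int_S\varphi\,d\zeta=0$ and $\int_S\varphi(\zeta)\,\zeta\,d\zeta=0$, $$|S|\iint_{S\times S}\frac{\overline{\varphi(\zeta)}\varphi(\eta)}{|1-\zeta\cdot\bar\eta|^{\frac\lambda2}}\,d\zeta\,d\eta-(p-1)\left(\iint_{S\times S}\frac{d\zeta\,d\eta}{|1-\zeta\cdot\bar\eta|^{\frac\lambda2}}\right)\int_S|\varphi|^2\,d\zeta<0 .$$
   Context: $\mathbb H$ denotes the quaternions. $S=\{\zeta\in\mathbb H^{n+1}:|\zeta|=1\}$ with standard (non-normalized) surface measure $d\zeta$ and total area $|S|$; $\zeta\cdot\bar\eta=\sum_{j=1}^{n+1}\zeta_j\overline{\eta_j}$. The condition $\int_S\varphi(\zeta)\zeta\,d\zeta=0$ means that the integral of $\varphi$ against each of the $4n+4$ real coordinate functions of $\zeta\in\mathbb H^{n+1}\cong\mathbb R^{4n+4}$ vanishes. The Hardy-Littlewood-Sobolev inequality in question is $\big|\iint_{S\times S}\overline{f(\zeta)}g(\eta)\,d_S(\zeta,\eta)^{-\lambda}d\zeta d\eta\big|\le C\|f\|_p\|g\|_p$ with $d_S(\zeta,\eta)=2^{-1/2}|1-\zeta\cdot\bar\eta|^{1/2}$. 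*)

(* Defs.v *)
From HB Require Import structures.
From mathcomp Require Import all_boot all_order all_algebra.
From mathcomp Require Import all_classical all_reals all_analysis measurable_realfun.
From mathcomp Require Import complex ring lra.

Set Implicit Arguments.
Unset Strict Implicit.
Unset Printing Implicit Defensive.
Import Order.TTheory GRing.Theory Num.Theory numFieldNormedType.Exports.
Local Open Scope classical_set_scope.
Local Open Scope ring_scope.

(* The library's instance turning m1 \x m2 into a sigma-finite measure is
   shadowed by the one for subprobabilities, hence this copy. *)
Section sigma_finite_product.
Local Open Scope ereal_scope.
Context d1 d2 (T1 : measurableType d1) (T2 : measurableType d2) (R : realType).
Context (m1 : {sigma_finite_measure set T1 -> \bar R})
  (m2 : {sigma_finite_measure set T2 -> \bar R}).

Lemma product_sigma_finite : sigma_finite setT (m1 \x m2).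
Proof.
have /sigma_finiteP[F [TF ndF Foo]] := sigma_finiteT m1.
have /sigma_finiteP[G [TG ndG Goo]] := sigma_finiteT m2.
exists (fun n => F n `*` G n).
  rewrite -setXTT TF TG predeqE => -[x y]; split.
    move=> [/= [n _ Fnx] [k _ Gky]]; exists (maxn n k) => //; split.
    - by move: x Fnx; exact/subsetPset/ndF/leq_maxl.
    - by move: y Gky; exact/subsetPset/ndG/leq_maxr.
  by move=> [n _ []/= ? ?]; split; exists n.
move=> k; have [? ?] := Foo k; have [? ?] := Goo k.
split; first exact: measurableX.
by rewrite product_measure1E// lte_mul_pinfty// ge0_fin_numE.
Qed.

Definition prod_measure : set (T1 * T2) -> \bar R := m1 \x m2.

HB.instance Definition _ := Measure.on prod_measure.
HB.instance Definition _ := Measure_isSigmaFinite.Build _ _ _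
  prod_measure product_sigma_finite.

End sigma_finite_product.

Section tuple_measure.
Local Open Scope ereal_scope.
Context d (T : measurableType d) (R : realType).

Definition tcons n (p : T * n.-tuple T) : n.+1.-tuple T :=
  [tuple of p.1 :: p.2].

Lemma measurable_tcons n : measurable_fun [set: T * n.-tuple T] (@tcons n).
Proof. exact: measurable_cons. Qed.

Section tcons_measure.
Context (mu : {sigma_finite_measure set T -> \bar R}) (n : nat)
  (nu : {sigma_finite_measure set (n.-tuple T) -> \bar R}).

Definition tcons_measure : set (n.+1.-tuple T) -> \bar R :=
  pushforward (mu \x nu) (@tcons n).

Let tcons_preim A : measurable A -> measurable (@tcons n @^-1` A).
Proof. by move=> mA; rewrite -[X in measurable X]setTI; exact: measurable_tcons. Qed.

Let tcons0 : tcons_measure set0 = 0.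
Proof. by rewrite /tcons_measure /pushforward preimage_set0 measure0. Qed.

Let tcons_ge0 A : 0 <= tcons_measure A.
Proof. by rewrite /tcons_measure /pushforward; exact: (measure_ge0 (mu \x nu)). Qed.

Let tcons_sigma_additive : semi_sigma_additive tcons_measure.
Proof.
move=> F mF tF mUF; rewrite /tcons_measure /pushforward preimage_bigcup.
apply: measure_semi_sigma_additive.
- by move=> k; exact: tcons_preim.
- apply/trivIsetP => /= i j _ _ ij; rewrite -preimage_setI.
  by move/trivIsetP : tF => /(_ _ _ _ _ ij) ->//; rewrite preimage_set0.
- by rewrite -preimage_bigcup; exact: tcons_preim.
Qed.

HB.instance Definition _ := isMeasure.Build _ _ _
  tcons_measure tcons0 tcons_ge0 tcons_sigma_additive.

Let tuncons (t : n.+1.-tuple T) : T * n.-tuple T :=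
  (thead t, [tuple of behead t]).

Let measurable_tuncons : measurable_fun setT tuncons.
Proof.
apply: measurable_fun_pair; first exact: (measurable_tnth ord0).
exact: measurable_behead.
Qed.

Let tconsK p : tuncons (tcons p) = p.
Proof. by case: p => x t; rewrite /tuncons theadE; congr pair; apply/val_inj. Qed.

Let tcons_sigma_finite : sigma_finite setT tcons_measure.
Proof.
have [F TF mF] := product_sigma_finite mu nu.
exists (fun k => tuncons @^-1` F k).
  by rewrite -preimage_bigcup -TF preimage_setT.
move=> k; split.
  by rewrite -[X in measurable X]setTI; apply: measurable_tuncons => //; have [] := mF k.
rewrite /tcons_measure /pushforward -comp_preimage.
rewrite (_ : _ \o _ = id); last by apply/funext => p /=; exact: tconsK.
by rewrite preimage_id; have [] := mF k.
Qed.

HB.instance Definition _ := Measure_isSigmaFinite.Build _ _ _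
  tcons_measure tcons_sigma_finite.

End tcons_measure.

Fixpoint tuple_measure (mu : {sigma_finite_measure set T -> \bar R}) (n : nat) :
    {sigma_finite_measure set (n.-tuple T) -> \bar R} :=
  match n with
  | 0 => \d_([tuple])
  | n'.+1 => tcons_measure mu (tuple_measure mu n')
  end.

Lemma measurable_tuple_box n (A : set T) : measurable A ->
  measurable [set t : n.-tuple T | forall i, A (tnth t i)].
Proof.
move=> mA; rewrite (_ : [set _ | _] = \big[setI/setT]_(i < n)
    ((fun t : n.-tuple T => tnth t i) @^-1` A)).
  apply: bigsetI_measurable => i _.
  by rewrite -[X in measurable X]setTI; exact: measurable_tnth.
apply/seteqP; split=> t /=.
  by move=> tA; rewrite -bigcap_seq => i _; exact: tA.
by rewrite -bigcap_seq => tA i; apply: tA => /=; rewrite mem_index_enum.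
Qed.

Lemma tuple_measure_box_fin (mu : {sigma_finite_measure set T -> \bar R}) n A :
  measurable A -> mu A < +oo ->
  tuple_measure mu n [set t | forall i, A (tnth t i)] < +oo.
Proof.
move=> mA Afin; elim: n => [|n IHn]; first by rewrite /= diracE ltry.
rewrite /= /tcons_measure /pushforward.
rewrite (_ : _ @^-1` _ = A `*` [set t : n.-tuple T | forall i, A (tnth t i)]).
  rewrite product_measure1E//; last exact: measurable_tuple_box.
  by rewrite lte_mul_pinfty// ge0_fin_numE.
apply/seteqP; split=> -[x t] /=.
  move=> xtA; split; first by have := xtA ord0; rewrite /tcons tnth0.
  by move=> i; have := xtA (lift ord0 i); rewrite /tcons tnthS.
move=> [xA tA] i; case: (unliftP ord0 i) => [j ->|->].
  by rewrite /tcons tnthS.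
by rewrite /tcons tnth0.
Qed.

End tuple_measure.

(* ((a, b), (c, d)) stands for the quaternion a + b i + c j + d k. *)
Definition quat (R : realType) : Type :=
  ((measurableTypeR R * measurableTypeR R) *
   (measurableTypeR R * measurableTypeR R))%type.

Section quaternions.
Context (R : realType).

Definition mkquat (a b c d : R) : quat R := ((a, b), (c, d)).

Definition qcoord (c : 'I_4) (q : quat R) : R :=
  nth 0 [:: q.1.1 : R; q.1.2 : R; q.2.1 : R; q.2.2 : R] c.

HB.instance Definition _ := Choice.copy (quat R) ((R * R) * (R * R))%type.
HB.instance Definition _ := GRing.Zmodule.copy (quat R) ((R * R) * (R * R))%type.
HB.instance Definition _ := Measurable.copy (quat R)
  ((measurableTypeR R * measurableTypeR R) *
   (measurableTypeR R * measurableTypeR R))%type.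

Definition qone : quat R := mkquat 1 0 0 0.

Definition qmul (x y : quat R) : quat R :=
  let: ((a, b), (c, d)) := (x : (R * R) * (R * R)) in
  let: ((a', b'), (c', d')) := (y : (R * R) * (R * R)) in
  mkquat (a * a' - b * b' - c * c' - d * d')
         (a * b' + b * a' + c * d' - d * c')
         (a * c' - b * d' + c * a' + d * b')
         (a * d' + b * c' - c * b' + d * a').

Let quat_eq (a b c d a' b' c' d' : R) :
  a = a' -> b = b' -> c = c' -> d = d' -> mkquat a b c d = mkquat a' b' c' d'.
Proof. by move=> -> -> -> ->. Qed.

Let qmulA : associative qmul.
Proof.
by move=> [[a b][c d]] [[a' b'][c' d']] [[a'' b''][c'' d'']]; apply: quat_eq => /=; ring.
Qed.

Let qmul1q : left_id qone qmul.
Proof. by move=> [[a b][c d]]; apply: quat_eq => /=; ring. Qed.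

Let qmulq1 : right_id qone qmul.
Proof. by move=> [[a b][c d]]; apply: quat_eq => /=; ring. Qed.

Let qmulDl : left_distributive qmul +%R.
Proof.
by move=> [[a b][c d]] [[a' b'][c' d']] [[a'' b''][c'' d'']]; apply: quat_eq => /=; ring.
Qed.

Let qmulDr : right_distributive qmul +%R.
Proof.
by move=> [[a b][c d]] [[a' b'][c' d']] [[a'' b''][c'' d'']]; apply: quat_eq => /=; ring.
Qed.

Let qone_neq0 : qone != 0.
Proof. by apply/eqP => -[] /eqP; rewrite oner_eq0. Qed.

HB.instance Definition _ := GRing.Zmodule_isNzRing.Build (quat R)
  qmulA qmul1q qmulq1 qmulDl qmulDr qone_neq0.

Definition qconj (q : quat R) : quat R :=
  mkquat (q.1.1 : R) (- (q.1.2 : R)) (- (q.2.1 : R)) (- (q.2.2 : R)).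

Definition qscale (r : R) (q : quat R) : quat R :=
  mkquat (r * q.1.1) (r * q.1.2) (r * q.2.1) (r * q.2.2).

Definition qnorm (q : quat R) : R := Num.sqrt (\sum_(c < 4) qcoord c q ^+ 2).

Definition quat_leb : {sigma_finite_measure set (quat R) -> \bar R} :=
  prod_measure (prod_measure lebesgue_measure lebesgue_measure)
    (prod_measure lebesgue_measure lebesgue_measure).

End quaternions.

Section quaternionic_sphere.
Context (R : realType) (n : nat).

Notation quatn := (n.+1.-tuple (quat R)).

Definition hdot (z w : quatn) : quat R :=
  \sum_(j < n.+1) tnth z j * qconj (tnth w j).

Definition hnorm (z : quatn) : R :=
  Num.sqrt (\sum_(j < n.+1) qnorm (tnth z j) ^+ 2).

Definition hscale (r : R) (z : quatn) : quatn :=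
  [tuple qscale r (tnth z j) | j < n.+1].

Definition sphere : set quatn := [set z | hnorm z = 1].

Definition hleb : {sigma_finite_measure set quatn -> \bar R} :=
  tuple_measure (quat_leb R) n.+1.

Definition punctured_ball : set quatn := [set z | 0 < hnorm z <= 1].

Definition radial_proj (z : quatn) : quatn := hscale (hnorm z)^-1 z.

(* Surface measure in polar coordinates: the sphere has dimension 4n+3, so the
   area of A is 4n+4 times the volume of the cone {r z | 0 < r <= 1, z in A}.
   It is a measure on the ambient space, concentrated on the sphere. *)
Definition surface_measure (A : set quatn) : \bar R :=
  ((4 * n + 4)%:R%:E * hleb (radial_proj @^-1` A `&` punctured_ball))%E.

Let measurable_qcoord c : measurable_fun setT (@qcoord R c).
Proof.
have mR (f : quat R -> measurableTypeR R) :
    measurable_fun setT f -> measurable_fun setT (f : quat R -> R) by [].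
case: c => -[|[|[|[|//]]]] Hc; rewrite /qcoord /=; apply: mR.
- exact: (measurableT_comp measurable_fst measurable_fst).
- exact: (measurableT_comp measurable_snd measurable_fst).
- exact: (measurableT_comp measurable_fst measurable_snd).
- exact: (measurableT_comp measurable_snd measurable_snd).
Qed.

Let measurable_sqrt : measurable_fun setT (@Num.sqrt R).
Proof. by apply: continuous_measurable_fun; exact: sqrt_continuous. Qed.

Let measurable_qnorm : measurable_fun setT (@qnorm R).
Proof.
apply: measurableT_comp => //.
by apply: measurable_sum => c; exact: measurable_funX.
Qed.

Lemma measurable_hnorm : measurable_fun setT hnorm.
Proof.
apply: measurableT_comp => //.
apply: measurable_sum => j; apply: measurable_funX.
apply: (measurableT_comp measurable_qnorm); exact: measurable_tnth.
Qed.

Lemma measurable_punctured_ball : measurable punctured_ball.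
Proof.
rewrite (_ : punctured_ball = setT `&` hnorm @^-1` `]0, 1]).
  by apply: measurable_hnorm.
by rewrite setTI; apply/seteqP; split=> z /=; rewrite in_itv.
Qed.

Lemma measurable_sphere : measurable sphere.
Proof.
rewrite (_ : sphere = setT `&` hnorm @^-1` [set 1]); last by rewrite setTI.
by apply: measurable_hnorm.
Qed.

Lemma measurable_radial_proj : measurable_fun setT radial_proj.
Proof.
apply/measurable_fun_tnthP => j.
have mc c : measurable_fun setT
    (fun z : quatn => (hnorm z)^-1 * qcoord c (tnth z j)).
  apply: measurable_funM.
    rewrite (_ : (fun _ => _) = (@powR R ^~ (-1)) \o hnorm).
      by apply: measurableT_comp; [exact: measurable_powR|exact: measurable_hnorm].
    by apply/funext => z /=; rewrite powR_inv1// sqrtr_ge0.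
  apply: (measurableT_comp (measurable_qcoord c)); exact: measurable_tnth.
rewrite (_ : _ \o _ = fun z : quatn =>
  mkquat ((hnorm z)^-1 * qcoord (inord 0) (tnth z j))
         ((hnorm z)^-1 * qcoord (inord 1) (tnth z j))
         ((hnorm z)^-1 * qcoord (inord 2) (tnth z j))
         ((hnorm z)^-1 * qcoord (inord 3) (tnth z j))); last first.
  by apply/funext => z /=; rewrite tnth_mktuple /qcoord !inordK.
by apply: measurable_fun_pair; apply: measurable_fun_pair; exact: mc.
Qed.

Let surface_preim A : measurable A -> measurable (radial_proj @^-1` A).
Proof.
by move=> mA; rewrite -[X in measurable X]setTI; exact: measurable_radial_proj.
Qed.

Let surface0 : surface_measure set0 = 0%E.
Proof. by rewrite /surface_measure preimage_set0 set0I measure0 mule0. Qed.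

Let surface_ge0 A : (0 <= surface_measure A)%E.
Proof. by rewrite /surface_measure mule_ge0. Qed.

Let surface_sigma_additive : semi_sigma_additive surface_measure.
Proof.
move=> F mF tF mUF.
rewrite [X in X @ \oo --> _](_ : _ = (fun k => ((4 * n + 4)%:R%:E *
    \sum_(0 <= i < k) hleb (radial_proj @^-1` F i `&` punctured_ball))%E)); last first.
  by apply/funext => k; rewrite ge0_sume_distrr.
rewrite /surface_measure; apply: cvgeZl => //.
rewrite preimage_bigcup setI_bigcupl; apply: measure_semi_sigma_additive.
- move=> k; apply: measurableI; last exact: measurable_punctured_ball.
  exact: surface_preim.
- apply/trivIset_setIr/trivIsetP => /= i j _ _ ij; rewrite -preimage_setI.
  by move/trivIsetP : tF => /(_ _ _ _ _ ij) ->//; rewrite preimage_set0.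
- rewrite -setI_bigcupl -preimage_bigcup.
  apply: measurableI; last exact: measurable_punctured_ball.
  exact: surface_preim.
Qed.

HB.instance Definition _ := isMeasure.Build _ _ _
  surface_measure surface0 surface_ge0 surface_sigma_additive.

Let cube : set (quat R) := (`[-1, 1] `*` `[-1, 1]) `*` (`[-1, 1] `*` `[-1, 1]).

Let measurable_cube : measurable cube.
Proof. by apply: measurableX; apply: measurableX; exact: measurable_itv. Qed.

Let cube_fin : (quat_leb R cube < +oo)%E.
Proof.
have fin : lebesgue_measure (`[-1, 1]%classic : set (measurableTypeR R)) \is a fin_num.
  by rewrite lebesgue_measure_itv /=; case: ifP.
rewrite /quat_leb /cube /= /prod_measure product_measure1E; last 2 first.
- by apply: measurableX; exact: measurable_itv.
- by apply: measurableX; exact: measurable_itv.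
rewrite /= /prod_measure !product_measure1E; try exact: measurable_itv.
by rewrite -ge0_fin_numE ?mule_ge0// !fin_numM.
Qed.

Let ball_cube : punctured_ball `<=` [set z | forall j, cube (tnth z j)].
Proof.
move=> z /andP[_ z1] j.
have zj c : `|qcoord c (tnth z j)| <= 1.
  have sum0 m (F : 'I_m -> R) : 0 <= \sum_i F i ^+ 2.
    by apply: sumr_ge0 => i _; exact: sqr_ge0.
  have le_sum m (F : 'I_m -> R) i : F i ^+ 2 <= \sum_i F i ^+ 2.
    by rewrite (bigD1 i)//= lerDl; apply: sumr_ge0 => k _; exact: sqr_ge0.
  have h1 : qcoord c (tnth z j) ^+ 2 <= qnorm (tnth z j) ^+ 2.
    by rewrite /qnorm sqr_sqrtr//; exact: (le_sum _ (fun c => qcoord c (tnth z j)) c).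
  have h2 : qnorm (tnth z j) ^+ 2 <= hnorm z ^+ 2.
    rewrite [leRHS]sqr_sqrtr//.
    exact: (le_sum _ (fun k => qnorm (tnth z k)) j).
  have h3 : hnorm z ^+ 2 <= 1 by rewrite expr_le1// sqrtr_ge0.
  rewrite -(@ler_pXn2r _ 2)// ?nnegrE// expr1n real_normK ?num_real//.
  exact: le_trans h1 (le_trans h2 h3).
move: (zj (inord 0)) (zj (inord 1)) (zj (inord 2)) (zj (inord 3)).
rewrite /qcoord !inordK//= => *.
by split; split; rewrite /= in_itv /= -ler_norml.
Qed.

Lemma surface_measure_fin : (surface_measure setT < +oo)%E.
Proof.
have mC := @measurable_tuple_box _ _ n.+1 _ measurable_cube.
have finC := tuple_measure_box_fin n.+1 measurable_cube cube_fin.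
rewrite /surface_measure lte_mul_pinfty//.
apply: le_lt_trans finC; apply: le_measure; rewrite ?inE//.
  by rewrite preimage_setT setTI; exact: measurable_punctured_ball.
by rewrite preimage_setT setTI; exact: ball_cube.
Qed.

Let surface_sigma_finite : sigma_finite setT surface_measure.
Proof.
exists (fun=> setT); first by rewrite bigcup_const//; exists 0%N.
by move=> _; split => //; exact: surface_measure_fin.
Qed.

HB.instance Definition _ := Measure_isSigmaFinite.Build _ _ _
  surface_measure surface_sigma_finite.

End quaternionic_sphere.
Arguments sphere : clear implicits.
Arguments surface_measure : clear implicits.

Local Open Scope complex_scope.

Definition cintegral d (T : measurableType d) (R : realType)
    (mu : {measure set T -> \bar R}) (D : set T) (f : T -> R[i]) : R[i] :=
  (\int[mu]_(x in D) complex.Re (f x)) +i* (\int[mu]_(x in D) complex.Im (f x)).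

(* Functions on the sphere are functions on the ambient space whose values off
   the sphere are irrelevant. *)
Definition sphere_L2 (R : realType) (n : nat)
    (f : n.+1.-tuple (quat R) -> R[i]) : Prop :=
  [/\ measurable_fun (sphere R n) (fun z => complex.Re (f z)),
      measurable_fun (sphere R n) (fun z => complex.Im (f z)) &
      (\int[surface_measure R n]_(z in sphere R n)
         (ComplexField.Normc.normc (f z) ^+ 2)%:E < +oo)%E].

(* Main.v *)
Require Import Defs.
From HB Require Import structures.
From mathcomp Require Import all_boot all_order all_algebra.
From mathcomp Require Import all_classical all_reals all_analysis measurable_realfun.
From mathcomp Require Import complex ring lra zify.

Set Implicit Arguments.
Unset Strict Implicit.
Unset Printing Implicit Defensive.
Import Order.TTheory GRing.Theory Num.Theory numFieldNormedType.Exports.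
Local Open Scope classical_set_scope.
Local Open Scope ring_scope.

(* Put a = lambda / 4 and let u = <z, w>, so that the kernel is |1 - u|^(- 2 a).
   The kernels Z_m = h_m(x, x'), with h_m the complete symmetric polynomials in
   the complex eigenvalues x, x' of u, satisfy Z_l * Z_m = delta_(l m) g_m Z_m for
   the moments g_m of |y_1|^(2 m): isometries of the sphere reduce this to
   integrals of monomials. Hence all |u|^(2 k) Z_m are positive semidefinite.
   For t < 1 the kernel |1 - t u|^(- 2 a) is the uniform limit of the squares
   |sum_(j <= M) A_j t^j x^j|^2, A_j being the coefficients of (1 - x)^(- a).
   Expanding such a square in the |u|^(2 k) Z_m, log-convexity of (A_j) makes
   the terms with k > 0 nonpositive up to a negligible remainder, and what is
   left is sum_m A_m t^m Z_m. By Bessel's inequality its quadratic form is at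
   most A_2 g_2 |f|^2 when f is orthogonal to constants and coordinates.
   The same bound with f = 1 controls the mass of each row of the kernel, so
   Fatou's lemma and dominated convergence allow t -> 1. The total mass of the
   kernel is at least (1 - a / (n + 1)) |S|^2, by r^(- a) >= 1 - a (r - 1) at
   r = |1 - u|^2. The statement becomes (a + 1) (2 n + 3 - a) < 2 (2 n + 3) (n + 1 - a). *)

(** At t = 1 the kernel is unbounded, so the algebra is done for t < 1 and with finite sums only.
    Squares of partial sums are used instead of the series of the kernel because their expansion is
    a finite identity, whose error, of order (M + 1)^2 t^M, is controlled by a differential equation
    in t. No eigenvalue of the kernel is computed: only the relations between the Z_m and signs
    enter. Dropping the terms with k > 0 overestimates the form and the tangent line underestimates
    the mass; for n >= 1 the last inequality absorbs both losses. The indices 0 and 1 disappear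
    because Z_0 = 1 and Z_1 = 2 Re u is twice the real inner product; among m >= 2 the product A_m
    g_m is largest at m = 2, both sequences being decreasing. The constants are A_2 = a (a + 1) / 2,
    g_1 = |S| / (2 n + 2), g_2 = |S| / ((n + 1) (2 n + 3)) and p - 1 = a / (2 n + 3 - a). The
    surface measure is defined by volumes of cones, and its invariance is reduced to translation
    invariance of Lebesgue measure, without determinants. *)

Section measure_preserving.
Context (R : realType).

Definition measure_preserving d (T : measurableType d)
    (mu : set T -> \bar R) (f : T -> T) :=
  measurable_fun setT f /\ forall A, measurable A -> mu (f @^-1` A) = mu A.

(** The image of the product measure agrees with the product measure on rectangles, which determines
    it by sigma-finiteness. *)
Lemma measure_preserving_prod d1 d2 (T1 : measurableType d1)
    (T2 : measurableType d2) (m1 : {sigma_finite_measure set T1 -> \bar R})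
    (m2 : {sigma_finite_measure set T2 -> \bar R}) f1 f2 :
  measure_preserving m1 f1 -> measure_preserving m2 f2 ->
  measure_preserving (prod_measure m1 m2) (fun p => (f1 p.1, f2 p.2)).
Proof.
rewrite /prod_measure.
move=> [mf1 m1f] [mf2 m2f].
have mf : measurable_fun setT (fun p : T1 * T2 => (f1 p.1, f2 p.2)).
  by apply: measurable_fun_pair; apply: measurableT_comp.
split=> // A mA.
pose F : {mfun (T1 * T2)%type >-> (T1 * T2)%type} :=
  HB.pack (fun p : T1 * T2 => (f1 p.1, f2 p.2))
    (isMeasurableFun.Build _ _ _ _ _ mf).
have -> : (m1 \x m2)%E ((fun p => (f1 p.1, f2 p.2)) @^-1` A) =
  pushforward (m1 \x m2)%E F A by [].
apply/esym/product_measure_unique => // B C mB mC.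
rewrite /= /pushforward.
rewrite (_ : _ @^-1` _ = (f1 @^-1` B) `*` (f2 @^-1` C))//.
have mpre d (T : measurableType d) (f : T -> T) D :
   measurable_fun setT f -> measurable D -> measurable (f @^-1` D).
  by move=> mg mD; rewrite -[X in measurable X]setTI; exact: mg.
rewrite product_measure1E; [|exact: mpre..].
by congr (_ * _)%E; [exact: m1f|exact: m2f].
Qed.

(** Half-open intervals keep their length, and they determine Lebesgue measure. *)
Lemma measure_preserving_shift (y : R) :
  measure_preserving (@lebesgue_measure R : set (measurableTypeR R) -> \bar R)
    (fun x : measurableTypeR R => (x : R) + y).
Proof.
have mf : measurable_fun [set: measurableTypeR R]
    (fun x : measurableTypeR R => (x : R) + y : measurableTypeR R).
  exact: measurable_funD.
split=> // A mA; apply/esym.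
pose F : {mfun (measurableTypeR R) >-> (measurableTypeR R)} :=
  HB.pack (fun x : measurableTypeR R => (x : R) + y : measurableTypeR R)
    (isMeasurableFun.Build _ _ _ _ _ mf).
apply: (lebesgue_measure_unique (mu := pushforward lebesgue_measure F)) => //.
move=> _ [[a b]] _ <-; rewrite /pushforward.
rewrite [X in _ = lebesgue_measure X](_ : _ = `]a - y, b - y]%classic).
  by rewrite !lebesgue_measure_itv/= !lte_fin ltrBlDr subrK; case: ifP => // _;
    rewrite -!EFinD; congr EFin; lra.
by apply/seteqP; split=> x /=; rewrite !in_itv/= ltrBlDr lerBrDr.
Qed.

End measure_preserving.

(** * Measurability through real coordinates *)

Section quaternionic_measurability.
Context (R : realType).

Lemma measurable_qcoord c : measurable_fun setT (@qcoord R c).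
Proof.
have mR (f : quat R -> measurableTypeR R) :
    measurable_fun setT f -> measurable_fun setT (f : quat R -> R) by [].
case: c => -[|[|[|[|//]]]] Hc; rewrite /qcoord /=; apply: mR.
- exact: (measurableT_comp measurable_fst measurable_fst).
- exact: (measurableT_comp measurable_snd measurable_fst).
- exact: (measurableT_comp measurable_fst measurable_snd).
- exact: (measurableT_comp measurable_snd measurable_snd).
Qed.

Lemma quat_qcoord (q : quat R) : q = mkquat (qcoord (inord 0) q)
  (qcoord (inord 1) q) (qcoord (inord 2) q) (qcoord (inord 3) q).
Proof. by case: q => [[a b] [c d]]; rewrite /qcoord !inordK. Qed.

Lemma quat_eqP (p q : quat R) : (forall c, qcoord c p = qcoord c q) -> p = q.
Proof. by move=> pq; rewrite (quat_qcoord p) (quat_qcoord q) !pq. Qed.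

Lemma measurable_fun_quat d (T : measurableType d) (f : T -> quat R) :
  (forall c, measurable_fun setT (fun x => qcoord c (f x))) ->
  measurable_fun setT f.
Proof.
move=> mf; rewrite (_ : f = fun x => mkquat (qcoord (inord 0) (f x))
  (qcoord (inord 1) (f x)) (qcoord (inord 2) (f x)) (qcoord (inord 3) (f x))).
  by apply: measurable_fun_pair; apply: measurable_fun_pair; exact: mf.
by apply/funext => x; rewrite -quat_qcoord.
Qed.

Lemma measurable_fun_quatn d (T : measurableType d) n
    (f : T -> n.-tuple (quat R)) :
  (forall j c, measurable_fun setT (fun x => qcoord c (tnth (f x) j))) ->
  measurable_fun setT f.
Proof.
move=> mf; apply/measurable_fun_tnthP => j.
by apply: measurable_fun_quat => c; exact: mf.
Qed.

Lemma measurable_hcoord n (j : 'I_n) c :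
  measurable_fun setT (fun z : n.-tuple (quat R) => qcoord c (tnth z j)).
Proof.
apply: (measurableT_comp (measurable_qcoord c)); exact: measurable_tnth.
Qed.

Lemma qcoordD c (p q : quat R) : qcoord c (p + q) = qcoord c p + qcoord c q.
Proof. by case: c => -[|[|[|[|//]]]] Hc. Qed.

Lemma qcoordN c (p : quat R) : qcoord c (- p) = - qcoord c p.
Proof. by case: c => -[|[|[|[|//]]]] Hc. Qed.

Lemma qcoord0 c : qcoord c (0 : quat R) = 0.
Proof. by case: c => -[|[|[|[|//]]]] Hc. Qed.

End quaternionic_measurability.

(** * Translation invariance of Lebesgue measure on quaternionic space *)

Section translations.
Context (R : realType).

Definition hadd n (z w : n.-tuple (quat R)) : n.-tuple (quat R) :=
  [tuple tnth z j + tnth w j | j < n].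

Definition hopp n (z : n.-tuple (quat R)) : n.-tuple (quat R) :=
  [tuple - tnth z j | j < n].

Lemma quat_leb_shift (y : quat R) : measure_preserving (quat_leb R) (+%R^~ y).
Proof.
case: y => [[a b] [c d]].
have := measure_preserving_prod
  (measure_preserving_prod (measure_preserving_shift a) (measure_preserving_shift b))
  (measure_preserving_prod (measure_preserving_shift c) (measure_preserving_shift d)).
exact.
Qed.

Lemma tuple_leb_shift n (y : n.-tuple (quat R)) :
  measure_preserving (tuple_measure (quat_leb R) n) ((@hadd n)^~ y).
Proof.
elim: n y => [|n IHn] y.
  split=> [|A mA].
    rewrite (_ : _^~ y = id); first exact: measurable_id.
    by apply/funext => z; rewrite (tuple0 z) (tuple0 (hadd _ _)).
  rewrite (_ : _ @^-1` A = A)//; apply/seteqP; split=> z /=;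
    by rewrite (tuple0 z) (tuple0 (hadd _ _)).
have mh : measurable_fun setT ((@hadd n.+1)^~ y).
  apply: measurable_fun_quatn => j c.
  rewrite (_ : (fun x => _) = fun x => qcoord c (tnth x j) + qcoord c (tnth y j)).
    by apply: measurable_funD => //; exact: measurable_hcoord.
  by apply/funext => x; rewrite tnth_mktuple qcoordD.
split=> // A mA; rewrite /= /tcons_measure /pushforward.
have [_ H] := measure_preserving_prod (quat_leb_shift (thead y))
  (IHn [tuple of behead y]).
apply: etrans (H (@tcons _ _ n @^-1` A) _); last first.
  by rewrite -[X in measurable X]setTI; exact: measurable_tcons.
(* Through [tcons] a translation splits into one of the head and one of the tail, so it is a product
   map. *)
have E x z : hadd (tcons (x, z)) y =
    tcons (x + thead y, hadd z [tuple of behead y]).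
  apply: eq_from_tnth => i; rewrite tnth_mktuple.
  case: (unliftP ord0 i) => [j ->|->]; rewrite /tcons ?tnthS ?tnth0//=.
  by rewrite tnth_mktuple tnth_behead; congr (_ + tnth y _); apply/val_inj => /=;
    rewrite inordK// ltnS.
rewrite /prod_measure; congr ((_ \x _)%E _).
by apply/seteqP; split=> -[x z]; rewrite /preimage/= E.
Qed.

End translations.

(** * Invariance of the surface measure under isometries *)

Section sphere_isometries.
Context (R : realType) (n : nat).
Notation quatn := (n.+1.-tuple (quat R)).

(** Homogeneity and [isom_hnorm] give compatibility with cones over the sphere. [isom_hadd] packs
    additivity and surjectivity in the form that the volume argument uses: translating the image by
    [y] amounts to translating the source by [T' y]. *)
Record sphere_isometry (T : quatn -> quatn) : Prop := SphereIsometry {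
  isom_measurable : measurable_fun setT T;
  isom_hnorm : forall z, hnorm (T z) = hnorm z;
  isom_hscale : forall r z, T (hscale r z) = hscale r (T z);
  isom_hadd : exists T' : quatn -> quatn,
    forall x y, T (hadd x (T' y)) = hadd (T x) y }.

Lemma haddC (x y : quatn) : hadd x y = hadd y x.
Proof. by apply: eq_from_tnth => j; rewrite !tnth_mktuple addrC. Qed.

Lemma haddK (x y : quatn) : hadd (hadd x y) (hopp y) = x.
Proof. by apply: eq_from_tnth => j; rewrite !tnth_mktuple addrK. Qed.

Lemma hoppK (x : quatn) : hopp (hopp x) = x.
Proof. by apply: eq_from_tnth => j; rewrite !tnth_mktuple opprK. Qed.

Lemma hoppD (x y : quatn) : hopp (hadd x y) = hadd (hopp x) (hopp y).
Proof. by apply: eq_from_tnth => j; rewrite !tnth_mktuple opprD. Qed.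

Lemma measurable_hadd d (X : measurableType d) (f g : X -> quatn) :
  measurable_fun setT f -> measurable_fun setT g ->
  measurable_fun setT (fun x => hadd (f x) (g x)).
Proof.
move=> mf mg; apply: measurable_fun_quatn => j c.
rewrite (_ : (fun _ => _) =
    fun x => qcoord c (tnth (f x) j) + qcoord c (tnth (g x) j)).
  by apply: measurable_funD;
    [exact: (measurableT_comp (measurable_hcoord j c) mf)|
     exact: (measurableT_comp (measurable_hcoord j c) mg)].
by apply/funext => x; rewrite tnth_mktuple qcoordD.
Qed.

Lemma measurable_hopp d (X : measurableType d) (f : X -> quatn) :
  measurable_fun setT f -> measurable_fun setT (fun x => hopp (f x)).
Proof.
move=> mf; apply: measurable_fun_quatn => j c.
rewrite (_ : (fun _ => _) = fun x => - qcoord c (tnth (f x) j)).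
  by apply: measurable_funN;
    exact: (measurableT_comp (measurable_hcoord j c) mf).
by apply/funext => x; rewrite tnth_mktuple qcoordN.
Qed.

Lemma preimage_measurable d1 d2 (X : measurableType d1) (Y : measurableType d2)
  (f : X -> Y) A : measurable_fun setT f -> measurable A -> measurable (f @^-1` A).
Proof. by move=> mf mA; rewrite -[X in measurable X]setTI; exact: mf. Qed.

Section shift_invariant_measure.
Variable leb : {sigma_finite_measure set quatn -> \bar R}.
Hypothesis leb_shift : forall y, measure_preserving leb ((@hadd R n.+1)^~ y).

(* Fubini for the set {(x, y) : T x \in A, T x + y \in B}, once translating
   in y and once in x: this determines the image of the measure under T up to
   a factor, which the unit ball shows to be 1. *)
Lemma isom_double_count (T : quatn -> quatn) (A B : set quatn) :
  sphere_isometry T -> measurable A -> measurable B ->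
  (leb (T @^-1` A) * leb B = leb (T @^-1` B) * leb (@hopp _ _ @^-1` A))%E.
Proof.
move=> [mT _ _ [T' TT']] mA mB.
have mpa : measurable (T @^-1` A) by exact: preimage_measurable.
have mpb : measurable (T @^-1` B) by exact: preimage_measurable.
pose f (p : quatn * quatn) : \bar R :=
  (\1_(T @^-1` A) p.1 * \1_B (hadd (T p.1) p.2))%:E.
pose g (p : quatn * quatn) : \bar R :=
  (\1_(T @^-1` B) p.1 * \1_A (hadd (T p.1) (hopp p.2)))%:E.
have mT1 : measurable_fun setT (fun p : quatn * quatn => T p.1).
  exact: measurableT_comp.
have mf : measurable_fun setT f.
  apply/measurable_EFinP; apply: measurable_funM.
    by apply: measurableT_comp => //; exact: measurable_indic.
  apply: (measurableT_comp (measurable_indic mB)).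
  by apply: measurable_hadd.
have mg : measurable_fun setT g.
  apply/measurable_EFinP; apply: measurable_funM.
    by apply: measurableT_comp => //; exact: measurable_indic.
  apply: (measurableT_comp (measurable_indic mA)).
  by apply: measurable_hadd => //; exact: measurable_hopp.
have f0 p : (0 <= f p)%E by rewrite lee_fin mulr_ge0.
have g0 p : (0 <= g p)%E by rewrite lee_fin mulr_ge0.
have shiftE y C : measurable C -> leb ((@hadd _ _)^~ y @^-1` C) = leb C.
  by have [_] := leb_shift y; exact.
have intI (P Q : set quatn) : measurable P -> measurable Q ->
    (\int[leb]_x (\1_P x * \1_Q x)%:E = leb (P `&` Q))%E.
  move=> mP mQ; transitivity (\int[leb]_x (\1_(P `&` Q) x)%:E)%E.
    by apply: eq_integral => x _; rewrite indicI.
  by rewrite integral_indic ?setIT//; exact: measurableI.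
have step1 : (\int[leb]_x \int[leb]_y f (x, y) = leb (T @^-1` A) * leb B)%E.
  transitivity (\int[leb]_x ((\1_(T @^-1` A) x)%:E * leb B))%E.
    apply: eq_integral => x _; rewrite /f/=.
    under eq_integral do rewrite EFinM.
    rewrite ge0_integralZl//; last first.
      by apply/measurable_EFinP/(measurableT_comp (measurable_indic mB));
        exact: measurable_hadd.
    congr (_ * _)%E; rewrite -(shiftE (T x))//.
    set C := _ @^-1` _; rewrite -(setIT C) -integral_indic//; last first.
      exact: (preimage_measurable (leb_shift _).1).
    by apply: eq_integral => y _; rewrite haddC.
  rewrite ge0_integralZr//; last exact/measurable_EFinP.
  by rewrite integral_indic// setIT.
have step2 : (\int[leb]_x \int[leb]_y g (x, y) =
    leb (T @^-1` B) * leb (@hopp _ _ @^-1` A))%E.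
  have mhA : measurable (@hopp R n.+1 @^-1` A).
    by apply: preimage_measurable => //; exact: measurable_hopp.
  transitivity (\int[leb]_x ((\1_(T @^-1` B) x)%:E * leb (@hopp _ _ @^-1` A)))%E.
    apply: eq_integral => x _; rewrite /g/=.
    under eq_integral do rewrite EFinM.
    rewrite ge0_integralZl//; last first.
      by apply/measurable_EFinP/(measurableT_comp (measurable_indic mA));
        apply: measurable_hadd => //; exact: measurable_hopp.
    congr (_ * _)%E; rewrite -(shiftE (hopp (T x)))//.
    set C := _ @^-1` _; rewrite -(setIT C) -integral_indic//; last first.
      exact: (preimage_measurable (leb_shift _).1).
    apply: eq_integral => y _.
    by rewrite (_ : hadd _ _ = hopp (hadd y (hopp (T x))))// hoppD hoppK haddC.
  rewrite ge0_integralZr//; last exact/measurable_EFinP.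
  by rewrite integral_indic// setIT.
apply: (etrans (esym step1)); apply: (etrans _ step2).
apply: (etrans (fubini_tonelli f mf f0)).
apply: (etrans _ (esym (fubini_tonelli g mg g0))).
apply: eq_integral => y _; rewrite /f /g/=.
have mTy : measurable_fun setT (fun x => hadd (T x) y) by exact: measurable_hadd.
have mTNy : measurable_fun setT (fun x => hadd (T x) (hopp y)).
  exact: measurable_hadd.
rewrite (intI _ ((fun x => hadd (T x) y) @^-1` B))//; last exact: preimage_measurable.
rewrite (intI _ ((fun x => hadd (T x) (hopp y)) @^-1` A))//; last exact: preimage_measurable.
(* For fixed [y], replacing x by x + T' y turns the conditions T x in [B], T x - y in [A] into T x +
   y in [B], T x in [A]. *)
rewrite -[RHS](shiftE (T' y)); last by apply: measurableI => //; exact: preimage_measurable.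
by congr (leb _); apply/seteqP; split=> x; rewrite /preimage/= TT' haddK => -[].
Qed.

End shift_invariant_measure.

Lemma isom_id : sphere_isometry id.
Proof. by split=> //; exists id. Qed.

Lemma isom_comp T1 T2 : sphere_isometry T1 -> sphere_isometry T2 ->
  sphere_isometry (T1 \o T2).
Proof.
move=> [m1 n1 s1 [T1' a1]] [m2 n2 s2 [T2' a2]]; split.
- exact: measurableT_comp.
- by move=> z /=; rewrite n1 n2.
- by move=> r z /=; rewrite s2 s1.
- by exists (T2' \o T1') => x y /=; rewrite a2 a1.
Qed.

(** Double counting for [T] and for the identity gives leb (T^-1 C) leb B = leb B leb (- C) = leb C
    leb B, and [leb B] cancels. When [B] is null, both sets are null as subsets of [B]. *)
Lemma isom_preserving (leb : {sigma_finite_measure set quatn -> \bar R})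
    (T : quatn -> quatn) (B C : set quatn) :
  (forall y, measure_preserving leb ((@hadd R n.+1)^~ y)) ->
  sphere_isometry T -> measurable B -> measurable C -> C `<=` B ->
  (leb B < +oo)%E -> T @^-1` B = B -> leb (T @^-1` C) = leb C.
Proof.
move=> leb_shift iT mB mC CB Bfin TB.
have mTC : measurable (T @^-1` C) by apply: preimage_measurable => //; exact: isom_measurable iT.
have TCB : T @^-1` C `<=` B by rewrite -TB => z /CB.
have [B0|B0] := eqVneq (leb B) 0%E.
  have z0 D : measurable D -> D `<=` B -> leb D = 0%E.
    move=> mD DB; apply/eqP; rewrite eq_le measure_ge0 andbT -B0.
    by apply: le_measure => //; rewrite inE.
  by rewrite !z0.
have := isom_double_count leb_shift iT mC mB.
have := isom_double_count leb_shift isom_id mC mB.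
rewrite TB !preimage_id => <- E.
have Bf : leb B \is a fin_num by rewrite ge0_fin_numE.
have Bp : (0 < leb B)%E by rewrite lt0e B0 measure_ge0.
by apply/eqP; rewrite eq_le -(lee_pmul2r Bf Bp) -[X in _ && X](lee_pmul2r Bf Bp) /= E lexx.
Qed.

(** Read off from finiteness of the surface measure, since the factor 4 n + 4 is positive. *)
Lemma punctured_ball_fin : (hleb R n (@punctured_ball R n) < +oo)%E.
Proof.
have := surface_measure_fin R n; rewrite /surface_measure preimage_setT setTI.
move: (hleb R n) => leb; have := measure_ge0 leb (@punctured_ball R n).
case: (leb _) => [x _ _|_|//]; first by rewrite ltry.
by rewrite gt0_muley// lte_fin ltr0n addn4.
Qed.

(** Since [T] commutes with [radial_proj], the truncated cone over T^-1 A is the preimage of the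
    truncated cone over [A]. *)
Lemma isom_surface_measure T A : sphere_isometry T -> measurable A ->
  surface_measure R n (T @^-1` A) = surface_measure R n A.
Proof.
move=> iT mA; rewrite /surface_measure; congr (_ * _)%E.
have TB : T @^-1` (@punctured_ball R n) = @punctured_ball R n.
  by apply/seteqP; split=> z; rewrite /preimage/punctured_ball/= (isom_hnorm iT).
have -> : @radial_proj R n @^-1` (T @^-1` A) `&` @punctured_ball R n =
    T @^-1` (@radial_proj R n @^-1` A `&` @punctured_ball R n).
  rewrite [RHS]preimage_setI TB; congr (_ `&` _); apply/seteqP; split=> z;
  by rewrite /preimage/radial_proj/= (isom_hnorm iT) (isom_hscale iT).
apply: (isom_preserving (B := @punctured_ball R n)) => //.
- by move=> y; exact: tuple_leb_shift.
- exact: measurable_punctured_ball.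
- apply: measurableI; last exact: measurable_punctured_ball.
  by apply: preimage_measurable => //; exact: measurable_radial_proj.
- exact: punctured_ball_fin.
Qed.

End sphere_isometries.

(** * Quaternions as pairs of complex numbers *)

Section quaternion_algebra.
Local Notation "x ^*" := (conjc x) : ring_scope.
Context (R : realType).
Local Open Scope complex_scope.
Implicit Types (p q : quat R) (x y : R[i]).

Lemma complex_eqP x y :
  complex.Re x = complex.Re y -> complex.Im x = complex.Im y -> x = y.
Proof. by case: x y => [a b] [c d] /= -> ->. Qed.

Lemma qmulE p q : p * q = mkquat
  (p.1.1 * q.1.1 - p.1.2 * q.1.2 - p.2.1 * q.2.1 - p.2.2 * q.2.2)
  (p.1.1 * q.1.2 + p.1.2 * q.1.1 + p.2.1 * q.2.2 - p.2.2 * q.2.1)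
  (p.1.1 * q.2.1 - p.1.2 * q.2.2 + p.2.1 * q.1.1 + p.2.2 * q.1.2)
  (p.1.1 * q.2.2 + p.1.2 * q.2.1 - p.2.1 * q.1.2 + p.2.2 * q.1.1).
Proof. by case: p q => [[a b] [c d]] [[a' b'] [c' d']]. Qed.

Lemma qaddE p q : p + q =
  mkquat (p.1.1 + q.1.1) (p.1.2 + q.1.2) (p.2.1 + q.2.1) (p.2.2 + q.2.2).
Proof. by []. Qed.

Lemma qoppE p : - p = mkquat (- p.1.1) (- p.1.2) (- p.2.1) (- p.2.2).
Proof. by []. Qed.

Lemma mkquat_eq (a b c d a' b' c' d' : R) :
  a = a' -> b = b' -> c = c' -> d = d' -> mkquat a b c d = mkquat a' b' c' d'.
Proof. by move=> -> -> -> ->. Qed.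

Definition qreal (r : R) : quat R := mkquat r 0 0 0.

Definition qnsq q : R := q.1.1 ^+ 2 + q.1.2 ^+ 2 + q.2.1 ^+ 2 + q.2.2 ^+ 2.

Lemma qnsq_ge0 q : 0 <= qnsq q.
Proof. by rewrite /qnsq !addr_ge0// sqr_ge0. Qed.

Lemma qnormE q : qnorm q ^+ 2 = qnsq q.
Proof.
have E : \sum_(c < 4) qcoord c q ^+ 2 = qnsq q.
  by rewrite !big_ord_recl big_ord0 /qcoord/= addr0 !addrA.
by rewrite /qnorm E sqr_sqrtr// qnsq_ge0.
Qed.

Ltac quat_ring := apply: mkquat_eq => /=; ring.

Lemma qconjM p q : qconj (p * q) = qconj q * qconj p.
Proof. rewrite !qmulE /qconj/=; quat_ring. Qed.

Lemma qconjD p q : qconj (p + q) = qconj p + qconj q.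
Proof. rewrite !qaddE /qconj/=; quat_ring. Qed.

Lemma qconj0 : qconj 0 = 0 :> quat R.
Proof. by rewrite /qconj/= !oppr0. Qed.

Lemma qconjK q : qconj (qconj q) = q.
Proof. by case: q => [[a b] [c d]]; rewrite /qconj/= !opprK. Qed.

Lemma qconj_sum I r (P : pred I) (F : I -> quat R) :
  qconj (\sum_(i <- r | P i) F i) = \sum_(i <- r | P i) qconj (F i).
Proof. by rewrite (big_morph _ qconjD qconj0). Qed.

Lemma qmul_conj q : q * qconj q = qreal (qnsq q).
Proof. rewrite qmulE /qconj/qreal/qnsq/=; quat_ring. Qed.

Lemma qconj_mul q : qconj q * q = qreal (qnsq q).
Proof. rewrite qmulE /qconj/qreal/qnsq/=; quat_ring. Qed.

Lemma qnsqM p q : qnsq (p * q) = qnsq p * qnsq q.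
Proof. rewrite qmulE /qnsq/=; ring. Qed.

Lemma qnsq_conj q : qnsq (qconj q) = qnsq q.
Proof. rewrite /qnsq/=; ring. Qed.

Lemma qreal_comm r q : qreal r * q = q * qreal r.
Proof. rewrite !qmulE /qreal/=; quat_ring. Qed.

Lemma qscaleE r q : qscale r q = qreal r * q.
Proof. rewrite qmulE /qscale/qreal/=; quat_ring. Qed.

Lemma qrealM r s : qreal (r * s) = qreal r * qreal s.
Proof. rewrite qmulE /qreal/=; quat_ring. Qed.

Lemma qrealD r s : qreal (r + s) = qreal r + qreal s.
Proof. rewrite qaddE /qreal/=; quat_ring. Qed.

Lemma qreal_sum I r (P : pred I) (F : I -> R) :
  qreal (\sum_(i <- r | P i) F i) = \sum_(i <- r | P i) qreal (F i).
Proof. by rewrite (big_morph _ qrealD (erefl _)). Qed.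

Lemma qconj_real r : qconj (qreal r) = qreal r.
Proof. rewrite /qconj/qreal/=; quat_ring. Qed.

(* q = qc1 q + qc2 q * j *)
Definition qc1 q : R[i] := (q.1.1 : R) +i* (q.1.2 : R).
Definition qc2 q : R[i] := (q.2.1 : R) +i* (q.2.2 : R).
Definition cquat x y : quat R :=
  mkquat (complex.Re x) (complex.Im x) (complex.Re y) (complex.Im y).

Lemma qc1D p q : qc1 (p + q) = qc1 p + qc1 q.
Proof. by []. Qed.

Lemma qc1_0 : qc1 0 = 0.
Proof. by []. Qed.

Lemma qc1_sum I r (P : pred I) (F : I -> quat R) :
  qc1 (\sum_(i <- r | P i) F i) = \sum_(i <- r | P i) qc1 (F i).
Proof. by rewrite (big_morph _ qc1D qc1_0). Qed.

Lemma qc2D p q : qc2 (p + q) = qc2 p + qc2 q.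
Proof. by []. Qed.

Lemma qc1M p q : qc1 (p * q) = qc1 p * qc1 q - qc2 p * (qc2 q)^*.
Proof. by rewrite qmulE /qc1 /qc2; apply: complex_eqP => /=; ring. Qed.

Lemma qc1_conj q : qc1 (qconj q) = (qc1 q)^*.
Proof. by []. Qed.

Lemma qc2_conj q : qc2 (qconj q) = - qc2 q.
Proof. by []. Qed.

Lemma qc1_cquat x y : qc1 (cquat x y) = x. Proof. by case: x. Qed.
Lemma qc2_cquat x y : qc2 (cquat x y) = y. Proof. by case: y. Qed.

Lemma qnsq_qc q : (qnsq q)%:C = qc1 q * (qc1 q)^* + qc2 q * (qc2 q)^*.
Proof. by rewrite /qnsq /qc1 /qc2; apply: complex_eqP => /=; ring. Qed.

Lemma re_qc q : (2 * (q.1.1 : R))%:C = qc1 q + (qc1 q)^*.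
Proof. by rewrite /qc1; apply: complex_eqP => /=; ring. Qed.

Lemma re_qmulC p q : (p * q).1.1 = (q * p).1.1 :> R.
Proof. by rewrite !qmulE /=; ring. Qed.

End quaternion_algebra.

(** * Quaternionic space, multiplications by units and reflections *)

Section quaternionic_space.
Context (R : realType) (n : nat).
Notation quatn := (n.+1.-tuple (quat R)).
Implicit Types (z w : quatn) (q : quat R).

Definition hlmul q z : quatn := [tuple q * tnth z j | j < n.+1].
Definition hrmul q z : quatn := [tuple tnth z j * q | j < n.+1].
Definition hnsq z : R := \sum_(j < n.+1) qnsq (tnth z j).

Lemma hnsq_ge0 z : 0 <= hnsq z.
Proof. by apply: sumr_ge0 => j _; exact: qnsq_ge0. Qed.

Lemma hnormE z : hnorm z = Num.sqrt (hnsq z).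
Proof. by rewrite /hnorm; under eq_bigr do rewrite qnormE. Qed.

Lemma hnorm_sq z : hnorm z ^+ 2 = hnsq z.
Proof. by rewrite hnormE sqr_sqrtr// hnsq_ge0. Qed.

Lemma hdotC z w : hdot z w = qconj (hdot w z).
Proof. by rewrite /hdot qconj_sum; apply: eq_bigr => j _; rewrite qconjM qconjK. Qed.

Lemma hdotDl x y z : hdot (hadd x y) z = hdot x z + hdot y z.
Proof. by rewrite /hdot -big_split/=; apply: eq_bigr => j _; rewrite tnth_mktuple mulrDl. Qed.

Lemma hdotDr x y z : hdot z (hadd x y) = hdot z x + hdot z y.
Proof. by rewrite hdotC hdotDl qconjD -!hdotC. Qed.

Lemma hdotNl x z : hdot (hopp x) z = - hdot x z.
Proof. by rewrite /hdot -sumrN; apply: eq_bigr => j _; rewrite tnth_mktuple mulNr. Qed.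

Lemma hdot_lmull q x z : hdot (hlmul q x) z = q * hdot x z.
Proof. by rewrite /hdot mulr_sumr; apply: eq_bigr => j _; rewrite tnth_mktuple mulrA. Qed.

Lemma hdot_lmulr q x z : hdot x (hlmul q z) = hdot x z * qconj q.
Proof. by rewrite hdotC hdot_lmull qconjM -hdotC. Qed.

Lemma hdot_self z : hdot z z = qreal (hnsq z).
Proof. by rewrite /hdot /hnsq qreal_sum; apply: eq_bigr => j _; rewrite qmul_conj. Qed.

Lemma hscaleE r z : hscale r z = hlmul (qreal r) z.
Proof. by apply: eq_from_tnth => j; rewrite !tnth_mktuple qscaleE. Qed.

Lemma hdot_rmul q x z : qnsq q = 1 -> hdot (hrmul q x) (hrmul q z) = hdot x z.
Proof.
move=> q1; rewrite /hdot; apply: eq_bigr => j _; rewrite !tnth_mktuple qconjM.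
by rewrite -mulrA (mulrA q) qmul_conj q1 mul1r.
Qed.

Lemma eq_hnsq (x y : quatn) : hdot x x = hdot y y -> hnsq x = hnsq y.
Proof. by rewrite !hdot_self => -[]. Qed.

Lemma eq_hnorm (x y : quatn) : hdot x x = hdot y y -> hnorm x = hnorm y.
Proof. by move/eq_hnsq; rewrite !hnormE => ->. Qed.

Lemma measurable_qmul d (T : measurableType d) (f g : T -> quat R) :
  (forall c, measurable_fun setT (fun x => qcoord c (f x))) ->
  (forall c, measurable_fun setT (fun x => qcoord c (g x))) ->
  forall c, measurable_fun setT (fun x => qcoord c (f x * g x)).
Proof.
move=> mf mg c.
pose F i j := fun x => qcoord (inord i) (f x) * qcoord (inord j) (g x).
have mF i j : measurable_fun setT (F i j).
  by apply: measurable_funM; [exact: mf|exact: mg].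
have cE q : [/\ (q.1.1 : R) = qcoord (inord 0) q, (q.1.2 : R) = qcoord (inord 1) q,
    (q.2.1 : R) = qcoord (inord 2) q & (q.2.2 : R) = qcoord (inord 3) q].
  by rewrite /qcoord !inordK.
case: c => -[|[|[|[|//]]]] Hc.
- rewrite (_ : (fun _ => _) = fun x => F 0 0 x - F 1 1 x - F 2 2 x - F 3 3 x).
    by do ![exact: mF|apply: measurable_funB|apply: measurable_funD].
  apply/funext => x; rewrite qmulE /qcoord/=.
  by have [-> -> -> ->] := cE (f x); have [-> -> -> ->] := cE (g x).
- rewrite (_ : (fun _ => _) = fun x => F 0 1 x + F 1 0 x + F 2 3 x - F 3 2 x).
    by do ![exact: mF|apply: measurable_funB|apply: measurable_funD].
  apply/funext => x; rewrite qmulE /qcoord/=.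
  by have [-> -> -> ->] := cE (f x); have [-> -> -> ->] := cE (g x).
- rewrite (_ : (fun _ => _) = fun x => F 0 2 x - F 1 3 x + F 2 0 x + F 3 1 x).
    by do ![exact: mF|apply: measurable_funB|apply: measurable_funD].
  apply/funext => x; rewrite qmulE /qcoord/=.
  by have [-> -> -> ->] := cE (f x); have [-> -> -> ->] := cE (g x).
- rewrite (_ : (fun _ => _) = fun x => F 0 3 x + F 1 2 x - F 2 1 x + F 3 0 x).
    by do ![exact: mF|apply: measurable_funB|apply: measurable_funD].
  apply/funext => x; rewrite qmulE /qcoord/=.
  by have [-> -> -> ->] := cE (f x); have [-> -> -> ->] := cE (g x).
Qed.

Lemma measurable_qconj d (T : measurableType d) (f : T -> quat R) :
  (forall c, measurable_fun setT (fun x => qcoord c (f x))) ->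
  forall c, measurable_fun setT (fun x => qcoord c (qconj (f x))).
Proof.
move=> mf c.
have [s sE] : exists s : R, forall q : quat R, qcoord c (qconj q) = s * qcoord c q.
  by case: c => -[|[|[|[|//]]]] Hc; [exists 1|exists (-1)..] => q;
    rewrite /qcoord/= ?mul1r ?mulN1r.
under eq_fun do rewrite sE; exact: measurable_funM.
Qed.

Lemma measurable_hdot d (T : measurableType d) (f g : T -> quatn) :
  measurable_fun setT f -> measurable_fun setT g ->
  forall c, measurable_fun setT (fun x => qcoord c (hdot (f x) (g x))).
Proof.
move=> mf mg c.
have E x : qcoord c (hdot (f x) (g x)) =
    \sum_(j < n.+1) qcoord c (tnth (f x) j * qconj (tnth (g x) j)).
  by rewrite /hdot (big_morph _ (@qcoordD R c) (@qcoord0 R c)).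
under eq_fun do rewrite E.
apply: measurable_sum => j; apply: measurable_qmul => c'.
  exact: (measurableT_comp (measurable_hcoord j c') mf).
by apply: measurable_qconj => c'';
  exact: (measurableT_comp (measurable_hcoord j c'') mg).
Qed.

Lemma measurable_hlmul d (T : measurableType d) (f : T -> quat R) (g : T -> quatn) :
  (forall c, measurable_fun setT (fun x => qcoord c (f x))) ->
  measurable_fun setT g -> measurable_fun setT (fun x => hlmul (f x) (g x)).
Proof.
move=> mf mg; apply: measurable_fun_quatn => j c.
under eq_fun do rewrite tnth_mktuple.
apply: measurable_qmul => // {}c.
exact: (measurableT_comp (measurable_hcoord j c) mg).
Qed.

Lemma isom_lmul q : qnsq q = 1 -> sphere_isometry (hlmul q).
Proof.
move=> q1; split.
- exact: measurable_hlmul.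
- move=> z; apply: eq_hnorm; rewrite hdot_lmull hdot_lmulr hdot_self mulrA.
  by rewrite -qreal_comm -mulrA qmul_conj q1 -qrealM mulr1.
- by move=> r z; apply: eq_from_tnth => j; rewrite !tnth_mktuple !qscaleE !mulrA qreal_comm.
- exists (hlmul (qconj q)) => x y; apply: eq_from_tnth => j; rewrite !tnth_mktuple.
  by rewrite mulrDr mulrA qmul_conj q1 mul1r.
Qed.

Lemma isom_rmul q : qnsq q = 1 -> sphere_isometry (hrmul q).
Proof.
move=> q1; split.
- apply: measurable_fun_quatn => j c; under eq_fun do rewrite tnth_mktuple.
  by apply: measurable_qmul => // {}c; exact: measurable_hcoord.
- by move=> z; apply: eq_hnorm; rewrite hdot_rmul.
- by move=> r z; apply: eq_from_tnth => j; rewrite !tnth_mktuple !qscaleE mulrA.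
- exists (hrmul (qconj q)) => x y; apply: eq_from_tnth => j; rewrite !tnth_mktuple.
  by rewrite mulrDl -mulrA qconj_mul q1 mulr1.
Qed.

(** The quaternionic reflection in the hyperplane orthogonal to [w]; for w = 0 the convention 1 / 0
    = 0 makes it the identity. *)
Definition hrefl w x : quatn :=
  hadd x (hlmul (qreal (- 2 / hnsq w) * hdot x w) w).

Lemma hnsq_eq0 w : hnsq w = 0 -> forall j, tnth w j = 0.
Proof.
move=> w0 j; have /eqP := w0; rewrite psumr_eq0; last by move=> i _; exact: qnsq_ge0.
move=> /allP /(_ j (mem_index_enum _)) /eqP; rewrite /qnsq.
case: (tnth w j) => [[a b] [c d]] /= h.
have [ha hb hc hd] : [/\ a = 0, b = 0, c = 0 & d = 0] :> Prop.
  have := (sqr_ge0 (a : R), sqr_ge0 (b : R), sqr_ge0 (c : R), sqr_ge0 (d : R)).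
  move=> [[[ha hb] hc] hd].
  by split; apply/eqP; rewrite -sqrf_eq0; apply/eqP; lra.
by rewrite ha hb hc hd.
Qed.

Lemma hdot_refl w x y : hdot (hrefl w x) (hrefl w y) = hdot x y.
Proof.
rewrite /hrefl; have [w0|w0] := eqVneq (hnsq w) 0.
  rewrite w0 invr0 mulr0.
  have E u : hadd u (hlmul (qreal 0 * hdot u w) w) = u.
    by apply: eq_from_tnth => j; rewrite !tnth_mktuple mul0r mul0r addr0.
  by rewrite !E.
set c := - 2 / _; rewrite hdotDl !hdotDr !hdot_lmull !hdot_lmulr hdot_self.
rewrite qconjM -(hdotC w y) qconj_real.
set X := hdot x w; set Y := hdot w y; set D := hdot x y.
rewrite !mulrA -(qreal_comm (hnsq w)) !mulrA -!qrealM.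
rewrite -[X * Y * qreal c]qreal_comm mulrA -!addrA.
rewrite -[_ * X * Y * qreal c]qreal_comm !mulrA -!qrealM -!mulrDl -!qrealD.
(* The correction terms are the same product with real coefficients c, c and c^2 |w|^2, and 2 c +
   c^2 |w|^2 = 0 for c = - 2 / |w|^2. *)
rewrite (_ : c + _ = 0); last first.
  rewrite /c; field; exact: w0.
by rewrite (_ : qreal 0 = 0)// !mul0r addr0.
Qed.

Lemma isom_refl w : sphere_isometry (hrefl w).
Proof.
have hD x y : hrefl w (hadd x y) = hadd (hrefl w x) (hrefl w y).
  apply: eq_from_tnth => j; rewrite !tnth_mktuple hdotDl mulrDr mulrDl.
  by rewrite !addrA; congr (_ + _); rewrite -!addrA; congr (_ + _); rewrite addrC.
split.
- apply: measurable_hadd => //; apply: measurable_hlmul => //.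
  by apply: measurable_qmul => // c; exact: measurable_hdot.
- by move=> z; apply: eq_hnorm; rewrite hdot_refl.
- move=> r x; apply: eq_from_tnth => j; rewrite !tnth_mktuple hscaleE hdot_lmull.
  by rewrite !qscaleE mulrDr !mulrA (qreal_comm r (qreal _)).
(* A reflection is an involution, hence its own right inverse. *)
- exists (hrefl w) => x y; rewrite hD; congr hadd.
  have [w0|w0] := eqVneq (hnsq w) 0.
    by apply: eq_from_tnth => j; rewrite !tnth_mktuple (hnsq_eq0 w0) !mulr0 !addr0.
  apply: eq_from_tnth => j; rewrite !tnth_mktuple hdotDl hdot_lmull hdot_self.
  rewrite -addrA -mulrDl mulrDr.
  rewrite -(mulrA _ _ (qreal (hnsq w))) -(qreal_comm (hnsq w)) !mulrA -!qrealM.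
  rewrite -!mulrDl -!qrealD (_ : - 2 / _ + _ = 0); last by field; exact: w0.
  by rewrite (_ : qreal 0 = 0)// !mul0r addr0.
Qed.

End quaternionic_space.

(** * Phase rotations and transitivity of the symplectic isometries *)

Section transitivity.
Local Notation "x ^*" := (conjc x) : ring_scope.
Context (R : realType) (n : nat).
Local Open Scope complex_scope.
Notation quatn := (n.+1.-tuple (quat R)).
Implicit Types (q : quat R).

Definition hbase : quatn := [tuple if j == ord0 then 1 else 0 | j < n.+1].

(** It rotates only the first of the 2 n + 2 complex coordinates. In general it does not preserve
    [hdot], but it preserves the surface measure and isolates the dependence on that coordinate. *)
Definition hphase (x : R[i]) (z : quatn) : quatn :=
  [tuple if j == ord0 then cquat (x * qc1 (tnth z j)) (qc2 (tnth z j))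
         else tnth z j | j < n.+1].

Lemma qcoord_sq_le c q : qcoord c q ^+ 2 <= qnsq q.
Proof.
rewrite -qnormE /qnorm sqr_sqrtr; last by apply: sumr_ge0 => i _; exact: sqr_ge0.
by rewrite (bigD1 c)//= lerDl; apply: sumr_ge0 => k _; exact: sqr_ge0.
Qed.

Lemma qconjN q : qconj (- q) = - qconj q.
Proof. by case: q => [[a b] [c d]]; apply: mkquat_eq. Qed.

Lemma qnsq_real (r : R) : qnsq (qreal r) = r ^+ 2.
Proof. by rewrite /qnsq/=; ring. Qed.

Lemma isom_phase (x : R[i]) : x * x^* = 1 -> sphere_isometry (hphase x).
Proof.
move=> x1.
have xx : complex.Re x ^+ 2 + complex.Im x ^+ 2 = 1.
  by case: x x1 => a b [] /= <- _; ring.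
have nsqE q : qnsq (cquat (x * qc1 q) (qc2 q)) = qnsq q.
  case: q => [[a b] [c d]]; case: x xx {x1} => [e f] /= ef.
  rewrite /qnsq/=; transitivity ((e ^+ 2 + f ^+ 2) * (a ^+ 2 + b ^+ 2) + c ^+ 2 + d ^+ 2).
    by ring.
  by rewrite ef; ring.
split.
- apply: measurable_fun_quatn => j c; under eq_fun do rewrite tnth_mktuple.
  case: (j == ord0); last exact: measurable_hcoord.
  have mj i : measurable_fun setT (fun z : quatn => qcoord i (tnth z j)).
    exact: measurable_hcoord.
  have cE q : [/\ (q.1.1 : R) = qcoord (inord 0) q, (q.1.2 : R) = qcoord (inord 1) q,
      (q.2.1 : R) = qcoord (inord 2) q & (q.2.2 : R) = qcoord (inord 3) q].
    by rewrite /qcoord !inordK.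
  case: c => -[|[|[|[|//]]]] Hc.
  + rewrite (_ : (fun _ => _) = fun z : quatn => complex.Re x * qcoord (inord 0) (tnth z j)
        - complex.Im x * qcoord (inord 1) (tnth z j)).
      by apply: measurable_funB; apply: measurable_funM.
    apply/funext => z; have [<- <- _ _] := cE (tnth z j).
    by case: x {x1 xx nsqE}.
  + rewrite (_ : (fun _ => _) = fun z : quatn => complex.Re x * qcoord (inord 1) (tnth z j)
        + complex.Im x * qcoord (inord 0) (tnth z j)).
      by apply: measurable_funD; apply: measurable_funM.
    apply/funext => z; have [<- <- _ _] := cE (tnth z j).
    by case: x {x1 xx nsqE}.
  + rewrite (_ : (fun _ => _) = fun z : quatn => qcoord (inord 2) (tnth z j)); first exact: mj.
    by apply/funext => z; have [_ _ <- _] := cE (tnth z j).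
  + rewrite (_ : (fun _ => _) = fun z : quatn => qcoord (inord 3) (tnth z j)); first exact: mj.
    by apply/funext => z; have [_ _ _ <-] := cE (tnth z j).
- move=> z; rewrite !hnormE; congr Num.sqrt; apply: eq_bigr => j _.
  by rewrite tnth_mktuple; case: ifP.
- move=> r z; apply: eq_from_tnth => j; rewrite !tnth_mktuple.
  case: ifP => // _; case: (tnth z j) => [[a b] [c d]]; case: x {x1 xx nsqE} => [e f].
  by apply: mkquat_eq => /=; ring.
- exists (hphase x^*) => y z; apply: eq_from_tnth => j; rewrite /hphase /hadd !tnth_mktuple.
  case: (j == ord0) => //; rewrite qc1D qc2D qc1_cquat qc2_cquat mulrDr mulrA x1 mul1r.
  by case: (tnth z j) (tnth y j) => [[? ?] [? ?]] [[? ?] [? ?]]; case: x {x1 xx nsqE}.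
Qed.

Lemma hnsq_base : hnsq hbase = 1.
Proof.
rewrite /hnsq big_ord_recl big1 ?addr0.
  by rewrite tnth_mktuple/= /qnsq/= expr1n !expr0n/= !addr0.
by move=> j _; rewrite tnth_mktuple/= /qnsq/= !expr0n/= !addr0.
Qed.

Lemma hdot_base z : hdot z hbase = tnth z ord0.
Proof.
rewrite /hdot big_ord_recl big1 ?addr0; last first.
  by move=> j _; rewrite tnth_mktuple/= qconj0 mulr0.
rewrite tnth_mktuple/= (_ : qconj 1 = 1) ?mulr1//.
by rewrite /qconj/= !oppr0.
Qed.

Lemma hdotNr (x y : quatn) : hdot x (hopp y) = - hdot x y.
Proof. by rewrite hdotC hdotNl qconjN -hdotC. Qed.

Lemma hadd_subE (x y : quatn) : hnsq (hadd x (hopp y)) =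
  hnsq x + hnsq y - 2 * (hdot x y).1.1.
Proof.
have: (hdot (hadd x (hopp y)) (hadd x (hopp y))).1.1 =
    hnsq x + hnsq y - 2 * (hdot x y).1.1 :> R.
  rewrite hdotDl !hdotDr !hdotNl !hdotNr opprK !hdot_self (hdotC y x) /=.
  by case: (hdot x y) => [[a ?] [? ?]] /=; ring.
by rewrite hdot_self.
Qed.

(** The reflection in b - d carries [b] to a vector d of the same norm only if <b, d> is real. So d
    is |b| w times the base vector, where w is the phase of the first coordinate of [b]; right
    multiplication by the conjugate of w, which preserves [hdot], then removes w. *)
Lemma sp_transitive (b : quatn) : exists T, [/\ sphere_isometry T,
  (forall x y, hdot (T x) (T y) = hdot x y) & T b = hscale (hnorm b) hbase].
Proof.
set r := hnorm b.
have [w w1 bw] : exists2 w : quat R, qnsq w = 1 &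
    tnth b ord0 = qreal (qnorm (tnth b ord0)) * w.
  have [b0|b0] := eqVneq (qnorm (tnth b ord0)) 0.
    exists 1; first by rewrite /qnsq/= expr1n !expr0n/= !addr0.
    rewrite b0 (_ : qreal 0 = 0)// mul0r; apply: quat_eqP => c; rewrite qcoord0.
    apply/eqP; rewrite -sqrf_eq0 eq_le sqr_ge0 andbT.
    by rewrite (le_trans (qcoord_sq_le _ _))// -qnormE b0 expr0n.
  exists (qreal (qnorm (tnth b ord0))^-1 * tnth b ord0).
    by rewrite qnsqM qnsq_real -qnormE -exprMn mulVf ?expr1n.
  by rewrite mulrA -qrealM divff// mul1r.
pose s := qnorm (tnth b ord0).
pose d := hscale r (hlmul w hbase).
pose v := hadd b (hopp d).
have bd : hdot b d = qreal (r * s).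
  rewrite /d hscaleE !hdot_lmulr hdot_base bw qconj_real -!mulrA.
  by rewrite (mulrA w) qmul_conj w1 mul1r -qrealM mulrC.
have dd : hnsq d = r ^+ 2.
  have : hdot d d = qreal (r ^+ 2).
    rewrite /d hscaleE !hdot_lmulr !hdot_lmull hdot_self hnsq_base qconj_real.
    by rewrite (_ : qreal 1 = 1)// mulr1 -!mulrA (mulrA w) qmul_conj w1 mul1r -qrealM expr2.
  by rewrite hdot_self => -[].
have vE : hnsq v = 2 * (r ^+ 2 - r * s).
  by rewrite hadd_subE dd -hnorm_sq -/r bd/=; ring.
have bv : hdot b v = qreal (r ^+ 2 - r * s).
  rewrite /v hdotDr hdotNr hdot_self bd.
  by rewrite -hnorm_sq -/r; apply: mkquat_eq => //=; rewrite subr0.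
have rb : hrefl v b = d.
  have vv : hlmul (qreal (- 2 / hnsq v) * hdot b v) v = hopp v.
    have [v0|v0] := eqVneq (hnsq v) 0.
      by apply: eq_from_tnth => j; rewrite [LHS]tnth_mktuple [RHS]tnth_mktuple (hnsq_eq0 v0) mulr0 oppr0.
    rewrite bv -qrealM (_ : _ / _ * _ = -1).
      apply: eq_from_tnth => j; rewrite !tnth_mktuple.
      by rewrite (_ : qreal (-1) = -1) ?mulN1r//; apply: mkquat_eq; rewrite ?oppr0.
    by rewrite vE; field; move: v0; rewrite vE mulf_eq0 pnatr_eq0.
  rewrite /hrefl vv; apply: eq_from_tnth => j.
  by rewrite [LHS]tnth_mktuple [tnth (hopp v) j]tnth_mktuple [tnth v j]tnth_mktuple
    [tnth (hopp d) j]tnth_mktuple subKr.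
exists (hrmul (qconj w) \o hrefl v); split.
- by apply: isom_comp; [apply: isom_rmul; rewrite qnsq_conj|exact: isom_refl].
- by move=> x y; rewrite /= hdot_rmul ?qnsq_conj// hdot_refl.
- rewrite /= rb /d; apply: eq_from_tnth => j.
  rewrite !tnth_mktuple !qscaleE; case: ifP => _; rewrite !(mulr1, mulr0, mul0r)//.
  by rewrite -mulrA qmul_conj w1 mulr1.
Qed.

End transitivity.

(** * Integration of bounded functions over the sphere *)

Section sphere_integration.
Local Notation "x ^*" := (conjc x) : ring_scope.
Context (R : realType) (n : nat).
Local Open Scope complex_scope.
Notation quatn := (n.+1.-tuple (quat R)).
Notation sigma := (surface_measure R n).
Notation S := (sphere R n).
Implicit Types (f g : quatn -> R) (F G : quatn -> R[i]).

Lemma sphereP z : S z <-> hnsq z = 1.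
Proof.
rewrite /sphere/= hnormE; split=> [z1|->]; last by rewrite sqrtr1.
by rewrite -(sqr_sqrtr (hnsq_ge0 z)) z1 expr1n.
Qed.

(** Measurability is asked on the whole space, so that the class is stable under ring operations and
    composition with isometries; boundedness is asked only on the sphere, where the coordinates are
    bounded. *)
Definition sphere_bounded f :=
  measurable_fun setT f /\ exists M, forall z, S z -> `|f z| <= M.

Lemma sphere_fin : (sigma S < +oo)%E.
Proof.
apply: le_lt_trans (surface_measure_fin R n).
by apply: le_measure; rewrite ?inE//; exact: measurable_sphere.
Qed.

Lemma sphere_bounded_integrable f : sphere_bounded f ->
  sigma.-integrable S (EFin \o f).
Proof.
move=> [mf [M fM]]; apply: measurable_bounded_integrable.
- exact: measurable_sphere.
- exact: sphere_fin.
- exact: measurable_funTS.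
- exists M; split; first exact: num_real.
  by move=> x Mx z Sz; exact: le_trans (fM _ Sz) (ltW Mx).
Qed.

Lemma sphere_bounded_cst (c : R) : sphere_bounded (fun=> c).
Proof. by split=> //; exists `|c|. Qed.

Lemma sphere_boundedD f g : sphere_bounded f -> sphere_bounded g ->
  sphere_bounded (fun z => f z + g z).
Proof.
move=> [mf [M fM]] [mg [N gN]]; split; first exact: measurable_funD.
by exists (M + N) => z Sz; rewrite (le_trans (ler_normD _ _))// lerD ?fM ?gN.
Qed.

Lemma sphere_boundedM f g : sphere_bounded f -> sphere_bounded g ->
  sphere_bounded (fun z => f z * g z).
Proof.
move=> [mf [M fM]] [mg [N gN]]; split; first exact: measurable_funM.
by exists (M * N) => z Sz; rewrite normrM ler_pM ?fM ?gN.
Qed.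

Lemma sphere_boundedN f : sphere_bounded f -> sphere_bounded (fun z => - f z).
Proof.
move=> [mf [M fM]]; split; first exact: measurable_funN.
by exists M => z Sz; rewrite normrN fM.
Qed.

Lemma sphere_boundedB f g : sphere_bounded f -> sphere_bounded g ->
  sphere_bounded (fun z => f z - g z).
Proof. by move=> bf bg; apply: sphere_boundedD => //; exact: sphere_boundedN. Qed.

Lemma isom_sphere T : sphere_isometry T -> T @^-1` S = S.
Proof.
by move=> iT; apply/seteqP; split=> z; rewrite /preimage/sphere/= (isom_hnorm iT).
Qed.

Lemma sphere_bounded_isom T f : sphere_isometry T -> sphere_bounded f ->
  sphere_bounded (f \o T).
Proof.
move=> iT [mf [M fM]]; split; first by apply: measurableT_comp => //; exact: isom_measurable iT.
by exists M => z Sz; apply: fM; rewrite -(isom_sphere iT) in Sz.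
Qed.

Lemma isom_Rintegral T f : sphere_isometry T -> sphere_bounded f ->
  \int[sigma]_(z in S) f (T z) = \int[sigma]_(z in S) f z.
Proof.
move=> iT bf; rewrite /Rintegral; congr fine.
have mT := isom_measurable iT.
have mf : measurable_fun setT (EFin \o f) by apply/measurable_EFinP; case: bf.
have fi : sigma.-integrable (T @^-1` S) (EFin \o f \o T).
  by rewrite isom_sphere//; exact: (sphere_bounded_integrable (sphere_bounded_isom iT bf)).
have := integral_pushforward mT mf fi (@measurable_sphere R n).
rewrite (isom_sphere iT) => <-.
apply: eq_measure_integral => A mA _; exact: isom_surface_measure.
Qed.

Lemma hdot_CS (x y : quatn) : qnsq (hdot x y) <= hnsq x * hnsq y.
Proof.
have [y0|y0] := eqVneq (hnsq y) 0.
  have -> : hdot x y = 0.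
    by rewrite /hdot big1// => j _; rewrite (hnsq_eq0 y0) qconj0 mulr0.
  by rewrite y0 mulr0 (_ : qnsq 0 = 0)// /qnsq/=; ring.
(* This vector is [x] minus its projection on [y]; its squared norm is |x|^2 - |<x, y>|^2 /
   |y|^2. *)
have := hnsq_ge0 (hadd x (hopp (hlmul (hdot x y * qreal (hnsq y)^-1) y))).
have nE q : hnsq (hlmul q y) = qnsq q * hnsq y.
  by rewrite /hnsq mulr_sumr; apply: eq_bigr => j _; rewrite tnth_mktuple qnsqM.
rewrite hadd_subE nE hdot_lmulr qconjM qconj_real mulrA -(mulrA _ (qreal _)).
rewrite qreal_comm mulrA qmul_conj -qrealM qnsqM qnsq_real /=.
set X := qnsq _; set Y := hnsq y; rewrite -/Y in y0.
have Y0 : 0 < Y by rewrite lt_def y0 hnsq_ge0.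
rewrite (_ : _ - _ = (hnsq x * Y - X) / Y); last by field.
by rewrite pmulr_lge0 ?invr_gt0// subr_ge0.
Qed.

Lemma sphere_bounded_hdot c b : sphere_bounded (fun z => qcoord c (hdot z b)).
Proof.
split; first exact: measurable_hdot.
exists (hnsq b + 1) => z /sphereP z1.
have b0 : 0 <= hnsq b := hnsq_ge0 b.
rewrite -(@ler_pXn2r _ 2)// ?nnegrE// ?addr_ge0// real_normK ?num_real//.
apply: le_trans (qcoord_sq_le _ _) _; apply: le_trans (hdot_CS _ _) _.
by rewrite z1; nra.
Qed.

Lemma sphere_bounded_hcoord c j : sphere_bounded (fun z => qcoord c (tnth z j)).
Proof.
split; first exact: measurable_hcoord.
exists 1 => z /sphereP z1.
rewrite -(@ler_pXn2r _ 2)// ?nnegrE// expr1n real_normK ?num_real//.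
apply: le_trans (qcoord_sq_le _ _) _; rewrite -z1 /hnsq (bigD1 j)//= lerDl.
by apply: sumr_ge0 => i _; exact: qnsq_ge0.
Qed.

Definition csphere_bounded F := sphere_bounded (fun z => complex.Re (F z)) /\
  sphere_bounded (fun z => complex.Im (F z)).

Lemma csphere_bounded_cst (c : R[i]) : csphere_bounded (fun=> c).
Proof. by split; exact: sphere_bounded_cst. Qed.

Lemma csphere_boundedD F G : csphere_bounded F -> csphere_bounded G ->
  csphere_bounded (fun z => F z + G z).
Proof.
move=> [rF iF] [rG iG]; split.
  under eq_fun do rewrite (raddfD (@complex.Re R)).
  exact: sphere_boundedD.
under eq_fun do rewrite (raddfD (@complex.Im R)).
exact: sphere_boundedD.
Qed.

Lemma ReD (x y : R[i]) : complex.Re (x + y) = complex.Re x + complex.Re y.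
Proof. by case: x y => [a b] [c d]. Qed.

Lemma ImD (x y : R[i]) : complex.Im (x + y) = complex.Im x + complex.Im y.
Proof. by case: x y => [a b] [c d]. Qed.

Lemma ReM (x y : R[i]) : complex.Re (x * y) =
  complex.Re x * complex.Re y - complex.Im x * complex.Im y.
Proof. by case: x y => [a b] [c d]. Qed.

Lemma ImM (x y : R[i]) : complex.Im (x * y) =
  complex.Re x * complex.Im y + complex.Im x * complex.Re y.
Proof. by case: x y => [a b] [c d]. Qed.

Lemma csphere_boundedM F G : csphere_bounded F -> csphere_bounded G ->
  csphere_bounded (fun z => F z * G z).
Proof.
move=> [rF iF] [rG iG]; split.
  under eq_fun do rewrite ReM.
  by apply: sphere_boundedB; exact: sphere_boundedM.
under eq_fun do rewrite ImM.
by apply: sphere_boundedD; exact: sphere_boundedM.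
Qed.

Lemma csphere_boundedX F m : csphere_bounded F -> csphere_bounded (fun z => F z ^+ m).
Proof.
move=> bF; elim: m => [|m IHm]; first exact: csphere_bounded_cst.
by under eq_fun do rewrite exprS; exact: csphere_boundedM.
Qed.

Lemma csphere_bounded_conj F : csphere_bounded F -> csphere_bounded (fun z => (F z)^*).
Proof.
move=> [rF iF]; split.
  by rewrite (_ : (fun _ => _) = fun z => complex.Re (F z))//; apply/funext => z; case: (F z).
rewrite (_ : (fun _ => _) = fun z => - complex.Im (F z)); first exact: sphere_boundedN.
by apply/funext => z; case: (F z).
Qed.

Lemma csphere_bounded_sum m (F : 'I_m -> quatn -> R[i]) :
  (forall i, csphere_bounded (F i)) -> csphere_bounded (fun z => \sum_i F i z).
Proof.
elim: m F => [|m IHm] F bF.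
  by under eq_fun do rewrite big_ord0; exact: csphere_bounded_cst.
by under eq_fun do rewrite big_ord_recr/=; apply: csphere_boundedD => //; exact: IHm.
Qed.

Lemma csphere_bounded_real f : sphere_bounded f -> csphere_bounded (fun z => (f z)%:C).
Proof. by move=> bf; split => //=; exact: sphere_bounded_cst. Qed.

Lemma csphere_bounded_qc1 b : csphere_bounded (fun z => qc1 (hdot z b)).
Proof.
split; [have := sphere_bounded_hdot (inord 0) b|have := sphere_bounded_hdot (inord 1) b];
  by rewrite /qcoord/= inordK.
Qed.

Lemma csphere_bounded_qc2 b : csphere_bounded (fun z => qc2 (hdot z b)).
Proof.
split; [have := sphere_bounded_hdot (inord 2) b|have := sphere_bounded_hdot (inord 3) b];
  by rewrite /qcoord/= inordK.
Qed.

Lemma csphere_bounded_isom T F : sphere_isometry T -> csphere_bounded F ->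
  csphere_bounded (F \o T).
Proof. by move=> iT [rF iF]; split; [exact: (sphere_bounded_isom iT rF)|exact: (sphere_bounded_isom iT iF)]. Qed.

Definition cint F := cintegral sigma S F.

Lemma eq_cint F G : (forall z, S z -> F z = G z) -> cint F = cint G.
Proof.
move=> FG; rewrite /cint /cintegral; congr (_ +i* _);
  by apply: eq_Rintegral => z /set_mem Sz; rewrite FG.
Qed.

Let mS := @measurable_sphere R n.

Lemma sRintegralD f g : sphere_bounded f -> sphere_bounded g ->
  \int[sigma]_(z in S) (f z + g z) =
  \int[sigma]_(z in S) f z + \int[sigma]_(z in S) g z.
Proof.
by move=> bf bg; apply: RintegralD => //; exact: sphere_bounded_integrable.
Qed.

Lemma sRintegralB f g : sphere_bounded f -> sphere_bounded g ->
  \int[sigma]_(z in S) (f z - g z) =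
  \int[sigma]_(z in S) f z - \int[sigma]_(z in S) g z.
Proof.
by move=> bf bg; apply: RintegralB => //; exact: sphere_bounded_integrable.
Qed.

Lemma sRintegralZ (c : R) f : sphere_bounded f ->
  \int[sigma]_(z in S) (c * f z) = c * \int[sigma]_(z in S) f z.
Proof.
by move=> bf; apply: RintegralZl => //; exact: sphere_bounded_integrable.
Qed.

Lemma cintD F G : csphere_bounded F -> csphere_bounded G ->
  cint (fun z => F z + G z) = cint F + cint G.
Proof.
move=> [rF iF] [rG iG]; apply: complex_eqP; rewrite ?ReD ?ImD -sRintegralD//=.
  by apply: eq_Rintegral => z _; rewrite ReD.
by apply: eq_Rintegral => z _; rewrite ImD.
Qed.

Lemma cintZ c F : csphere_bounded F -> cint (fun z => c * F z) = c * cint F.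
Proof.
move=> [rF iF]; have bZ f (r : R) : sphere_bounded f -> sphere_bounded (fun z => r * f z).
  by move=> bf; apply: sphere_boundedM => //; exact: sphere_bounded_cst.
apply: complex_eqP; rewrite ?ReM ?ImM /=.
  under eq_Rintegral do rewrite ReM.
  by rewrite sRintegralB ?sRintegralZ//; exact: bZ.
under eq_Rintegral do rewrite ImM.
by rewrite sRintegralD ?sRintegralZ//; exact: bZ.
Qed.

Lemma isom_cint T F : sphere_isometry T -> csphere_bounded F ->
  cint (fun z => F (T z)) = cint F.
Proof.
move=> iT [rF iF]; rewrite /cint /cintegral; congr (_ +i* _).
  exact: (isom_Rintegral iT rF).
exact: (isom_Rintegral iT iF).
Qed.

Lemma cint_real f : cint (fun z => (f z)%:C) = (\int[sigma]_(z in S) f z)%:C.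
Proof.
rewrite /cint /cintegral; congr (_ +i* _) => /=.
by rewrite Rintegral_cst// mul0r.
Qed.

Lemma cint_sum m (F : 'I_m -> quatn -> R[i]) :
  (forall i, csphere_bounded (F i)) ->
  cint (fun z => \sum_i F i z) = \sum_i cint (F i).
Proof.
elim: m F => [|m IHm] F bF.
  under eq_cint do rewrite big_ord0; rewrite big_ord0.
  by rewrite -[LHS]/(cint (fun=> 0%:C)) cint_real Rintegral_cst// mul0r.
rewrite big_ord_recr/= -IHm// -cintD//.
  by apply: eq_cint => z _; rewrite big_ord_recr.
by apply: csphere_bounded_sum.
Qed.

End sphere_integration.

(** * Complete symmetric polynomials in two variables *)

Section symmetric_polynomials.

(** With s = x + x' and d = x x' this is h_m(x, x'), a rescaled Chebyshev polynomial of the second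
    kind. Only the sum and the product enter, and for the eigenvalues of a quaternion u these are 2
    Re u and |u|^2. *)
Fixpoint hsym (A : comNzRingType) (s d : A) (m : nat) : A :=
  if m is m1.+1 then
    if m1 is m2.+1 then s * hsym s d m1 - d * hsym s d m2 else s
  else 1.

Lemma hsymSS (A : comNzRingType) (s d : A) m :
  hsym s d m.+2 = s * hsym s d m.+1 - d * hsym s d m.
Proof. by []. Qed.

Lemma nat_ind2 (P : nat -> Prop) :
  P 0%N -> P 1%N -> (forall m, P m -> P m.+1 -> P m.+2) -> forall m, P m.
Proof.
move=> P0 P1 PSS m; suff [] : P m /\ P m.+1 by [].
by elim: m => // m [Pm PSm]; split=> //; exact: PSS.
Qed.

Lemma hsym_rmorph (A B : comNzRingType) (f : {rmorphism A -> B}) s d m :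
  f (hsym s d m) = hsym (f s) (f d) m.
Proof.
elim/nat_ind2: m => [||m IH0 IH1]; [exact: rmorph1|by []|].
by rewrite !hsymSS rmorphB !rmorphM IH0 IH1.
Qed.

Section trace.
Variables (A : comNzRingType) (al be ga de : A).
Let a : {poly A} := al%:P + be *: 'X.
Let b : {poly A} := ga%:P + de *: 'X.
Let g i k := (a ^+ i * b ^+ k)`_k.

(** With X the indeterminate, a b = al b + de X a - (al de - be ga) X; multiplied by a^i b^k, this
    gives the recursion on coefficients that sums up to the one of [hsym]. *)
Let gS i k : g i.+1 k.+1 = al * g i k.+1 + de * g i.+1 k - (al * de - be * ga) * g i k.
Proof.
rewrite /g; set P := a ^+ i * b ^+ k.
have -> : a ^+ i * b ^+ k.+1 = P * b by rewrite exprSr mulrA.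
have -> : a ^+ i.+1 * b ^+ k = P * a by rewrite exprSr mulrAC.
have -> : a ^+ i.+1 * b ^+ k.+1 = P * a * b by rewrite exprSr (exprSr b) mulrA (mulrAC _ a).
have E : P * a * b = al *: (P * b) + de *: (P * a) * 'X - (al * de - be * ga) *: P * 'X.
  rewrite /a /b -!mul_polyC; rewrite !(polyCB, polyCM); ring.
by rewrite E coefB coefD coefZ !coefMX /= !coefZ.
Qed.

Let g0r i : g i 0 = al ^+ i.
Proof.
by rewrite /g expr0 mulr1 -horner_coef0 horner_exp /a !hornerE ?mulr0 ?addr0.
Qed.

Let g0l k : g 0 k = de ^+ k.
Proof.
rewrite /g expr0 mul1r; elim: k => [|k IHk]; first by rewrite !expr0 coef1.
rewrite exprSr {2}/b mulrDr coefD coefMC -scalerAr coefZ coefMX/= IHk exprS.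
rewrite nth_default ?mul0r ?add0r//.
apply: leq_trans (size_poly_exp_leq _ _) _.
have sb : (size b <= 2)%N.
  rewrite /b (leq_trans (size_polyD _ _))// geq_max (leq_trans (size_polyC_leq1 _))//.
  by rewrite (leq_trans (size_scale_leq _ _))// size_polyX.
by rewrite ltnS -[leqRHS]mul1n leq_mul2r; apply/orP; right; case: (size b) sb.
Qed.

(* h_m is the trace of the m-th symmetric power of the matrix ((al, be), (ga, de)),
   whose diagonal coefficients are the coefficients below. *)
Lemma hsym_trace m : \sum_(k < m.+1) ((al%:P + be *: 'X) ^+ (m - k) *
    (ga%:P + de *: 'X) ^+ k)`_k = hsym (al + de) (al * de - be * ga) m.
Proof.
rewrite -/a -/b; change (\sum_(k < m.+1) g (m - k) k = hsym (al + de) (al * de - be * ga) m).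
elim/nat_ind2: m => [||m IH0 IH1].
- by rewrite big_ord1 g0r.
- by rewrite big_ord_recl big_ord1 /= g0r g0l !expr1.
rewrite hsymSS -IH0 -IH1 big_ord_recl big_ord_recr/=.
under eq_bigr => k _.
  rewrite /bump /= add1n subSS (_ : (m.+1 - k)%N = (m - k).+1); last by rewrite subSn// -ltnS.
  rewrite gS; over.
rewrite /bump/= add1n subnn subn0 g0r g0l.
rewrite sumrB big_split/= -!mulr_sumr.
have -> : \sum_(k < m.+1) g (m - k) k.+1 = \sum_(k < m.+2) g (m.+1 - k) k - al ^+ m.+1.
  by rewrite [in RHS]big_ord_recl/= subn0 g0r addrC addrA addNr add0r; apply: eq_bigr => k _.
have -> : \sum_(k < m.+1) g (m - k).+1 k = \sum_(k < m.+2) g (m.+1 - k) k - de ^+ m.+1.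
  rewrite [in RHS]big_ord_recr/= subnn g0l addrK; apply: eq_bigr => k _.
  by rewrite subSn// -ltnS.
by rewrite (exprS al m.+1) (exprS de m.+1); ring.
Qed.

End trace.

(** The natural numbers provide enough roots. Applied in s and then in t, it separates the members
    of a family that depends polynomially on two integer parameters. *)
Lemma poly_vanish (F : numFieldType) N (a : nat -> F) :
  (forall s : nat, \sum_(k < N) s%:R ^+ k * a k = 0) -> forall k, (k < N)%N -> a k = 0.
Proof.
move=> h k kN; pose p := \poly_(i < N) a i.
have p0 : p = 0.
  apply: (@roots_geq_poly_eq0 _ p [seq s%:R | s <- iota 0 N]).
  - apply/allP => _ /mapP[s _ ->]; rewrite /root horner_poly.
    by under eq_bigr do rewrite mulrC; rewrite h.
  - rewrite map_inj_uniq ?iota_uniq// => i j /eqP.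
    by rewrite eqr_nat => /eqP.
  - by rewrite size_map size_iota size_poly.
by have := coef_poly N a k; rewrite kN -/p p0 coef0.
Qed.

End symmetric_polynomials.

(** * Weights under the circle action *)

Section reproducing_kernels.
Local Notation "x ^*" := (conjc x) : ring_scope.
Context (R : realType) (n : nat).
Local Open Scope complex_scope.
Notation quatn := (n.+1.-tuple (quat R)).
Notation sigma := (surface_measure R n).
Notation S := (sphere R n).

Lemma conjME (x y : R[i]) : (x * y)^* = x^* * y^*.
Proof. by case: x y => [a b] [c d]; apply: complex_eqP => /=; ring. Qed.

Lemma conj0E : (0 : R[i])^* = 0.
Proof. by apply: complex_eqP; rewrite /= ?oppr0. Qed.

(** The witness is e^(i pi / k). A single rotation that changes the sign of a function of weight k
    makes its integral vanish, which replaces averaging over the circle. *)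
Lemma unit_root (k : nat) : (0 < k)%N ->
  exists2 x : R[i], x * x^* = 1 & x ^+ k = -1.
Proof.
move=> k0; pose t : R := pi / k%:R.
exists (cos t +i* sin t).
  by apply: complex_eqP => /=; have := cos2Dsin2 t; [nra|lra].
have demoivre m : (cos t +i* sin t) ^+ m = cos (t *+ m) +i* sin (t *+ m).
  elim: m => [|m IHm]; first by rewrite expr0 mulr0n cos0 sin0.
  by rewrite exprS IHm mulrS cosD sinD; apply: complex_eqP => /=; ring.
rewrite demoivre (_ : t *+ k = pi); last by rewrite -mulr_natr /t divfK// pnatr_eq0 -lt0n.
by rewrite cospi sinpi; apply: complex_eqP; rewrite /= ?oppr0.
Qed.

Definition hcdot (z w : quatn) : R[i] := qc1 (hdot z w).

Lemma hcdotC z w : hcdot w z = (hcdot z w)^*.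
Proof. by rewrite /hcdot (hdotC w z) qc1_conj. Qed.

Lemma csb_hcdotl b : csphere_bounded (fun z : quatn => hcdot z b).
Proof. exact: csphere_bounded_qc1. Qed.

Lemma csb_hcdotr b : csphere_bounded (fun z : quatn => hcdot b z).
Proof.
under eq_fun do rewrite hcdotC.
by apply: csphere_bounded_conj; exact: csb_hcdotl.
Qed.

Definition gmom m : R :=
  \int[sigma]_(y in S) (((tnth y ord0).1.1 ^+ 2 + (tnth y ord0).1.2 ^+ 2) ^+ m).

Lemma cint_odd (T : quatn -> quatn) F c : sphere_isometry T -> csphere_bounded F ->
  (forall y, F (T y) = c * F y) -> c = -1 -> cint F = 0.
Proof.
move=> iT bF FT cN1; have := isom_cint iT bF.
have -> : cint (fun y => F (T y)) = cint (fun y => -1 * F y).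
  by apply: eq_cint => y _; rewrite FT cN1.
by rewrite cintZ// mulN1r => /eqP; rewrite eqNr => /eqP.
Qed.

(** Under y |-> x y with |x| = 1 the four factors acquire conj(x)^p, x^q, 1 and x^M. As p < q + M,
    some x with x^(q + M - p) = -1 reverses the sign of the integrand. *)
Lemma cint_monomial z b M p q l : (p < q + M)%N ->
  cint (fun y : quatn => hcdot z y ^+ p * (hcdot z y)^* ^+ q *
    (qnsq (hdot z y))%:C ^+ l * hcdot y b ^+ M) = 0.
Proof.
move=> pqM; have [x xx xk] : exists2 x : R[i], x * x^* = 1 & x ^+ (q + M - p) = -1.
  by apply: unit_root; rewrite subn_gt0.
have x1 : qnsq (cquat x 0) = 1.
  by apply: complexI; rewrite qnsq_qc qc1_cquat qc2_cquat mul0r addr0 xx.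
apply: (@cint_odd (hlmul (cquat x 0)) _ (x^* ^+ p * x ^+ (q + M))).
- exact: isom_lmul.
- have bu := csb_hcdotr z; have bb := csb_hcdotl b.
  apply: csphere_boundedM; last exact: csphere_boundedX.
  apply: csphere_boundedM; first apply: csphere_boundedM.
  + exact: csphere_boundedX.
  + by apply: csphere_boundedX; exact: csphere_bounded_conj.
  + apply: csphere_boundedX; under eq_fun do rewrite hdotC qnsq_conj qnsq_qc.
    have b1 := csphere_bounded_qc1 z; have b2 := csphere_bounded_qc2 z.
    by apply: csphere_boundedD; apply: csphere_boundedM => //; exact: csphere_bounded_conj.
- move=> y; rewrite /hcdot hdot_lmull hdot_lmulr qnsqM qnsq_conj x1 mulr1.
  rewrite !qc1M !qc1_conj !qc2_conj !qc1_cquat !qc2_cquat.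
  rewrite !oppr0 !conj0E !(mul0r, mulr0, subr0) conjME conjcK !exprMn exprD; ring.
- rewrite -(subnKC (ltnW pqM)) exprD mulrA -exprMn mulrC (mulrC _ x) xx expr1n mulr1.
  exact: xk.
Qed.

(** On unit quaternions u = <z, w> this is the character of the m-th symmetric power of SU(2). The
    numbers [hcdot z w] and its conjugate add up to the trace of u but do not multiply to |u|^2,
    whence the separate factor |u|^(2 l) in the monomials. *)
Definition zkernel m (z w : quatn) : R :=
  hsym (2 * ((hdot z w).1.1 : R)) (qnsq (hdot z w)) m.

Lemma zkernel_complex m z w : (zkernel m z w)%:C =
  hsym (hcdot z w + (hcdot z w)^*) (qnsq (hdot z w))%:C m.
Proof. by rewrite /zkernel -re_qc; exact: (hsym_rmorph (real_complex R)). Qed.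

Lemma zkernelC m z w : zkernel m w z = zkernel m z w.
Proof. by rewrite /zkernel hdotC qnsq_conj. Qed.

Lemma csb_monomial z b M p q l : csphere_bounded (fun y : quatn =>
   hcdot z y ^+ p * (hcdot z y)^* ^+ q * (qnsq (hdot z y))%:C ^+ l * hcdot y b ^+ M).
Proof.
have bu := csb_hcdotr z; have bb := csb_hcdotl b.
apply: csphere_boundedM; last exact: csphere_boundedX.
apply: csphere_boundedM; first apply: csphere_boundedM.
- exact: csphere_boundedX.
- by apply: csphere_boundedX; exact: csphere_bounded_conj.
- apply: csphere_boundedX; under eq_fun do rewrite hdotC qnsq_conj qnsq_qc.
  have b1 := csphere_bounded_qc1 z; have b2 := csphere_bounded_qc2 z.
  by apply: csphere_boundedD; apply: csphere_boundedM => //; exact: csphere_bounded_conj.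
Qed.

Lemma csb_hsym (s d : quatn -> R[i]) m : csphere_bounded s -> csphere_bounded d ->
  csphere_bounded (fun y => hsym (s y) (d y) m).
Proof.
move=> bs bd; elim/nat_ind2: m => [||m IH0 IH1]; [exact: csphere_bounded_cst|by []|].
under eq_fun do rewrite hsymSS -mulN1r.
apply: csphere_boundedD; first exact: csphere_boundedM.
by apply: csphere_boundedM; [exact: csphere_bounded_cst|exact: csphere_boundedM].
Qed.

(* Only the top weight of the circle action z |-> e^(i t) z survives. *)
Lemma cint_weight z b M m p q l : (p + m <= M + q)%N ->
  cint (fun y : quatn => (hcdot z y ^+ p * (hcdot z y)^* ^+ q *
    (qnsq (hdot z y))%:C ^+ l * hcdot y b ^+ M) * (zkernel m z y)%:C) =
  if (p + m == M + q)%N then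
    cint (fun y : quatn => hcdot z y ^+ (p + m) * (hcdot z y)^* ^+ q *
    (qnsq (hdot z y))%:C ^+ l * hcdot y b ^+ M) else 0.
Proof.
have bz k : csphere_bounded (fun y => (zkernel k z y)%:C).
  under eq_fun do rewrite zkernel_complex.
  apply: csb_hsym; last first.
    by have := csb_monomial z b 0 0 0 1; under eq_fun do rewrite !expr0 !mul1r mulr1 expr1.
  by apply: csphere_boundedD; [|apply: csphere_bounded_conj]; exact: csb_hcdotr.
have bmz p' q' l' k : csphere_bounded (fun y : quatn => (hcdot z y ^+ p' *
   (hcdot z y)^* ^+ q' * (qnsq (hdot z y))%:C ^+ l' * hcdot y b ^+ M) * (zkernel k z y)%:C).
  by apply: csphere_boundedM => //; exact: csb_monomial.
elim/nat_ind2: m p q l => [||m IH0 IH1] p q l.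
- rewrite addn0 => pM.
  rewrite (_ : cint _ = cint (fun y : quatn => hcdot z y ^+ p * (hcdot z y)^* ^+ q *
    (qnsq (hdot z y))%:C ^+ l * hcdot y b ^+ M)); last first.
    by apply: eq_cint => y _; rewrite /zkernel/= mulr1.
  by case: eqP => // /eqP pM'; rewrite cint_monomial// addnC ltn_neqAle pM' pM.
- rewrite addn1 => pM.
  transitivity (cint (fun y : quatn => (hcdot z y ^+ p.+1 * (hcdot z y)^* ^+ q *
      (qnsq (hdot z y))%:C ^+ l * hcdot y b ^+ M)) +
    cint (fun y : quatn => (hcdot z y ^+ p * (hcdot z y)^* ^+ q.+1 *
      (qnsq (hdot z y))%:C ^+ l * hcdot y b ^+ M))).
    rewrite -cintD; [|exact: csb_monomial..].
    by apply: eq_cint => y _; rewrite zkernel_complex /= !exprS; ring.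
  rewrite (cint_monomial z b l (p := p)) ?addr0; last first.
    by rewrite addSn ltnS addnC ltnW.
  by case: eqP => // /eqP pM'; rewrite cint_monomial// addnC ltn_neqAle pM' pM.
move=> pM.
(* By the three-term recursion of [zkernel]. Only the first term can reach the top weight; the other
   two stay strictly below it. *)
transitivity (cint (fun y : quatn => (hcdot z y ^+ p.+1 * (hcdot z y)^* ^+ q *
      (qnsq (hdot z y))%:C ^+ l * hcdot y b ^+ M) * (zkernel m.+1 z y)%:C) +
    cint (fun y : quatn => (hcdot z y ^+ p * (hcdot z y)^* ^+ q.+1 *
      (qnsq (hdot z y))%:C ^+ l * hcdot y b ^+ M) * (zkernel m.+1 z y)%:C) +
    (-1) * cint (fun y : quatn => (hcdot z y ^+ p * (hcdot z y)^* ^+ q *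
      (qnsq (hdot z y))%:C ^+ l.+1 * hcdot y b ^+ M) * (zkernel m z y)%:C)).
  rewrite -cintD// -cintZ// -cintD//.
  - apply: eq_cint => y _; rewrite !zkernel_complex hsymSS !exprS; ring.
  - exact: csphere_boundedD.
  - by apply: csphere_boundedM => //; exact: csphere_bounded_cst.
rewrite IH1 ?addSnnS// IH1 ?IH0; [|lia..].
rewrite [X in _ + X + _]ifF; last by apply/eqP; lia.
rewrite [X in _ * X]ifF; last by apply/eqP; lia.
by rewrite mulr0 !addr0.
Qed.

End reproducing_kernels.

(** * Reproducing property on powers of linear functions *)

Section reproducing_property.
Local Notation "x ^*" := (conjc x) : ring_scope.
Context (R : realType) (n : nat).
Local Open Scope complex_scope.
Notation quatn := (n.+1.-tuple (quat R)).

Lemma csb_coord0 : csphere_bounded (fun y : quatn => qc1 (tnth y ord0)).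
Proof. by under eq_fun do rewrite -hdot_base; exact: csphere_bounded_qc1. Qed.

(** Write <z, y> = a conj(y_0) + r, with y_0 the first complex coordinate of y and r independent of
    y_0. In the binomial expansion the term in r^k has weight k under a rotation of y_0, so only k =
    0 remains and gives a^m times the moment of |y_0|^(2 m). *)
Lemma cint_hcdot_coord0 (z : quatn) m :
  cint (fun y : quatn => hcdot z y ^+ m * qc1 (tnth y ord0) ^+ m) =
  (gmom R n m)%:C * qc1 (tnth z ord0) ^+ m.
Proof.
set a := qc1 (tnth z ord0).
pose r (y : quatn) := hcdot z y - a * (qc1 (tnth y ord0))^*.
have br : csphere_bounded r.
  rewrite /r; under eq_fun do rewrite -mulNr.
  apply: csphere_boundedD; first exact: csb_hcdotr.
  apply: csphere_boundedM; first exact: csphere_bounded_cst.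
  by apply: csphere_bounded_conj; exact: csb_coord0.
have bc := csb_coord0.
have bF k : csphere_bounded (fun y : quatn => ((qc1 (tnth y ord0))^* ^+ (m - k) *
    r y ^+ k) * qc1 (tnth y ord0) ^+ m).
  by apply: csphere_boundedM; [apply: csphere_boundedM|];
    apply: csphere_boundedX => //; exact: csphere_bounded_conj.
transitivity (\sum_(k < m.+1) ((a ^+ (m - k)) *+ 'C(m, k)) *
    cint (fun y : quatn => ((qc1 (tnth y ord0))^* ^+ (m - k) * r y ^+ k) *
      qc1 (tnth y ord0) ^+ m)).
  under eq_bigr do rewrite -cintZ//.
  rewrite -cint_sum; last first.
    by move=> k; apply: csphere_boundedM => //; exact: csphere_bounded_cst.
  apply: eq_cint => y _.
  have -> : hcdot z y = a * (qc1 (tnth y ord0))^* + r y by rewrite /r addrC subrK.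
  rewrite exprDn mulr_suml; apply: eq_bigr => k _.
  by rewrite exprMn !mulrnAl !mulrA.
rewrite big_ord_recl big1 ?addr0 => [|k _]; last first.
  have [x xx xk] := @unit_root R (k.+1) isT.
  rewrite (@cint_odd _ _ (hphase x) _ (x^* ^+ (m - lift ord0 k) * x ^+ m)) ?mulr0//.
  - exact: isom_phase.
  - move=> y; have xC : x^* * x = 1 by rewrite mulrC.
    have y0 : tnth (hphase x y) ord0 =
        cquat (x * qc1 (tnth y ord0)) (qc2 (tnth y ord0)).
      by rewrite tnth_mktuple eqxx.
    have rx : r (hphase x y) = r y.
      rewrite /r /hcdot /hdot !qc1_sum !big_ord_recl y0 !qc1M.
      rewrite !qc1_conj !qc2_conj !qc1_cquat !qc2_cquat conjME -/a.
      under eq_bigr => i _ do rewrite tnth_mktuple/=.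
      ring.
    rewrite rx y0 qc1_cquat conjME !exprMn.
    by rewrite -!mulrA (mulrCA (r y ^+ _)) (mulrCA ((qc1 _)^* ^+ _)).
  - rewrite (_ : (lift ord0 k : nat) = k.+1)//.
    by rewrite -[X in _ * x ^+ X](subnK (ltn_ord k)) exprD mulrA
      -exprMn (mulrC x^* x) xx expr1n mul1r.
have e0 : nat_of_ord (@ord0 m) = 0%N by [].
rewrite !e0 subn0 bin0 mulr1n mulrC; congr (_ * _).
rewrite /gmom -cint_real; apply: eq_cint => y _.
rewrite expr0 mulr1 -exprMn rmorphXn /=; congr (_ ^+ _).
by case: (tnth y ord0) => [[c d] ?]; apply: complex_eqP => /=; ring.
Qed.

Lemma hcdot_scaler (r : R) (z w : quatn) : hcdot z (hscale r w) = r%:C * hcdot z w.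
Proof.
rewrite hscaleE /hcdot hdot_lmulr qconj_real -qreal_comm qc1M.
by case: (hdot z w) => [[a b] [c d]]; apply: complex_eqP => /=; ring.
Qed.

(** Transitivity moves [b] to |b| times the base vector, where the second factor is a power of the
    first complex coordinate. *)
Lemma cint_hcdot (z b : quatn) m :
  cint (fun y : quatn => hcdot z y ^+ m * hcdot y b ^+ m) =
  (gmom R n m)%:C * hcdot z b ^+ m.
Proof.
have [T [iT Tdot Tb]] := sp_transitive b.
have bF w c : csphere_bounded (fun y : quatn => hcdot w y ^+ m * hcdot y c ^+ m).
  by apply: csphere_boundedM; apply: csphere_boundedX; [exact: csb_hcdotr|exact: csb_hcdotl].
transitivity (cint (fun y : quatn => hcdot (T z) (T y) ^+ m * hcdot (T y) (T b) ^+ m)).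
  by apply: eq_cint => y _; rewrite /hcdot !Tdot.
rewrite (isom_cint (F := fun y : quatn => hcdot (T z) y ^+ m * hcdot y (T b) ^+ m))//.
transitivity ((hnorm b)%:C ^+ m *
    cint (fun y : quatn => hcdot (T z) y ^+ m * qc1 (tnth y ord0) ^+ m)).
  rewrite -cintZ; last first.
    by apply: csphere_boundedM; apply: csphere_boundedX; [exact: csb_hcdotr|exact: csb_coord0].
  apply: eq_cint => y _; rewrite Tb hcdot_scaler exprMn /hcdot hdot_base; ring.
rewrite cint_hcdot_coord0 -[hcdot z b]/(qc1 _) -Tdot Tb -[qc1 (hdot _ _)]/(hcdot _ _).
by rewrite hcdot_scaler exprMn /hcdot hdot_base; ring.
Qed.

Lemma csb_zkernel m z : csphere_bounded (fun y : quatn => (zkernel m z y)%:C).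
Proof.
under eq_fun do rewrite zkernel_complex.
apply: csb_hsym; last first.
  have := csb_monomial z z 0 0 0 1.
  by under eq_fun do rewrite !expr0 !mul1r mulr1 expr1.
by apply: csphere_boundedD; [|apply: csphere_bounded_conj]; exact: csb_hcdotr.
Qed.

Lemma cint_zkernel_hcdot m M (z b : quatn) : (m <= M)%N ->
  cint (fun y : quatn => (zkernel m z y)%:C * hcdot y b ^+ M) =
  ((m == M)%:R * gmom R n M)%:C * hcdot z b ^+ M.
Proof.
move=> mM.
transitivity (cint (fun y : quatn => (hcdot z y ^+ 0 * (hcdot z y)^* ^+ 0 *
    (qnsq (hdot z y))%:C ^+ 0 * hcdot y b ^+ M) * (zkernel m z y)%:C)).
  by apply: eq_cint => y _; rewrite !expr0 !mul1r mulrC.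
rewrite cint_weight ?addn0 ?add0n//.
case: eqP => [->|_]; last by rewrite !mul0r.
rewrite mul1r -cint_hcdot; apply: eq_cint => y _.
by rewrite !expr0 !mulr1.
Qed.

(* Left multiplication by a unit quaternion replaces the complex structure of
   the first coordinate function by any of its conjugates. *)
Lemma cint_zkernel_rot m M (z b : quatn) q : qnsq q != 0 -> (m <= M)%N ->
  cint (fun y : quatn => (zkernel m z y)%:C * qc1 (q * hdot y b) ^+ M) =
  ((m == M)%:R * gmom R n M)%:C * qc1 (q * hdot z b) ^+ M.
Proof.
move=> q0 mM; pose r := Num.sqrt (qnsq q).
have r0 : r != 0 by rewrite sqrtr_eq0 -ltNge lt_def q0 qnsq_ge0.
have [p p1 qp] : exists2 p, qnsq p = 1 & q = qreal r * p.
  exists (qreal r^-1 * q).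
    by rewrite qnsqM qnsq_real exprVn sqr_sqrtr ?qnsq_ge0// mulVf.
  by rewrite mulrA -qrealM divff// mul1r.
have qE w : qc1 (q * hdot w b) = r%:C * hcdot (hlmul p w) b.
  rewrite qp /hcdot hdot_lmull -mulrA qc1M.
  by case: (p * _) => [[a c] [d e]]; apply: complex_eqP => /=; ring.
have zT y : zkernel m (hlmul p z) (hlmul p y) = zkernel m z y.
  rewrite /zkernel hdot_lmull hdot_lmulr !qnsqM qnsq_conj p1 mul1r mulr1.
  by rewrite mulrA (re_qmulC (p * _)) mulrA qconj_mul p1 mul1r.
have bF c : csphere_bounded (fun y : quatn => (zkernel m c y)%:C * hcdot y b ^+ M).
  by apply: csphere_boundedM; [exact: csb_zkernel|apply: csphere_boundedX; exact: csb_hcdotl].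
transitivity (r%:C ^+ M * cint (fun y : quatn =>
    (zkernel m (hlmul p z) (hlmul p y))%:C * hcdot (hlmul p y) b ^+ M)).
  rewrite -cintZ.
    by apply: eq_cint => y _; rewrite qE exprMn zT; ring.
  have := csphere_bounded_isom (isom_lmul n p1) (bF (hlmul p z)); exact.
rewrite (isom_cint (F := fun y => (zkernel m (hlmul p z) y)%:C * hcdot y b ^+ M))//; last exact: isom_lmul.
by rewrite cint_zkernel_hcdot// qE exprMn; ring.
Qed.

End reproducing_property.

(** * Convolution of the kernels *)

Section convolution.
Local Notation "x ^*" := (conjc x) : ring_scope.
Context (R : realType) (n : nat).
Local Open Scope complex_scope.
Notation quatn := (n.+1.-tuple (quat R)).
Notation sigma := (surface_measure R n).
Notation S := (sphere R n).

Let linp (x y : R[i]) : {poly R[i]} := x%:P + y *: 'X.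

Lemma size_linp x y : (size (linp x y) <= 2)%N.
Proof.
rewrite /linp (leq_trans (size_polyD _ _))// geq_max (leq_trans (size_polyC_leq1 _))//.
by rewrite (leq_trans (size_scale_leq _ _))// size_polyX.
Qed.

Lemma size_linpX x y k : (size (linp x y ^+ k) <= k.+1)%N.
Proof.
apply: leq_trans (size_poly_exp_leq _ _) _.
rewrite ltnS -[leqRHS]mul1n leq_mul2r; apply/orP; right.
by have := size_linp x y; case: (size _).
Qed.

Lemma csb_coefM (P Q : quatn -> {poly R[i]}) :
  (forall l, csphere_bounded (fun y => (P y)`_l)) ->
  (forall l, csphere_bounded (fun y => (Q y)`_l)) ->
  forall l, csphere_bounded (fun y => (P y * Q y)`_l).
Proof.
move=> bP bQ l; under eq_fun do rewrite coefM.
by apply: csphere_bounded_sum => i; exact: csphere_boundedM.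
Qed.

Lemma csb_coefX (P : quatn -> {poly R[i]}) k :
  (forall l, csphere_bounded (fun y => (P y)`_l)) ->
  forall l, csphere_bounded (fun y => (P y ^+ k)`_l).
Proof.
move=> bP; elim: k => [|k IHk] l.
  by under eq_fun do rewrite expr0; exact: csphere_bounded_cst.
by under eq_fun do rewrite exprS; exact: csb_coefM.
Qed.

Lemma csb_linp (f g : quatn -> R[i]) : csphere_bounded f -> csphere_bounded g ->
  forall l, csphere_bounded (fun y => (linp (f y) (g y))`_l).
Proof.
move=> bf bg l; under eq_fun do rewrite /linp coefD coefC coefZ coefX.
apply: csphere_boundedD; last first.
  by apply: csphere_boundedM => //; exact: csphere_bounded_cst.
by case: eqP => _ //; exact: csphere_bounded_cst.
Qed.

Section coefficient_extraction.
Variables (w : quatn) (m : nat).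
Let P y := linp (qc1 (hdot y w)) (- qc2 (hdot y w)).
Let Q y := linp (qc2 (hdot y w))^* (qc1 (hdot y w))^*.
Let G k l y := (P y ^+ (m - k) * Q y ^+ k)`_l.

Let csbG k l : csphere_bounded (G k l).
Proof.
have b1 := csphere_bounded_qc1 w; have b2 := csphere_bounded_qc2 w.
apply: csb_coefM => {}l; apply: csb_coefX => {}l; apply: csb_linp => //.
- under eq_fun do rewrite -mulN1r; apply: csphere_boundedM => //.
  exact: csphere_bounded_cst.
- exact: csphere_bounded_conj.
- exact: csphere_bounded_conj.
Qed.

(** The left side is the m-th power of the complex part of (1 - s j) u (1 + t j), with u = <y, w>.
    As s and t vary it generates the matrix coefficients [G k l] of the m-th symmetric power of u,
    while each member has the form treated in [cint_zkernel_rot]. *)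
Let GE (s t : nat) y : qc1 (mkquat 1 0 (- s%:R) 0 *
    hdot y (hlmul (qconj (mkquat 1 0 t%:R 0)) w)) ^+ m =
  \sum_(k < m.+1) s%:R ^+ k * ('C(m, k)%:R * \sum_(l < m.+1) t%:R ^+ l * G k l y).
Proof.
rewrite hdot_lmulr qconjK.
have -> : qc1 (mkquat 1 0 (- s%:R) 0 * (hdot y w * mkquat 1 0 t%:R 0)) =
    (P y).[t%:R] + s%:R * (Q y).[t%:R].
  rewrite /P /Q /linp !(hornerD, hornerC, hornerZ, hornerX).
  have nC k : k%:R = (k%:R : R)%:C by rewrite (rmorph_nat (real_complex R)).
  rewrite !nC qmulE qmulE /qc1 /qc2.
  by case: (hdot y w) => [[a b] [c d]]; apply: complex_eqP => /=; ring.
rewrite exprDn; apply: eq_bigr => k _.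
rewrite exprMn mulrCA -mulr_natl mulrCA -horner_exp -[(Q y).[_] ^+ _]horner_exp -hornerM.
congr (_ * (_ * _)); rewrite (@horner_coef_wide _ m.+1).
  by apply: eq_bigr => l _; rewrite mulrC.
apply: leq_trans (size_polyMleq _ _) _.
have sP : (size (P y ^+ (m - k)) <= (m - k).+1)%N by exact: size_linpX.
have sQ : (size (Q y ^+ k) <= k.+1)%N by exact: size_linpX.
move: sP sQ (ltn_ord k); move: (size (P y ^+ _)) (size (Q y ^+ _)) => sp sq.
by lia.
Qed.

(** The family in s and t separates the functions [G k l], so each of them is reproduced, the defect
    [E k l] being zero; and [zkernel] is the sum of the diagonal ones by [hsym_trace]. *)
Lemma cint_zkernel_conv m' z : (m' <= m)%N ->
  cint (fun y : quatn => (zkernel m' z y)%:C * (zkernel m y w)%:C) =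
  ((m' == m)%:R * gmom R n m)%:C * (zkernel m z w)%:C.
Proof.
move=> mm; set c := (_ * gmom R n m)%:C.
pose E k l := cint (fun y => (zkernel m' z y)%:C * G k l y) - c * G k l z.
have bzG k l : csphere_bounded (fun y => (zkernel m' z y)%:C * G k l y).
  by apply: csphere_boundedM; [exact: csb_zkernel|exact: csbG].
have E0 k l : (k < m.+1)%N -> (l < m.+1)%N -> E k l = 0.
  move=> km lm.
  suff h t : \sum_(l < m.+1) t%:R ^+ l * E k l = 0 by exact: (poly_vanish h).
  have Ck : 'C(m, k)%:R != 0 :> R[i] by rewrite pnatr_eq0 -lt0n bin_gt0 -ltnS.
  suff : 'C(m, k)%:R * \sum_(l < m.+1) t%:R ^+ l * E k l = 0.
    by move/eqP; rewrite mulf_eq0 (negbTE Ck)/= => /eqP.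
  apply: (poly_vanish (a := fun k => 'C(m, k)%:R * \sum_(l < m.+1) t%:R ^+ l * E k l) _ km) => s {k km l lm Ck}.
  have q0 : qnsq (mkquat 1 0 (- s%:R) 0 : quat R) != 0.
    by rewrite /qnsq/= gt_eqF// !expr0n/= !addr0 sqrrN expr1n ltr_pwDl// sqr_ge0.
  have := cint_zkernel_rot z (hlmul (qconj (mkquat 1 0 t%:R 0)) w) q0 mm.
  rewrite GE -/c.
  rewrite (_ : cint _ = \sum_(k < m.+1) s%:R ^+ k * ('C(m, k)%:R *
    \sum_(l < m.+1) t%:R ^+ l * cint (fun y => (zkernel m' z y)%:C * G k l y))); last first.
    transitivity (cint (fun y => \sum_(k < m.+1) (s%:R ^+ k * 'C(m, k)%:R) *
        \sum_(l < m.+1) t%:R ^+ l * ((zkernel m' z y)%:C * G k l y))).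
      apply: eq_cint => y _; rewrite GE mulr_sumr; apply: eq_bigr => k _.
      rewrite mulrCA -!mulrA; congr (_ * _); rewrite mulrCA; congr (_ * _).
      by rewrite mulr_sumr; apply: eq_bigr => l _; rewrite mulrCA.
    have bs k : csphere_bounded (fun y => \sum_(l < m.+1) t%:R ^+ l * ((zkernel m' z y)%:C * G k l y)).
      apply: csphere_bounded_sum => l; apply: csphere_boundedM => //.
      exact: csphere_bounded_cst.
    rewrite cint_sum; last first.
      by move=> k; apply: csphere_boundedM => //; exact: csphere_bounded_cst.
    apply: eq_bigr => k _; rewrite cintZ// mulrA; congr (_ * _).
    rewrite cint_sum; last first.
      by move=> l; apply: csphere_boundedM => //; exact: csphere_bounded_cst.
    by apply: eq_bigr => l _; rewrite cintZ.
  move/eqP; rewrite -subr_eq0 => /eqP; apply: etrans.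
  rewrite mulr_sumr -sumrB; apply: eq_bigr => k _.
  rewrite (mulrCA c) -mulrBr (mulrCA c) -mulrBr; congr (_ * (_ * _)).
  rewrite mulr_sumr -sumrB; apply: eq_bigr => l _.
  by rewrite /E mulrBr (mulrCA c).
have zG y : (zkernel m y w)%:C = \sum_(k < m.+1) G k k y.
  rewrite zkernel_complex /G /P /Q /linp hsym_trace; congr hsym.
  by rewrite qnsq_qc /hcdot; ring.
transitivity (\sum_(k < m.+1) cint (fun y => (zkernel m' z y)%:C * G k k y)).
  rewrite -cint_sum//; apply: eq_cint => y _.
  by rewrite zG mulr_sumr.
rewrite zG mulr_sumr; apply: eq_bigr => k _; apply/eqP.
by rewrite -subr_eq0; apply/eqP; exact: E0.
Qed.

End coefficient_extraction.

Lemma sb_zkernel m z : sphere_bounded (fun y : quatn => zkernel m z y).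
Proof. by have [] := csb_zkernel m z. Qed.

Lemma Rint_zkernel_conv m m' (z w : quatn) :
  \int[sigma]_(y in S) (zkernel m' z y * zkernel m y w) =
  (m' == m)%:R * gmom R n m * zkernel m z w.
Proof.
(* The kernels are symmetric, so exchanging the indices amounts to exchanging [z] and [w]. *)
wlog mm : m m' z w / (m' <= m)%N => [hw|].
  have [|mm] := leqP m' m; first exact: hw.
  have := hw m' m w z (ltnW mm).
  rewrite (gtn_eqF mm) (ltn_eqF mm) !mul0r => <-; apply: eq_Rintegral => y _.
  by rewrite mulrC zkernelC [X in _ * X]zkernelC.
apply: complexI; rewrite -cint_real rmorphM/= -cint_zkernel_conv//.
by apply: eq_cint => y _; rewrite rmorphM.
Qed.

End convolution.

(** * Quadratic forms of bounded kernels on a finite measure space *)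

Section quadratic_forms.
Context d (T : measurableType d) (R : realType).
Variable mu : {sigma_finite_measure set T -> \bar R}.
Hypothesis mu_fin : (mu setT < +oo)%E.
Implicit Types (f g : T -> R) (k : T * T -> R).

Definition square_integrable f :=
  measurable_fun setT f /\ (\int[mu]_x ((f x) ^+ 2)%:E < +oo)%E.

Definition bounded_kernel d' (X : measurableType d') (k : X -> R) :=
  measurable_fun setT k /\ exists M, forall p, `|k p| <= M.

Definition qform k f := \int[(mu \x mu)%E]_p (f p.1 * f p.2 * k p).

Lemma bounded_kernelD d' (X : measurableType d') (k l : X -> R) :
  bounded_kernel k -> bounded_kernel l -> bounded_kernel (fun p => k p + l p).
Proof.
move=> [mk [M kM]] [ml [N lN]]; split; first exact: measurable_funD.
by exists (M + N) => p; rewrite (le_trans (ler_normD _ _))// lerD.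
Qed.

Lemma bounded_kernelM d' (X : measurableType d') (k l : X -> R) :
  bounded_kernel k -> bounded_kernel l -> bounded_kernel (fun p => k p * l p).
Proof.
move=> [mk [M kM]] [ml [N lN]]; split; first exact: measurable_funM.
by exists (M * N) => p; rewrite normrM ler_pM.
Qed.

Lemma bounded_kernel_cst d' (X : measurableType d') (c : R) :
  bounded_kernel (fun _ : X => c).
Proof. by split=> //; exists `|c|. Qed.

Lemma bounded_kernelZ d' (X : measurableType d') (c : R) (k : X -> R) :
  bounded_kernel k -> bounded_kernel (fun p => c * k p).
Proof. by move=> bk; apply: bounded_kernelM => //; exact: bounded_kernel_cst. Qed.

Lemma bounded_kernel_sum d' (X : measurableType d') m (k : 'I_m -> X -> R) :
  (forall i, bounded_kernel (k i)) -> bounded_kernel (fun p => \sum_i k i p).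
Proof.
elim: m k => [|m IHm] k bk.
  by under eq_fun do rewrite big_ord0; exact: bounded_kernel_cst.
by under eq_fun do rewrite big_ord_recr/=; apply: bounded_kernelD => //; exact: IHm.
Qed.

Lemma bounded_kernel_comp d' (X : measurableType d') d'' (Y : measurableType d'')
    (h : X -> Y) (k : Y -> R) :
  measurable_fun setT h -> bounded_kernel k -> bounded_kernel (k \o h).
Proof.
move=> mh [mk [M kM]]; split; first exact: measurableT_comp.
by exists M => p; exact: kM.
Qed.

Let mu_cst (c : R) : mu.-integrable setT (EFin \o cst c).
Proof.
apply: measurable_bounded_integrable => //.
exists `|c|; split; first exact: num_real.
by move=> x cx z _; exact: ltW.
Qed.

Lemma square_integrable_sq f : square_integrable f ->
  mu.-integrable setT (EFin \o (fun x => f x ^+ 2)).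
Proof.
move=> [mf f2]; apply/integrableP; split.
  by apply/measurable_EFinP; exact: measurable_funX.
apply: le_lt_trans f2; rewrite le_eqVlt; apply/orP; left; apply/eqP.
by apply: eq_integral => x _ /=; rewrite ger0_norm ?sqr_ge0.
Qed.

(** The measure is finite and |f| <= f^2 + 1. *)
Lemma square_integrable_int f : square_integrable f ->
  mu.-integrable setT (EFin \o f).
Proof.
move=> f2; have mf := f2.1.
apply: (le_integrable measurableT _ _ (integrableD measurableT (square_integrable_sq f2) (mu_cst 1))).
  exact/measurable_EFinP.
move=> x _ /=; rewrite lee_fin [leRHS]ger0_norm ?addr_ge0 ?sqr_ge0//.
have := sqr_ge0 (`|f x| - 1); rewrite sqrrB expr1n mulr1 real_normK ?num_real//.
by have := normr_ge0 (f x); lra.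
Qed.

Lemma bounded_kernel_int f : bounded_kernel f -> mu.-integrable setT (EFin \o f).
Proof.
move=> [mf [M fM]]; apply: measurable_bounded_integrable => //.
exists M; split; first exact: num_real.
by move=> x Mx z _; rewrite /= (le_trans (fM z))// ltW.
Qed.

Lemma integrable_mul_bounded f (k : T -> R) : mu.-integrable setT (EFin \o f) ->
  bounded_kernel k -> mu.-integrable setT (EFin \o (fun x => f x * k x)).
Proof.
move=> fi [mk [M kM]].
have mf : measurable_fun setT f by apply/measurable_EFinP; exact: measurable_int fi.
apply: (le_integrable measurableT _ _ (integrableZl measurableT (`|M|) fi)).
  by apply/measurable_EFinP; exact: measurable_funM.
move=> x _ /=; rewrite lee_fin !normrM normr_id mulrC ler_wpM2r//.
exact: le_trans (kM x) (ler_norm _).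
Qed.

Lemma bounded_square_integrable f : bounded_kernel f -> square_integrable f.
Proof.
move=> bf; split; first by case: bf.
have := bounded_kernel_int (bounded_kernelM bf bf) => /integrableP[_].
apply: le_lt_trans; rewrite le_eqVlt; apply/orP; left; apply/eqP.
by apply: eq_integral => x _ /=; rewrite ger0_norm -expr2 ?sqr_ge0.
Qed.

Lemma square_integrableM f (k : T -> R) : square_integrable f -> bounded_kernel k ->
  square_integrable (fun x => f x * k x).
Proof.
move=> f2 bk; split; first by apply: measurable_funM; [case: f2|case: bk].
have := integrable_mul_bounded (square_integrable_sq f2) (bounded_kernelM bk bk).
move=> /integrableP[_]; apply: le_lt_trans; rewrite le_eqVlt; apply/orP; left; apply/eqP.
by apply: eq_integral => x _ /=; rewrite ger0_norm -expr2 -exprMn ?sqr_ge0.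
Qed.

Lemma prod_integrable f g k : mu.-integrable setT (EFin \o f) ->
  mu.-integrable setT (EFin \o g) -> bounded_kernel k ->
  (mu \x mu)%E.-integrable setT (EFin \o (fun p => f p.1 * g p.2 * k p)).
Proof.
move=> fi gi [mk [M kM]].
have mf : measurable_fun setT f by apply/measurable_EFinP; exact: measurable_int fi.
have mg : measurable_fun setT g by apply/measurable_EFinP; exact: measurable_int gi.
apply/integrable12ltyP.
  apply/measurable_EFinP; apply: measurable_funM => //; apply: measurable_funM.
    exact: (measurableT_comp mf).
  exact: (measurableT_comp mg).
pose A := (\int[mu]_x `|f x|%:E)%E; pose B := (\int[mu]_x `|g x|%:E)%E.
have Af : (A < +oo)%E by move/integrableP: fi => [].
have Bf : (B < +oo)%E by move/integrableP: gi => [].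
have A0 : (0 <= A)%E by exact: integral_ge0.
have B0 : (0 <= B)%E by exact: integral_ge0.
have mnf : measurable_fun setT (fun x => `|f x|%:E).
  by apply/measurable_EFinP; exact: measurableT_comp.
have mng : measurable_fun setT (fun x => `|g x|%:E).
  by apply/measurable_EFinP; exact: measurableT_comp.
apply: (@le_lt_trans _ _ (A * (B * `|M|%:E))%E); last first.
  by rewrite lte_mul_pinfty ?ge0_fin_numE// lte_mul_pinfty ?ge0_fin_numE// ltry.
rewrite /A -ge0_integralZr ?mule_ge0//.
apply: ge0_le_integral => //.
- by move=> x _; exact: integral_ge0.
- apply: (measurable_fun_fubini_tonelli_F (fun p => `|f p.1 * g p.2 * k p|%:E)) => //.
  apply/measurable_EFinP; apply: measurableT_comp => //; apply: measurable_funM => //.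
  by apply: measurable_funM; [exact: (measurableT_comp mf)|exact: (measurableT_comp mg)].
- exact: emeasurable_funM.
move=> x _.
have mgM : measurable_fun setT (fun y => (`|g y|%:E * `|M|%:E)%E).
  exact: emeasurable_funM.
rewrite /B -ge0_integralZr// -ge0_integralZl//.
apply: ge0_le_integral => //.
- apply/measurable_EFinP; apply: measurableT_comp => //.
  rewrite /=; apply: measurable_funM; first by apply: (measurable_funM (measurable_cst _) mg).
  exact: (measurableT_comp mk (pair1_measurable x)).
- exact: emeasurable_funM.
move=> y _; rewrite /= -!EFinM lee_fin !normrM mulrA ler_wpM2l//.
exact: le_trans (kM _) (ler_norm _).
Qed.

Definition kop k f x := \int[mu]_y (k (x, y) * f y).

Lemma bounded_section k x : bounded_kernel k -> bounded_kernel (fun y => k (x, y)).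
Proof.
move=> [mk [M kM]]; split; first exact: (measurableT_comp mk (pair1_measurable x)).
by exists M.
Qed.

Lemma bounded_section2 k y : bounded_kernel k -> bounded_kernel (fun x => k (x, y)).
Proof.
move=> [mk [M kM]]; split; first exact: (measurableT_comp mk (pair2_measurable y)).
by exists M.
Qed.

Lemma prod_Rintegral f g k : mu.-integrable setT (EFin \o f) ->
  mu.-integrable setT (EFin \o g) -> bounded_kernel k ->
  \int[(mu \x mu)%E]_p (f p.1 * g p.2 * k p) = \int[mu]_x (f x * kop k g x) /\
  \int[(mu \x mu)%E]_p (f p.1 * g p.2 * k p) =
    \int[mu]_y (g y * kop (fun p => k (p.2, p.1)) f y).
Proof.
move=> fi gi bk; have ki := prod_integrable fi gi bk.
have gki x : mu.-integrable setT (EFin \o (fun y => k (x, y) * g y)).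
  under eq_fun do rewrite mulrC.
  by apply: integrable_mul_bounded => //; exact: bounded_section.
have fki y : mu.-integrable setT (EFin \o (fun x => k (x, y) * f x)).
  under eq_fun do rewrite mulrC.
  by apply: integrable_mul_bounded => //; exact: bounded_section2.
split; rewrite /Rintegral; congr fine.
  rewrite -integral12_prod_meas1//; apply: eq_integral => x _; rewrite /= /kop.
  transitivity (\int[mu]_y ((f x)%:E * (k (x, y) * g y)%:E))%E.
    by apply: eq_integral => y _; rewrite -EFinM; congr EFin; ring.
  rewrite (integralZl measurableT (gki x)) [RHS]EFinM /Rintegral fineK//.
  exact: (integrable_fin_num measurableT (gki x)).
rewrite -integral21_prod_meas1//; apply: eq_integral => y _; rewrite /= /kop.
transitivity (\int[mu]_x ((g y)%:E * (k (x, y) * f x)%:E))%E.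
  by apply: eq_integral => x _; rewrite -EFinM; congr EFin; ring.
rewrite (integralZl measurableT (fki y)) [RHS]EFinM /Rintegral fineK//.
exact: (integrable_fin_num measurableT (fki y)).
Qed.

Lemma kop_bounded k f : bounded_kernel k -> mu.-integrable setT (EFin \o f) ->
  bounded_kernel (kop k f).
Proof.
move=> bk fi; have [mk [M kM]] := bk.
have kfi x : mu.-integrable setT (EFin \o (fun y => k (x, y) * f y)).
  under eq_fun do rewrite mulrC.
  by apply: integrable_mul_bounded => //; exact: bounded_section.
split.
  apply/measurable_EFinP.
  have := measurable_fubini_F (prod_integrable (mu_cst 1) fi bk).
  congr (measurable_fun _ _); apply/funext => x /=.
  rewrite /fubini_F /kop /Rintegral fineK; last exact: (integrable_fin_num measurableT (kfi x)).
  by apply: eq_integral => y _ /=; rewrite mul1r mulrC.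
exists (M * \int[mu]_y `|f y|) => x; rewrite /kop.
rewrite (le_trans (le_normr_Rintegral _ _))//.
have nfi : mu.-integrable setT (EFin \o (fun y => `|f y|)) by exact: integrable_norm.
rewrite -RintegralZl//; apply: le_Rintegral => //.
- exact: (integrable_norm (kfi x)).
- have := integrableZl measurableT M nfi; exact.
by move=> y _; rewrite normrM ler_wpM2r.
Qed.

(* The inequality 0 <= | c f - Psi f |^2, where Phi = Psi^2. *)
Lemma qform_square k l f (c : R) : square_integrable f ->
  bounded_kernel k -> bounded_kernel l -> (forall x y, k (y, x) = k (x, y)) ->
  (forall x y, \int[mu]_z (k (z, x) * k (z, y)) = l (y, x)) ->
  0 <= c ^+ 2 * (\int[mu]_x f x ^+ 2) - 2 * c * qform k f + qform l f.
Proof.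
move=> f2 bk bl kC kl; have fi := square_integrable_int f2.
have bg := kop_bounded bk fi; set g := kop k f in bg.
have gi := bounded_kernel_int bg.
have qk : qform k f = \int[mu]_x (f x * g x) by exact: (prod_Rintegral fi fi bk).1.
have ql : qform l f = \int[mu]_x (g x * g x).
  (* Moving [kop k] from one factor to the other composes it with itself, and [kl] identifies the
     composite with [l]. *)
  rewrite -(prod_Rintegral gi fi bk).1 (prod_Rintegral gi fi bk).2.
  rewrite /qform (prod_Rintegral fi fi bl).1; apply: eq_Rintegral => x _; congr (_ * _).
  have bx : bounded_kernel (fun z => k (z, x)) by exact: bounded_section2.
  transitivity (\int[mu]_z (k (z, x) * g z)); last first.
    by apply: eq_Rintegral => z _; rewrite /= kC.
  rewrite -(prod_Rintegral (bounded_kernel_int bx) fi bk).1.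
  rewrite (prod_Rintegral (bounded_kernel_int bx) fi bk).2.
  apply: eq_Rintegral => y _; rewrite mulrC; congr (_ * _).
  rewrite -kl; apply: eq_Rintegral => z _; rewrite /= kC; ring.
rewrite qk ql.
have fgi := integrable_mul_bounded fi bg; have ggi := integrable_mul_bounded gi bg.
have f2i := square_integrable_sq f2.
rewrite -RintegralZl// -RintegralZl// -RintegralB//; last 2 first.
- have := integrableZl measurableT (c ^+ 2) f2i; exact.
- have := integrableZl measurableT (2 * c) fgi; exact.
rewrite -RintegralD//; last first.
  have := integrableB measurableT (integrableZl measurableT (c ^+ 2) f2i)
    (integrableZl measurableT (2 * c) fgi); exact.
apply: Rintegral_ge0 => x _.
by rewrite (_ : _ + _ = (c * f x - g x) ^+ 2) ?sqr_ge0//; ring.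
Qed.

Lemma qformD k l f : square_integrable f -> bounded_kernel k -> bounded_kernel l ->
  qform (fun p => k p + l p) f = qform k f + qform l f.
Proof.
move=> f2 bk bl; have fi := square_integrable_int f2.
rewrite /qform -RintegralD//; [|exact: (prod_integrable fi fi bk)|exact: (prod_integrable fi fi bl)].
by apply: eq_Rintegral => p _; rewrite mulrDr.
Qed.

Lemma qformZ c k f : square_integrable f -> bounded_kernel k ->
  qform (fun p => c * k p) f = c * qform k f.
Proof.
move=> f2 bk; have fi := square_integrable_int f2.
rewrite /qform -RintegralZl//; last exact: (prod_integrable fi fi bk).
by apply: eq_Rintegral => p _; rewrite mulrCA.
Qed.

Lemma qform_sum m (k : 'I_m -> T * T -> R) f : square_integrable f ->
  (forall i, bounded_kernel (k i)) ->
  qform (fun p => \sum_i k i p) f = \sum_i qform (k i) f.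
Proof.
move=> f2; elim: m k => [|m IHm] k bk.
  rewrite big_ord0 -[RHS](mul0r (qform (fun=> 1) f)) -qformZ//; last exact: bounded_kernel_cst.
  by apply: eq_Rintegral => p _; rewrite big_ord0 mul0r.
rewrite big_ord_recr/= -IHm// -qformD//; last exact: bounded_kernel_sum.
by apply: eq_Rintegral => p _; rewrite big_ord_recr.
Qed.

Definition psd k := forall f, square_integrable f -> 0 <= qform k f.

Lemma psd_mul k (e : T -> R) : psd k -> bounded_kernel e ->
  psd (fun p => k p * (e p.1 * e p.2)).
Proof.
move=> pk be f f2; rewrite (_ : qform _ _ = qform k (fun x => f x * e x)).
  by apply: pk; exact: square_integrableM.
by apply: eq_Rintegral => p _ /=; ring.
Qed.

(** The Schur product with a finite Gram kernel: the summand of index i contributes the form of [k]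
    at f e_i. *)
Lemma psd_mul_sum k (I : finType) (e : I -> T -> R) : psd k -> bounded_kernel k ->
  (forall i, bounded_kernel (e i)) ->
  psd (fun p => k p * \sum_i (e i p.1 * e i p.2)).
Proof.
move=> pk bk be f f2.
rewrite (_ : qform _ _ = qform (fun p => \sum_(i < #|I|)
    k p * (e (enum_val i) p.1 * e (enum_val i) p.2)) f); last first.
  apply: eq_Rintegral => p _; congr (_ * _).
  rewrite mulr_sumr [RHS](reindex_onto (@enum_rank I) (@enum_val I _))/=; last first.
    by move=> i _; exact: enum_valK.
  apply: eq_big => [i|i _]; rewrite enum_rankK ?eqxx//.
rewrite qform_sum//; first by apply: sumr_ge0 => i _; exact: psd_mul.
move=> i; apply: bounded_kernelM => //; apply: bounded_kernelM;
  exact: (bounded_kernel_comp _ (be _)).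
Qed.

Lemma qform_bound k f (M : R) : square_integrable f -> bounded_kernel k ->
  (forall p, `|k p| <= M) -> `|qform k f| <= M * (\int[mu]_x `|f x|) ^+ 2.
Proof.
move=> f2 bk kM; have fi := square_integrable_int f2.
have nfi : mu.-integrable setT (EFin \o (fun y => `|f y|)) by exact: integrable_norm.
have ki := prod_integrable fi fi bk.
have b1 : bounded_kernel (fun _ : T * T => M) by exact: bounded_kernel_cst.
rewrite /qform (le_trans (le_normr_Rintegral _ ki))//.
apply: (@le_trans _ _ (\int[(mu \x mu)%E]_p (`|f p.1| * `|f p.2| * M))).
  apply: le_Rintegral => //.
  - exact: (integrable_norm ki).
  - exact: (prod_integrable nfi nfi b1).
  by move=> p _; rewrite !normrM ler_wpM2l// mulr_ge0.
rewrite (prod_Rintegral nfi nfi b1).1 /kop le_eqVlt; apply/orP; left; apply/eqP.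
transitivity (\int[mu]_x (`|f x| * (M * \int[mu]_y `|f y|))).
  by apply: eq_Rintegral => x _; rewrite RintegralZl.
by rewrite RintegralZr//; ring.
Qed.

End quadratic_forms.

(** * Orthogonal families of kernels and Bessel's inequality *)

Section orthogonal_kernels.
Context d (T : measurableType d) (R : realType).
Variable mu : {sigma_finite_measure set T -> \bar R}.
Hypothesis mu_fin : (mu setT < +oo)%E.
Variables (Z : nat -> T * T -> R) (gamma : nat -> R).
Hypothesis bZ : forall i, bounded_kernel (Z i).
Hypothesis ZC : forall i x y, Z i (y, x) = Z i (x, y).
Hypothesis gamma_ge0 : forall i, 0 <= gamma i.
Hypothesis Zconv : forall i j x y,
  \int[mu]_z (Z i (z, x) * Z j (z, y)) = (i == j)%:R * gamma i * Z i (y, x).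

(** With q the form at f, [qform_square] reads c^2 |f|^2 - 2 c q + gamma q >= 0 for all c. If gamma
    > 0, take c = 0; if gamma = 0, the choice c = q / (|f|^2 + 1) excludes q < 0. *)
Lemma psd_idempotent i : psd mu (Z i).
Proof.
move=> f f2; have h c : 0 <= c ^+ 2 * (\int[mu]_x f x ^+ 2) -
    2 * c * qform mu (Z i) f + gamma i * qform mu (Z i) f.
  rewrite -(qformZ mu_fin _ f2 (bZ i)).
  apply: (qform_square mu_fin c f2 (bZ i)) => //; first exact: bounded_kernelZ.
  by move=> x y; rewrite Zconv eqxx mul1r.
set q := qform _ _ _ in h *; set F := \int[mu]_x _ in h.
have F0 : 0 <= F by apply: Rintegral_ge0 => x _; exact: sqr_ge0.
rewrite leNgt; apply/negP => q0.
have [g0|g0] := ltP 0 (gamma i).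
  have := h 0; rewrite expr0n/= mul0r mulr0 mul0r subr0 add0r.
  by rewrite pmulr_rge0// leNgt q0.
have gz : gamma i = 0 by apply/eqP; rewrite eq_le g0 gamma_ge0.
have := h (q / (F + 1)); rewrite gz mul0r addr0.
have F1 : 0 < F + 1 by lra.
rewrite (_ : _ - _ = (q / (F + 1)) ^+ 2 * (- F - 2)); last by field; lra.
rewrite nmulr_lge0; last by lra.
by rewrite leNgt exprn_even_gt0//= mulf_neq0 ?invr_neq0//; lra.
Qed.

(** The square of k = sum beta_i Z_i is l = sum beta_i^2 gamma_i Z_i, whose form is at most C X when
    X is the form of k, each Z_i being positive semidefinite. Then [qform_square] at c = C gives 0
    <= C^2 |f|^2 - 2 C X + C X. *)
Lemma bessel (beta : nat -> R) (C : R) M f : square_integrable mu f -> 0 < C ->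
  (forall i, 0 <= beta i) -> (forall i, beta i * gamma i <= C) ->
  \sum_(i < M) beta i * qform mu (Z i) f <= C * (\int[mu]_x f x ^+ 2).
Proof.
move=> f2 C0 beta0 bg.
pose k p := \sum_(i < M) beta i * Z i p.
pose l p := \sum_(i < M) (beta i ^+ 2 * gamma i) * Z i p.
have bk : bounded_kernel k.
  by apply: bounded_kernel_sum => i; exact: bounded_kernelZ.
have bl : bounded_kernel l.
  by apply: bounded_kernel_sum => i; exact: bounded_kernelZ.
have kl x y : \int[mu]_z (k (z, x) * k (z, y)) = l (y, x).
  have sumI m (G : 'I_m -> T -> R) :
      (forall i, bounded_kernel (G i)) ->
      \int[mu]_z \sum_(i < m) G i z = \sum_(i < m) \int[mu]_z G i z.
    elim: m G => [|m IHm] G bG.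
      by rewrite big_ord0 (_ : (fun _ => _) = fun=> 0) ?Rintegral_cst ?mul0r//;
        apply/funext => z; rewrite big_ord0.
    rewrite big_ord_recr/= -IHm// -RintegralD//.
    - by apply: eq_Rintegral => z _; rewrite big_ord_recr.
    - by apply: (bounded_kernel_int mu_fin); exact: bounded_kernel_sum.
    - exact: bounded_kernel_int.
  have bZZ i j : bounded_kernel (fun z => Z i (z, x) * Z j (z, y)).
    by apply: bounded_kernelM; exact: bounded_section2.
  transitivity (\sum_(i < M) \sum_(j < M) \int[mu]_z
      ((beta i * beta j) * (Z i (z, x) * Z j (z, y)))).
    transitivity (\int[mu]_z (\sum_(i < M) \sum_(j < M)
        (beta i * beta j) * (Z i (z, x) * Z j (z, y)))).
      apply: eq_Rintegral => z _; rewrite /k mulr_suml; apply: eq_bigr => i _.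
      by rewrite mulr_sumr; apply: eq_bigr => j _; ring.
    rewrite (sumI _ (fun (i : 'I_M) z => \sum_(j < M)
        (beta i * beta j) * (Z i (z, x) * Z j (z, y)))); last first.
      by move=> i; apply: bounded_kernel_sum => j; exact: bounded_kernelZ.
    apply: eq_bigr => i _.
    rewrite (sumI _ (fun (j : 'I_M) z => (beta i * beta j) * (Z i (z, x) * Z j (z, y))))//.
    by move=> j; exact: bounded_kernelZ.
  apply: eq_bigr => i _; rewrite (bigD1 i)//= big1 ?addr0 => [|j ji].
    rewrite RintegralZl//; last exact: (bounded_kernel_int mu_fin (bZZ i i)).
    by rewrite Zconv eqxx mul1r; ring.
  rewrite RintegralZl//; last exact: (bounded_kernel_int mu_fin (bZZ i j)).
  have ij : (i == j :> nat) = false by rewrite eq_sym; exact: negbTE ji.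
  by rewrite Zconv ij !mul0r mulr0.
have kC x y : k (y, x) = k (x, y).
  by apply: eq_bigr => i _; rewrite ZC.
have := qform_square mu_fin C f2 bk bl kC kl.
have qk : qform mu k f = \sum_(i < M) beta i * qform mu (Z i) f.
  rewrite qform_sum//; first by apply: eq_bigr => i _; exact: qformZ.
  by move=> i; exact: bounded_kernelZ.
have ql : qform mu l f = \sum_(i < M) (beta i ^+ 2 * gamma i) * qform mu (Z i) f.
  rewrite qform_sum//; first by apply: eq_bigr => i _; exact: qformZ.
  by move=> i; exact: bounded_kernelZ.
rewrite qk; set X := \sum_(i < M) _; set F := \int[mu]_x _ => h.
have lX : qform mu l f <= C * X.
  rewrite ql /X mulr_sumr; apply: ler_sum => i _.
  rewrite mulrA; apply: ler_wpM2r; first exact: psd_idempotent.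
  by rewrite expr2 -mulrA mulrC ler_wpM2r.
rewrite -(ler_pM2l C0); lra.
Qed.

End orthogonal_kernels.

(** * Coefficients of the binomial series *)

Section binomial_series.
Context (R : realType) (a : R).
Hypotheses (a_gt0 : 0 < a) (a_lt1 : a < 1).

(* Coefficients of the binomial series of (1 - x)^(- a). *)
Fixpoint acoef (j : nat) : R :=
  if j is i.+1 then acoef i * ((a + i%:R) / i.+1%:R) else 1.

Lemma acoefS j : acoef j.+1 * j.+1%:R = acoef j * (a + j%:R).
Proof. by rewrite /= -mulrA divfK// pnatr_eq0. Qed.

Lemma acoef_gt0 j : 0 < acoef j.
Proof.
elim: j => //= j IHj; rewrite mulr_gt0// divr_gt0// ?ltr0n//.
by rewrite ltr_pwDl// ler0n.
Qed.

Lemma acoef_leS j : acoef j.+1 <= acoef j.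
Proof.
rewrite /= ler_piMr ?ltW ?acoef_gt0// ltr_pdivrMr ?ltr0n// mul1r.
by rewrite -natr1 addrC ltrD2l.
Qed.

Lemma acoef_le i j : (i <= j)%N -> acoef j <= acoef i.
Proof.
move=> /subnK <-; elim: (j - i)%N => // k IHk.
by rewrite addSn (le_trans (acoef_leS _)).
Qed.

Lemma acoef_le1 j : acoef j <= 1.
Proof. exact: (@acoef_le 0). Qed.

(** The ratios (a + j) / (j + 1) of consecutive coefficients increase with j because a < 1. *)
Lemma acoef_logconvex k m : (k <= m)%N ->
  acoef m * acoef k.+1 <= acoef m.+1 * acoef k.
Proof.
move=> km /=; rewrite mulrA [leRHS]mulrAC -!mulrA !ler_pM2l ?acoef_gt0//.
rewrite ler_pdivrMr ?ltr0n// mulrAC ler_pdivlMr ?ltr0n// -!natr1.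
have : k%:R <= m%:R :> R by rewrite ler_nat.
move: (k%:R) (m%:R) => x y xy.
have h : 0 <= (y - x) * (1 - a) by rewrite mulr_ge0// subr_ge0// ltW.
rewrite -subr_ge0 (_ : _ - _ = (y - x) * (1 - a))//; ring.
Qed.

End binomial_series.

(** * Expansion of squared partial sums *)

Section schur_expansion.
Context (R : realType).
Implicit Types (B : nat -> R) (q : nat -> nat -> R).

(** For q k m = |x|^(2 k) h_m and m > 0 this is |x|^(2 k) (x^m + conj(x)^m), since h_m - |x|^2 h_(m
    - 2) = x^m + conj(x)^m; these are the cross terms of the square. *)
Definition tschur q k m := if m is m'.+2 then q k m - q k.+1 m' else q k m.

(* The expansion of | sum_(j <= M) B_j x^j |^2 in q k m = |x|^(2 k) h_m(x, x^* ). *)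
Fixpoint sq_schur B q M : R :=
  if M is M'.+1 then sq_schur B q M' + (B M ^+ 2 * q M 0%N +
    B M * \sum_(k < M) B k * tschur q k (M - k))
  else q 0%N 0%N.

(* Log-convexity of B makes all terms with k > 0 negative, except for those of
   index j = M, due to the truncation. *)
Lemma sq_schur_le B q M : B 0%N = 1 ->
  (forall j, 0 <= B j) -> (forall k m, (k <= m)%N -> B m * B k.+1 <= B m.+1 * B k) ->
  (forall k m, 0 <= q k m) ->
  sq_schur B q M <= \sum_(j < M.+1) B j * q 0%N j +
    B M * \sum_(k < M) B k.+1 * q k.+1 (M - k.+1)%N.
Proof.
move=> B0 B_ge0 Blc q0; elim: M => [|M IHM].
  by rewrite /= big_ord1 big_ord0 B0 mul1r mulr0 addr0.
rewrite [leLHS]/=.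
have E1 : \sum_(k < M.+1) B k * tschur q k (M.+1 - k) =
    \sum_(k < M.+1) B k * q k (M.+1 - k)%N -
    \sum_(k < M) B k * q k.+1 (M - k.+1)%N.
  rewrite big_ord_recr [X in _ = X - _]big_ord_recr/= subSnn/=.
  rewrite addrAC -sumrB; congr (_ + _); apply: eq_bigr => k _.
  have kM := ltn_ord k.
  rewrite (_ : (M.+1 - k = (M - k.+1).+2)%N); last by lia.
  by rewrite /= mulrBr.
have E2 : \sum_(k < M.+1) B k * q k (M.+1 - k)%N =
    q 0%N M.+1 + \sum_(k < M) B k.+1 * q k.+1 (M - k)%N.
  by rewrite big_ord_recl/= B0 mul1r subn0.
have E3 : \sum_(k < M.+1) B k.+1 * q k.+1 (M.+1 - k.+1)%N =
    \sum_(k < M) B k.+1 * q k.+1 (M - k)%N + B M.+1 * q M.+1 0%N.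
  rewrite big_ord_recr/= subnn; congr (_ + _).
rewrite E1 E2 E3 [X in _ <= X + _]big_ord_recr/=.
(* The remainder left at index M is absorbed by the negative terms of index M + 1: this is where
   log-convexity enters. *)
have E4 : B M * \sum_(k < M) B k.+1 * q k.+1 (M - k.+1)%N <=
    B M.+1 * \sum_(k < M) B k * q k.+1 (M - k.+1)%N.
  rewrite !mulr_sumr; apply: ler_sum => k _; rewrite !mulrA ler_wpM2r//.
  by apply: Blc; exact: ltnW.
apply: le_trans (lerD IHM (lexx _)) _.
rewrite mulrBr !mulrDr expr2 mulrA.
move: E4; set X1 := B M * \sum_(k < M) _; set X2 := B M.+1 * \sum_(k < M) B k * _.
lra.
Qed.

Section complex_powers.
Variables (c y : R).
(** Real and imaginary parts of (c + i y)^j, kept as reals because the partial sums are later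
    differentiated in a real parameter. *)
Fixpoint upow (j : nat) : R * R :=
  if j is i.+1 then (c * (upow i).1 - y * (upow i).2, c * (upow i).2 + y * (upow i).1)
  else (1, 0).
Let dd := c ^+ 2 + y ^+ 2.
Let u j := (upow j).1.
Let v j := (upow j).2.

Lemma upow_norm j : u j ^+ 2 + v j ^+ 2 = dd ^+ j.
Proof.
elim: j => [|j IHj]; first by rewrite /u /v /= expr1n !expr0n/= addr0 expr0.
by rewrite [RHS]exprS -IHj /u /v /dd /=; ring.
Qed.

(** Real part of x^(k + m) conj(x)^k = |x|^(2 k) x^m. *)
Lemma upow_dot k m : u (k + m) * u k + v (k + m) * v k = dd ^+ k * u m.
Proof.
elim: k => [|k IHk]; first by rewrite add0n {2}/u {2}/v /=; ring.
by rewrite addSn [in RHS]exprS -mulrA -IHk /u /v /dd /=; ring.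
Qed.

Lemma upow_tschur m : 2 * u m.+1 = tschur (fun k m => dd ^+ k * hsym (2 * c) dd m) 0 m.+1.
Proof.
have rec j : u j.+2 = 2 * c * u j.+1 - dd * u j by rewrite /u /dd /=; ring.
have key j : 2 * u j.+2 = hsym (2 * c) dd j.+2 - dd * hsym (2 * c) dd j.
  elim/nat_ind2: j => [||j IH0 IH1].
  - by rewrite rec /u /dd /=; ring.
  - by rewrite !rec /u /dd /=; ring.
  rewrite rec mulrBr mulrCA IH1 (mulrCA _ dd) IH0.
  by rewrite [in RHS](hsymSS _ _ j.+2) [X in _ = _ - _ * X](hsymSS _ _ j); ring.
by case: m => [|m]; [rewrite /u /=; ring|rewrite key /= expr0 expr1 mul1r].
Qed.

Fixpoint psum B M : R * R :=
  if M is M'.+1 then ((psum B M').1 + B M * u M, (psum B M').2 + B M * v M)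
  else (B 0%N, 0).

Lemma psumE B M : psum B M = (\sum_(k < M.+1) B k * u k, \sum_(k < M.+1) B k * v k).
Proof.
elim: M => [|M IHM]; first by rewrite !big_ord1 /u /v /= mulr1 mulr0.
by rewrite !(big_ord_recr M.+1) /= IHM.
Qed.

(** The new term of index j = M + 1 adds B_j^2 |x|^(2 j) and the cross terms 2 B_j B_k Re(x^j
    conj(x)^k), which [upow_dot] and [upow_tschur] turn into [tschur]. *)
Lemma psum_sq B M : B 0%N = 1 ->
  (psum B M).1 ^+ 2 + (psum B M).2 ^+ 2 =
  sq_schur B (fun k m => dd ^+ k * hsym (2 * c) dd m) M.
Proof.
move=> B0; elim: M => [|M IHM]; first by rewrite /= B0 expr0; ring.
rewrite [RHS]/= -IHM.
have -> : psum B M.+1 = ((psum B M).1 + B M.+1 * u M.+1, (psum B M).2 + B M.+1 * v M.+1) by [].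
have -> : \sum_(k < M.+1) B k * tschur (fun k m => dd ^+ k * hsym (2 * c) dd m) k (M.+1 - k) =
    2 * ((psum B M).1 * u M.+1 + (psum B M).2 * v M.+1).
  rewrite psumE /fst /snd mulr_suml mulr_suml -big_split/= mulr_sumr; apply: eq_bigr => k _.
  have kM : (k <= M)%N by rewrite -ltnS.
  have -> : 2 * (B k * u k * u M.+1 + B k * v k * v M.+1) =
      B k * (2 * (u M.+1 * u k + v M.+1 * v k)) by ring.
  congr (_ * _).
  move: (nat_of_ord k) kM => {}k kM.
  have E : M.+1 = (k + (M - k).+1)%N by lia.
  rewrite [in RHS]E upow_dot mulrCA upow_tschur subSn//.
  by case: (M - k)%N => [|j] /=; rewrite ?exprSr expr0; ring.
rewrite mulr1 -upow_norm.
move: (u M.+1) (v M.+1) (psum B M) => x z [X Y]; rewrite /fst /snd; ring.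
Qed.

Lemma upow_bound j : dd <= 1 -> `|u j| <= 1 /\ `|v j| <= 1.
Proof.
move=> d1; have d0 : 0 <= dd by rewrite addr_ge0 ?sqr_ge0.
have := upow_norm j; have : dd ^+ j <= 1 by rewrite exprn_ile1.
have := sqr_ge0 (u j); have := sqr_ge0 (v j); move=> h1 h2 h3 h4.
by split; rewrite -(@ler_pXn2r _ 2)// ?nnegrE// expr1n real_normK ?num_real//; lra.
Qed.

(** h_m is a sum of m + 1 monomials of modulus at most 1. In real terms, h_(k + 1) = c h_k + Re x^(k
    + 1) adds at most 1 at each step. *)
Lemma hsym_bound m : dd <= 1 -> `|hsym (2 * c) dd m| <= m.+1%:R.
Proof.
move=> d1; have c1 : `|c| <= 1.
  rewrite -(@ler_pXn2r _ 2)// ?nnegrE// expr1n real_normK ?num_real//.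
  by have := sqr_ge0 y; move: d1; rewrite /dd; lra.
have hS k : hsym (2 * c) dd k.+1 = c * hsym (2 * c) dd k + u k.+1.
  elim/nat_ind2: k => [||k IH0 IH1]; [by rewrite /u /=; ring|by rewrite /u /dd /=; ring|].
  have -> : u k.+3 = 2 * c * u k.+2 - dd * u k.+1 by rewrite /u /dd /=; ring.
  have e2 : dd * hsym (2 * c) dd k = 2 * c * hsym (2 * c) dd k.+1 - hsym (2 * c) dd k.+2.
    by rewrite hsymSS; ring.
  have e1 : u k.+2 = hsym (2 * c) dd k.+2 - c * hsym (2 * c) dd k.+1 by rewrite IH1; ring.
  rewrite hsymSS e1.
  have -> : dd * hsym (2 * c) dd k.+1 = c * (dd * hsym (2 * c) dd k) + dd * u k.+1.
    by rewrite IH0; ring.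
  by rewrite e2; ring.
elim: m => [|m IHm]; first by rewrite /= normr1.
rewrite hS (_ : m.+2%:R = m.+1%:R + 1 :> R); last by rewrite natr1.
apply: le_trans (ler_normD _ _) _; apply: lerD.
  by rewrite normrM; apply: le_trans IHm; rewrite ler_piMl.
by have [] := upow_bound m.+1 d1.
Qed.

End complex_powers.

End schur_expansion.

(** * Approximation of the power kernel by squares of partial sums *)

Section real_derivatives.
Context (R : realType).
Implicit Types (f g : R -> R) (t : R).

Lemma rderiveD f g t df dg : is_derive t 1 f df -> is_derive t 1 g dg ->
  is_derive t 1 (fun s => f s + g s) (df + dg).
Proof. exact: is_deriveD. Qed.

Lemma rderiveM f g t df dg : is_derive t 1 f df -> is_derive t 1 g dg ->
  is_derive t 1 (fun s => f s * g s) (f t * dg + g t * df).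
Proof. exact: is_deriveM. Qed.

Lemma rderive_cst (x t : R) : is_derive t 1 (fun=> x) 0.
Proof. exact: is_derive_cst. Qed.

Lemma rderive_id t : is_derive t 1 (fun s : R => s) 1.
Proof. exact: is_derive_id. Qed.

Lemma rderive_eq f t df dg : is_derive t 1 f df -> df = dg -> is_derive t 1 f dg.
Proof. by move=> fd <-. Qed.

Lemma rderiveX t j : is_derive t 1 (fun s : R => s ^+ j.+1) (j.+1%:R * t ^+ j).
Proof.
elim: j => [|j IHj].
  by rewrite expr0 mulr1; exact: rderive_id.
under eq_fun do rewrite exprS.
apply: rderive_eq (rderiveM (rderive_id t) IHj) _.
by rewrite -(natr1 j.+1) exprS; ring.
Qed.

End real_derivatives.

Section binomial_square.
Context (R : realType) (a : R).
Hypotheses (a_gt0 : 0 < a) (a_lt1 : a < 1).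
Variables (c y : R).
Hypothesis cy1 : c ^+ 2 + y ^+ 2 <= 1.
Let u j := (upow c y j).1.
Let v j := (upow c y j).2.

Definition bcoef (t : R) (j : nat) := acoef a j * t ^+ j.

Fixpoint dpsum (t : R) M : R * R :=
  if M is M'.+1 then ((dpsum t M').1 + acoef a M * (M%:R * t ^+ M') * u M,
                      (dpsum t M').2 + acoef a M * (M%:R * t ^+ M') * v M)
  else (0, 0).

Let p M t := (psum c y (bcoef t) M).1.
Let q M t := (psum c y (bcoef t) M).2.

Lemma is_derive_psum M (t : R) :
  is_derive t 1 (p M) (dpsum t M).1 /\ is_derive t 1 (q M) (dpsum t M).2.
Proof.
have mono M' (r : R) : is_derive t 1 (fun t => bcoef t M'.+1 * r)
    (acoef a M'.+1 * (M'.+1%:R * t ^+ M') * r).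
  under eq_fun do rewrite /bcoef mulrAC mulrC.
  apply: rderive_eq (rderiveM (rderiveX t M') (rderive_cst (acoef a M'.+1 * r) t)) _.
  by rewrite mulr0 add0r mulrAC.
elim: M => [|M [IHp IHq]].
  split.
    rewrite (_ : p 0 = cst 1); first exact: is_derive_cst.
    by apply/funext => s; rewrite /p /bcoef /= mulr1.
  rewrite (_ : q 0 = cst 0); first exact: is_derive_cst.
  by apply/funext.
split; first exact: (is_deriveD IHp (mono M (u M.+1))).
exact: (is_deriveD IHq (mono M (v M.+1))).
Qed.

(* (1 - t x) F' = a x F - (a + M) A_M x^(M + 1) t^M for the truncated series F. *)
Lemma dpsum_ode M t :
  (dpsum t M).1 - t * (c * (dpsum t M).1 - y * (dpsum t M).2) =
    a * (c * p M t - y * q M t) - acoef a M * (a + M%:R) * u M.+1 * t ^+ M /\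
  (dpsum t M).2 - t * (c * (dpsum t M).2 + y * (dpsum t M).1) =
    a * (c * q M t + y * p M t) - acoef a M * (a + M%:R) * v M.+1 * t ^+ M.
Proof.
elim: M => [|M [IH1 IH2]].
  by rewrite /p /q /u /v /bcoef /= expr0; split; ring.
have EA := acoefS a M.
have pS : p M.+1 t = p M t + bcoef t M.+1 * u M.+1 by [].
have qS : q M.+1 t = q M t + bcoef t M.+1 * v M.+1 by [].
have dS1 : (dpsum t M.+1).1 = (dpsum t M).1 + acoef a M.+1 * (M.+1%:R * t ^+ M) * u M.+1 by [].
have dS2 : (dpsum t M.+1).2 = (dpsum t M).2 + acoef a M.+1 * (M.+1%:R * t ^+ M) * v M.+1 by [].
have uS : u M.+2 = c * u M.+1 - y * v M.+1 by [].
have vS : v M.+2 = c * v M.+1 + y * u M.+1 by [].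
rewrite pS qS dS1 dS2 uS vS /bcoef exprS.
move: IH1 IH2 EA; rewrite -!natr1.
move: (acoef a M.+1) (acoef a M) (p M t) (q M t) (dpsum t M) (u M.+1) (v M.+1) (t ^+ M) (M%:R).
move=> A1 A0 P Q [D1 D2] U V T m /= IH1 IH2 EA; split.
  transitivity (D1 - t * (c * D1 - y * D2) + A1 * (m + 1) * T * (U - t * (c * U - y * V))).
    by ring.
  rewrite IH1 EA.
  transitivity (a * (c * P - y * Q) - t * (A0 * (a + m)) * T * (c * U - y * V)); first by ring.
  rewrite -EA; ring.
transitivity (D2 - t * (c * D2 + y * D1) + A1 * (m + 1) * T * (V - t * (c * V + y * U))).
  by ring.
rewrite IH2 EA.
transitivity (a * (c * Q + y * P) - t * (A0 * (a + m)) * T * (c * V + y * U)); first by ring.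
rewrite -EA; ring.
Qed.

(** This is |1 - t x|^2 for x = c + i y. *)
Let ell (t : R) : R := (1 - t * c) ^+ 2 + (t * y) ^+ 2.

Lemma c_le1 : `|c| <= 1.
Proof.
rewrite -(@ler_pXn2r _ 2)// ?nnegrE// expr1n real_normK ?num_real//.
by have := sqr_ge0 y; have := cy1; lra.
Qed.

Lemma y_le1 : `|y| <= 1.
Proof.
rewrite -(@ler_pXn2r _ 2)// ?nnegrE// expr1n real_normK ?num_real//.
by have := sqr_ge0 c; have := cy1; lra.
Qed.

Lemma ell_ge t : 0 <= t -> t <= 1 -> (1 - t) ^+ 2 <= ell t.
Proof.
move=> t0 t1; have /ler_normlP[_ c1] := c_le1.
have : t * c <= t by rewrite ler_piMr.
by move=> h; rewrite /ell; have := sqr_ge0 (t * y); nra.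
Qed.

Lemma ell_le t : 0 <= t -> t <= 1 -> ell t <= 4.
Proof.
move=> t0 t1; have /ler_normlP[c1 _] := c_le1.
rewrite (_ : ell t = 1 - 2 * (t * c) + t ^+ 2 * (c ^+ 2 + y ^+ 2)); last first.
  by rewrite /ell; ring.
have : t ^+ 2 * (c ^+ 2 + y ^+ 2) <= 1.
  by rewrite mulr_ile1 ?addr_ge0 ?sqr_ge0// exprn_ile1.
have : 0 <= (1 + c) * t by rewrite mulr_ge0//; lra.
lra.
Qed.


Lemma is_derive_ell (t : R) : is_derive t 1 (ell : R -> R) (- 2 * c * (1 - t * c) + 2 * t * y ^+ 2).
Proof.
have dc : is_derive t 1 (fun s => 1 + (- c) * s) (- c).
  apply: rderive_eq (rderiveD (rderive_cst 1 t) (rderiveM (rderive_cst (- c) t) (rderive_id t))) _.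
  by rewrite mulr0 addr0 add0r mulr1.
have dy : is_derive t 1 (fun s => y * s) y.
  apply: rderive_eq (rderiveM (rderive_cst y t) (rderive_id t)) _.
  by rewrite mulr0 addr0 mulr1.
rewrite (_ : ell = fun s => (1 + (- c) * s) * (1 + (- c) * s) + (y * s) * (y * s)); last first.
  by apply/funext => s; rewrite /ell; ring.
by apply: rderive_eq (rderiveD (rderiveM dc dc) (rderiveM dy dy)) _; ring.
Qed.

(** For the full series F, |F|^2 |1 - t x|^(2 a) is identically 1. For the partial sum its
    derivative [dD] retains only the truncation term of the differential equation, so [D] stays
    close to its value 1 at t = 0. *)
Let D M (t : R) : R := (p M t ^+ 2 + q M t ^+ 2) * ell t `^ a.

Let dD M (t : R) : R := - 2 * ell t `^ (a - 1) * (acoef a M * (a + M%:R) * t ^+ M) *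
  (p M t * ((1 - t * c) * u M.+1 - t * y * v M.+1) +
   q M t * ((1 - t * c) * v M.+1 + t * y * u M.+1)).

Lemma is_derive_D M (t : R) : 0 <= t -> t < 1 -> is_derive t 1 (D M) (dD M t).
Proof.
move=> t0 t1; have ell0 : 0 < ell t.
  by apply: lt_le_trans (ell_ge t0 (ltW t1)); rewrite exprn_gt0// subr_gt0.
have [dp dq] := is_derive_psum M t.
have dl := is_derive_ell t.
have dpow : is_derive t 1 (fun s => ell s `^ a)
    ((a * ell t `^ (a - 1)) * (- 2 * c * (1 - t * c) + 2 * t * y ^+ 2)).
  have dpw := is_derive1_powR a ell0.
  have := @is_derive1_comp _ (@powR R ^~ a) ell t _ _ dpw dl.
  by [].
rewrite (_ : D M = fun s => (p M s * p M s + q M s * q M s) * ell s `^ a); last first.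
  by apply/funext => s; rewrite /D !expr2.
apply: rderive_eq (rderiveM (rderiveD (rderiveM dp dp) (rderiveM dq dq)) dpow) _.
have -> : ell t `^ a = ell t `^ (a - 1) * ell t.
  rewrite -[X in _ = _ * X](powRr1 (ltW ell0)) -powRD ?subrK//.
  by rewrite (gt_eqF ell0) implybT.
have [E1 E2] := dpsum_ode M t.
rewrite /dD.
move: E1 E2; move: (p M t) (q M t) (dpsum t M) (u M.+1) (v M.+1) (ell t `^ (a - 1)).
rewrite /ell; move: (acoef a M * _) (t ^+ M) => r T P Q [D1 D2] U V L /= E1 E2.
(* [X] and [Y] are the real and imaginary parts of (1 - t x) F', which the differential equation
   provides. *)
pose X := D1 - t * (c * D1 - y * D2); pose Y := D2 - t * (c * D2 + y * D1).
transitivity (L * ((P ^+ 2 + Q ^+ 2) * (a * (- 2 * c * (1 - t * c) + 2 * t * y ^+ 2)) +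
  2 * (P * ((1 - t * c) * X - t * y * Y) + Q * ((1 - t * c) * Y + t * y * X)))).
  rewrite /X /Y; ring.
by rewrite /X /Y E1 E2; ring.
Qed.

Lemma psum_bound M (t : R) : 0 <= t -> t <= 1 ->
  `|p M t| <= M.+1%:R /\ `|q M t| <= M.+1%:R.
Proof.
move=> t0 t1; have b0 k : 0 <= bcoef t k.
  by rewrite mulr_ge0 ?exprn_ge0// ltW// acoef_gt0.
have b1 k : bcoef t k <= 1.
  by rewrite mulr_ile1 ?exprn_ge0 ?exprn_ile1 ?acoef_le1// ltW// acoef_gt0.
have bw k (w : R) : `|w| <= 1 -> `|bcoef t k * w| <= 1.
  by move=> w1; rewrite normrM ger0_norm// mulr_ile1.
elim: M => [|M [IHp IHq]].
  by rewrite /p /q /bcoef /= mulr1 normr0 normr1; split.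
have [uM vM] := upow_bound M.+1 cy1.
have S : M.+2%:R = M.+1%:R + 1 :> R by rewrite natr1.
by split; rewrite S; apply: le_trans (ler_normD _ _) _; apply: lerD => //; exact: bw.
Qed.

Lemma dD_bound M (s t : R) : 0 <= s -> s <= t -> t < 1 ->
  `|dD M s| <= 48 * M.+1%:R ^+ 2 * t ^+ M / (1 - t) ^+ 2.
Proof.
move=> s0 st t1; have s1 : s < 1 by exact: le_lt_trans t1.
have t0 : 0 <= t by exact: le_trans st.
have t1p : 0 < (1 - t) ^+ 2 by rewrite exprn_gt0// subr_gt0.
have ell_ge' : (1 - t) ^+ 2 <= ell s.
  apply: le_trans (ell_ge s0 (ltW s1)).
  by rewrite ler_pXn2r ?nnegrE ?subr_ge0 ?(ltW t1) ?(ltW s1)// lerD2l lerN2.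
have ell0 : 0 < ell s by exact: lt_le_trans ell_ge'.
have ell_pow : ell s `^ (a - 1) <= 4 / (1 - t) ^+ 2.
  have -> : ell s `^ (a - 1) = ell s `^ a / ell s.
    by rewrite powRB ?(gt_eqF ell0) ?implybT// powRr1// ltW.
  apply: ler_pM; rewrite ?powR_ge0 ?invr_ge0 ?(ltW ell0)//.
    apply: (@le_trans _ _ (4 `^ a)).
      by apply: ge0_ler_powR; rewrite ?nnegrE ?(ltW a_gt0) ?(ltW ell0) ?ell_le ?(ltW s1).
    rewrite -[X in _ <= X]powRr1//; apply: ler_powR; last exact: ltW.
    by rewrite ler1n.
  by rewrite lef_pV2 ?posrE.
have [pM qM] := psum_bound M s0 (ltW s1).
have [uM vM] := upow_bound M.+1 cy1.
have c1 := c_le1; have y1 := y_le1.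
have tc : `|1 - s * c| <= 2.
  rewrite (le_trans (ler_normB _ _))// normr1 (_ : 2 = 1 + 1)// lerD2l normrM.
  by rewrite mulr_ile1// ger0_norm// ltW.
have ty : `|s * y| <= 1.
  by rewrite normrM mulr_ile1// ger0_norm// ltW.
have brk (w w' : R) : `|w| <= 1 -> `|w'| <= 1 ->
    `|(1 - s * c) * w| + `|s * y * w'| <= 3.
  move=> w1 w1'; rewrite (_ : 3 = 2 * 1 + 1 * 1); last by ring.
  by rewrite lerD// normrM ler_pM.
have M0 : 0 <= M.+1%:R :> R by rewrite ler0n.
have rest : `|p M s * ((1 - s * c) * u M.+1 - s * y * v M.+1) +
   q M s * ((1 - s * c) * v M.+1 + s * y * u M.+1)| <= M.+1%:R * 3 + M.+1%:R * 3.
  apply: le_trans (ler_normD _ _) _; rewrite !normrM; apply: lerD; apply: ler_pM => //.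
    by apply: le_trans (ler_normB _ _) _; exact: brk.
  by apply: le_trans (ler_normD _ _) _; exact: brk.
have coef : acoef a M * (a + M%:R) * s ^+ M <= M.+1%:R * t ^+ M.
  apply: ler_pM; rewrite ?exprn_ge0//.
  - by rewrite mulr_ge0 ?addr_ge0 ?ler0n ?(ltW a_gt0)// ltW// acoef_gt0.
  - rewrite -[leRHS]mul1r; apply: ler_pM; rewrite ?(ltW (acoef_gt0 _ _)) ?acoef_le1//.
      by rewrite addr_ge0 ?ler0n ?(ltW a_gt0).
    by rewrite -natr1 addrC lerD2l ltW.
  by rewrite lerXn2r ?nnegrE.
have coef0 : 0 <= acoef a M * (a + M%:R) * s ^+ M.
  by rewrite mulr_ge0 ?exprn_ge0// mulr_ge0 ?addr_ge0 ?ler0n ?(ltW a_gt0)// ltW// acoef_gt0.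
rewrite /dD !normrM -(normrM (acoef a M)) -(normrM (acoef a M * _)) (ger0_norm coef0).
rewrite normrN (ger0_norm (powR_ge0 _ _)) (@ger0_norm _ 2)//.
(* 48 = 2 * 4 * 6: the power of [ell] is at most 4 / (1 - t)^2, both components of the partial sum
   are at most M + 1, and their cofactors at most 3. *)
apply: (@le_trans _ _ (2 * (4 / (1 - t) ^+ 2) * (M.+1%:R * t ^+ M) * (M.+1%:R * 3 + M.+1%:R * 3))).
  apply: ler_pM => //.
    by apply: mulr_ge0 => //; rewrite mulr_ge0 ?powR_ge0.
  apply: ler_pM => //; first by rewrite mulr_ge0 ?powR_ge0.
  by rewrite ler_wpM2l.
rewrite le_eqVlt; apply/orP; left; apply/eqP; field.
by rewrite subr_eq0 eq_sym lt_eqF.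
Qed.

(** Mean value theorem for [D] on [0, t], then division by |1 - t x|^(2 a) >= (1 - t)^(2 a). The
    bound does not involve x, so it is uniform over pairs of points of the sphere. *)
Lemma sq_schur_approx M (t : R) : 0 <= t -> t < 1 ->
  `|sq_schur (bcoef t) (fun k m => (c ^+ 2 + y ^+ 2) ^+ k *
       hsym (2 * c) (c ^+ 2 + y ^+ 2) m) M - (ell t `^ a)^-1| <=
  48 * M.+1%:R ^+ 2 * t ^+ M / (1 - t) ^+ 2 * (((1 - t) ^+ 2) `^ a)^-1.
Proof.
move=> t0 t1; have t1p : 0 < (1 - t) ^+ 2 by rewrite exprn_gt0// subr_gt0.
have ell0 : 0 < ell t by exact: lt_le_trans (ell_ge t0 (ltW t1)).
rewrite -psum_sq; last by rewrite /bcoef /= mulr1.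
rewrite -/(p M t) -/(q M t).
have dD' s : s \in `[0, t]%R -> is_derive s 1 (D M) (dD M s).
  by rewrite in_itv/= => /andP[s0 st]; apply: is_derive_D => //; exact: le_lt_trans t1.
have cD : {within `[0, t], continuous (D M)}.
  apply: derivable_within_continuous => s st.
  by have [] := dD' s st.
have dDo s : s \in `]0, t[%R -> is_derive s 1 (D M) (dD M s).
  by move=> st; apply: dD'; exact: subset_itv_oo_cc st.
have [s st E] := MVT_segment t0 dDo cD.
have D0 : D M 0 = 1.
  have B0 k : bcoef 0 k.+1 = 0 by rewrite /bcoef expr0n mulr0.
  rewrite /D; have [-> ->] : p M 0 = 1 /\ q M 0 = 0.
    elim: M {dD' cD dDo E} => [|M [IHp IHq]]; first by rewrite /p /q /bcoef /= mulr1.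
    by move: IHp IHq; rewrite /p /q /= B0 !mul0r !addr0.
  by rewrite /ell !mul0r subr0 !expr1n !expr0n/= !addr0 powR1 mulr1.
have ellp : 0 < ell t `^ a by rewrite powR_gt0.
have Dt : `|D M t - 1| <= 48 * M.+1%:R ^+ 2 * t ^+ M / (1 - t) ^+ 2.
  move: st; rewrite in_itv/= => /andP[s0 st].
  have -> : D M t - 1 = dD M s * t by rewrite -[X in _ - X]D0 E subr0.
  rewrite normrM (ger0_norm t0); apply: le_trans (dD_bound M s0 st t1).
  by rewrite ler_piMr// ltW.
rewrite (_ : _ - _ = (D M t - 1) * (ell t `^ a)^-1); last first.
  by rewrite /D mulrBl mul1r mulfK// gt_eqF.
rewrite normrM; apply: ler_pM => //.
rewrite ger0_norm; last by rewrite invr_ge0 ltW.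
rewrite lef_pV2 ?posrE ?powR_gt0//.
by apply: ge0_ler_powR; rewrite ?nnegrE ?(ltW a_gt0) ?(ltW ell0) ?(ltW t1p) ?ell_ge ?(ltW t1).
Qed.

End binomial_square.

(** With r = t^(1/4), (M + 1) r^M is bounded by C = 1 / (1 - r). Its fourth power gives (M + 1)^4
    t^M <= C^4, and two spare factors M + 1 force smallness. *)
Lemma exists_small (R : realType) (t e : R) : 0 <= t -> t < 1 -> 0 < e ->
  exists M : nat, M.+1%:R ^+ 2 * t ^+ M < e.
Proof.
move=> t0 t1 e0; pose r := Num.sqrt (Num.sqrt t).
have r0 : 0 <= r by exact: sqrtr_ge0.
have r4 : r ^+ 4 = t by rewrite (exprM r 2 2) sqr_sqrtr ?sqrtr_ge0// sqr_sqrtr.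
have r1 : r < 1 by rewrite -(@ltr_pXn2r _ 4)// ?nnegrE// r4 expr1n.
pose C := (1 - r)^-1.
have C1 : 1 <= C by rewrite invf_ge1 ?subr_gt0//; lra.
have Cr M : M.+1%:R * r ^+ M <= C.
  rewrite /C -[_^-1]mul1r ler_pdivlMr ?subr_gt0//.
  (* The geometric sum 1 + ... + r^M has M + 1 terms, each at least r^M. *)
  suff : M.+1%:R * r ^+ M * (1 - r) <= 1 - r ^+ M.+1.
    by have := exprn_ge0 M.+1 r0; lra.
  elim: M => [|M IHM]; first by rewrite expr0 expr1; lra.
  rewrite -(natr1 M.+1) 2!exprS; rewrite exprS in IHM.
  have rx1 : r * r ^+ M <= 1 by rewrite -exprS exprn_ile1// ltW.
  have h := ler_wpM2l r0 IHM.
  have h' : r * r ^+ M * (1 - r) <= 1 - r.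
    by rewrite ler_piMl// subr_ge0 ltW.
  by rewrite exprS; move: (M.+1%:R) (r ^+ M) h h' => m x h h'; lra.
have [M MC] : exists M : nat, C ^+ 4 / e < M.+1%:R.
  exists (Num.truncn (C ^+ 4 / e)).
  by rewrite truncnS_gt.
exists M; have M0 : 0 < M.+1%:R :> R by rewrite ltr0n.
have rM : 0 <= r ^+ M by exact: exprn_ge0.
have h1 : M.+1%:R ^+ 2 * t ^+ M * M.+1%:R ^+ 2 <= C ^+ 4.
  rewrite -r4 exprAC (_ : _ * _ = (M.+1%:R * r ^+ M) ^+ 4); last by ring.
  by rewrite lerXn2r ?nnegrE ?mulr_ge0 ?ler0n//; lra.
have M1 : 1 <= M.+1%:R :> R by rewrite ler1n.
have h2 : C ^+ 4 < e * M.+1%:R by rewrite mulrC -ltr_pdivrMr.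
have h3 : M.+1%:R ^+ 2 * t ^+ M * M.+1%:R ^+ 2 < e * M.+1%:R ^+ 2.
  apply: le_lt_trans h1 _; apply: lt_le_trans h2 _.
  by rewrite ler_pM2l// ler_eXnr.
by move: h3; rewrite ltr_pM2r// exprn_gt0.
Qed.

(** * Moments of the coordinates on the sphere *)

Section moments.
Context (R : realType) (n : nat).
Local Open Scope complex_scope.
Notation quatn := (n.+1.-tuple (quat R)).
Notation sigma := (surface_measure R n).
Notation S := (sphere R n).

Definition area : R := fine (sigma S).

Definition csq (z y : quatn) : R :=
  ((hdot z y).1.1 : R) ^+ 2 + ((hdot z y).1.2 : R) ^+ 2.

Lemma sb_csq z : sphere_bounded (fun y : quatn => csq z y).
Proof.
have h i : sphere_bounded (fun y => qcoord i (hdot z y)).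
  under eq_fun do rewrite hdotC.
  have [s E] : exists s : R, forall q : quat R, qcoord i (qconj q) = s * qcoord i q.
    by case: i => -[|[|[|[|//]]]] Hc; [exists 1|exists (-1)..] => q;
      rewrite /qcoord/= ?mul1r ?mulN1r.
  under eq_fun do rewrite E.
  apply: sphere_boundedM; [exact: sphere_bounded_cst|exact: sphere_bounded_hdot].
have := h (inord 0); have := h (inord 1); rewrite /qcoord/= !inordK// => h1 h0.
by apply: sphere_boundedD; under eq_fun do rewrite expr2; exact: sphere_boundedM.
Qed.

Lemma sphere_boundedX (f : quatn -> R) m : sphere_bounded f ->
  sphere_bounded (fun y => f y ^+ m).
Proof.
move=> bf; elim: m => [|m IHm]; first exact: sphere_bounded_cst.
by under eq_fun do rewrite exprS; exact: sphere_boundedM.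
Qed.

Lemma Rint_csq m z :
  \int[sigma]_(y in S) (csq z y ^+ m) = gmom R n m * hnsq z ^+ m.
Proof.
apply: complexI; rewrite -cint_real.
have -> : (gmom R n m * hnsq z ^+ m)%:C = (gmom R n m)%:C * hcdot z z ^+ m.
  rewrite /hcdot hdot_self rmorphM/= rmorphXn/=; congr (_ * _ ^+ _).
rewrite -cint_hcdot; apply: eq_cint => y _.
rewrite -exprMn rmorphXn/=; congr (_ ^+ _); rewrite (hcdotC z y).
by rewrite /csq /hcdot /qc1; apply: complex_eqP => /=; ring.
Qed.

Lemma csq_ge0 z y : 0 <= csq z y.
Proof. by rewrite addr_ge0 ?sqr_ge0. Qed.

Definition hvec (j : 'I_n.+1) (q : quat R) : quatn :=
  [tuple if i == j then q else 0 | i < n.+1].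

Lemma hdot_vec j q y : hdot (hvec j q) y = q * qconj (tnth y j).
Proof.
rewrite /hdot (bigD1 j)//= big1 ?addr0 => [|i ij]; first by rewrite tnth_mktuple eqxx.
by rewrite tnth_mktuple (negbTE ij) mul0r.
Qed.

Lemma hnsq_vec j q : hnsq (hvec j q) = qnsq q.
Proof.
rewrite /hnsq (bigD1 j)//= big1 ?addr0 => [|i ij]; first by rewrite tnth_mktuple eqxx.
by rewrite tnth_mktuple (negbTE ij) /qnsq/= expr0n !addr0.
Qed.

Definition qj : quat R := mkquat 0 0 1 0.

Lemma qnsq_j : qnsq qj = 1.
Proof. by rewrite /qnsq/= expr0n expr1n/= !addr0 !add0r. Qed.

Lemma qnsq_1 : qnsq (1 : quat R) = 1.
Proof. by rewrite /qnsq/= expr0n expr1n/= !addr0. Qed.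

Lemma csq_sum y : \sum_j (csq (hvec j 1) y + csq (hvec j qj) y) = hnsq y.
Proof.
rewrite /hnsq; apply: eq_bigr => j _; rewrite /csq !hdot_vec mul1r.
rewrite qmulE /qj /qnsq; case: (tnth y j) => [[a b] [c d]] /=; ring.
Qed.

Lemma sRintegral_sum (m : nat) (f : 'I_m -> quatn -> R) :
  (forall i, sphere_bounded (f i)) ->
  \int[sigma]_(y in S) (\sum_i f i y) = \sum_i \int[sigma]_(y in S) f i y.
Proof.
move=> bf; apply: complexI; rewrite -cint_real rmorph_sum/=.
under eq_bigr do rewrite -cint_real.
rewrite -cint_sum; last by move=> i; exact: csphere_bounded_real.
by apply: eq_cint => y _; rewrite rmorph_sum.
Qed.

(** The 2 n + 2 complex coordinates, read off by [hvec] with 1 and j, have equal second moments, and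
    their squared moduli add up to 1 on the sphere. *)
Lemma gmom1E : gmom R n 1 * (2 * n.+1%:R) = area.
Proof.
have : \int[sigma]_(y in S) (hnsq y) = area.
  rewrite (_ : Rintegral _ _ _ = \int[sigma]_(y in S) 1).
    by rewrite Rintegral_cst ?mul1r//; exact: measurable_sphere.
  by apply: eq_Rintegral => y /set_mem /sphereP.
under eq_Rintegral do rewrite -csq_sum.
rewrite sRintegral_sum => [<-|j]; last by apply: sphere_boundedD; exact: sb_csq.
have h z : \int[sigma]_(y in S) (csq z y) = gmom R n 1 * hnsq z.
  by rewrite -[X in _ * X]expr1 -Rint_csq; under [in RHS]eq_Rintegral do rewrite expr1.
transitivity (\sum_(j < n.+1) (gmom R n 1 * 2)).
  by rewrite sumr_const card_ord -[RHS]mulr_natr mulrA.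
apply: eq_bigr => j _; rewrite sRintegralD; [|exact: sb_csq..].
by rewrite !h !hnsq_vec qnsq_1 qnsq_j; ring.
Qed.

(** Polarization: the sum of |alpha + x beta|^4 over x in {1, -1, i, -i} is 4 |alpha|^4 + 4 |beta|^4
    + 16 |alpha|^2 |beta|^2. Each vector z + x w has squared norm 2, so the sum integrates to 16
    g_2. *)
Lemma Rint_csq_orth (z w : quatn) : hnsq z = 1 -> hnsq w = 1 -> hcdot z w = 0 ->
  \int[sigma]_(y in S) (csq z y * csq w y) = gmom R n 2 / 2.
Proof.
move=> z1 w1 zw.
pose v (x : R[i]) := hadd z (hlmul (cquat x 0) w).
have v2 x : complex.Re x ^+ 2 + complex.Im x ^+ 2 = 1 -> hnsq (v x) = 2.
  move=> x1; have : (hdot (v x) (v x)).1.1 = 2 :> R.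
    have wz : hcdot w z = 0 by rewrite hcdotC zw; apply: complex_eqP; rewrite /= ?oppr0.
    rewrite /v hdotDl !hdotDr !hdot_lmull !hdot_lmulr !hdot_self z1 w1.
    move: zw wz; rewrite /hcdot /qc1 => -[e1 e2] -[e3 e4].
    rewrite !qmulE /qconj /=.
    move: e1 e2 e3 e4; case: (hdot z w) => [[a b] [c d]] /= -> ->.
    case: (hdot w z) => [[a' b'] [c' d']] /= -> ->.
    transitivity (1 + (complex.Re x ^+ 2 + complex.Im x ^+ 2)); first by ring.
    by rewrite x1.
  by rewrite hdot_self.
have vv x : complex.Re x ^+ 2 + complex.Im x ^+ 2 = 1 ->
    \int[sigma]_(y in S) (csq (v x) y ^+ 2) = 4 * gmom R n 2.
  by move=> x1; rewrite Rint_csq v2//; ring.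
have bz := sb_csq z; have bw := sb_csq w.
have bv x := sb_csq (v x).
have h1 : \int[sigma]_(y in S) (csq (v (1 +i* 0)) y ^+ 2) = 4 * gmom R n 2.
  by apply: vv => /=; ring.
have h2 : \int[sigma]_(y in S) (csq (v ((-1) +i* 0)) y ^+ 2) = 4 * gmom R n 2.
  by apply: vv => /=; ring.
have h3 : \int[sigma]_(y in S) (csq (v (0 +i* 1)) y ^+ 2) = 4 * gmom R n 2.
  by apply: vv => /=; ring.
have h4 : \int[sigma]_(y in S) (csq (v (0 +i* (-1))) y ^+ 2) = 4 * gmom R n 2.
  by apply: vv => /=; ring.
have pol y : csq (v (1 +i* 0)) y ^+ 2 + csq (v ((-1) +i* 0)) y ^+ 2 + csq (v (0 +i* 1)) y ^+ 2 + csq (v (0 +i* (-1))) y ^+ 2 =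
    4 * csq z y ^+ 2 + 4 * csq w y ^+ 2 + 16 * (csq z y * csq w y).
  rewrite /csq /v !hdotDl !hdot_lmull !qmulE /=.
  by case: (hdot z y) => [[a b] [c d]]; case: (hdot w y) => [[a' b'] [c' d']] /=; ring.
have bX (f : quatn -> R) m : sphere_bounded f -> sphere_bounded (fun y => f y ^+ m).
  exact: sphere_boundedX.
have bC (c : R) (f : quatn -> R) : sphere_bounded f -> sphere_bounded (fun y => c * f y).
  by move=> bf; apply: sphere_boundedM => //; exact: sphere_bounded_cst.
have E : \int[sigma]_(y in S) (csq (v (1 +i* 0)) y ^+ 2 + csq (v ((-1) +i* 0)) y ^+ 2 +
      csq (v (0 +i* 1)) y ^+ 2 + csq (v (0 +i* (-1))) y ^+ 2) =
    \int[sigma]_(y in S) (4 * csq z y ^+ 2 + 4 * csq w y ^+ 2 + 16 * (csq z y * csq w y)).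
  by apply: eq_Rintegral => y _; exact: pol.
have bzw : sphere_bounded (fun y => csq z y * csq w y) by exact: sphere_boundedM.
move: E; rewrite !sRintegralD; do ?[exact: bX|exact: bC|exact: bzw|apply: sphere_boundedD|apply: bX|apply: bC].
rewrite h1 h2 h3 h4 !sRintegralZ; do ?[exact: bX|exact: bC|exact: bzw].
rewrite !Rint_csq z1 w1 expr1n mulr1.
move: (Rintegral _ _ _) (gmom R n 2) => X g; clear; lra.
Qed.

(** Expand the integral of |y_1|^2 times the sum of all 2 n + 2 squared moduli, which is g_1: one
    fourth moment g_2 and 2 n + 1 mixed moments g_2 / 2. *)
Lemma gmom2E : gmom R n 2 * (2 * n + 3)%:R = 2 * gmom R n 1.
Proof.
pose e := hvec ord0 1.
have e1 : hnsq e = 1 by rewrite hnsq_vec qnsq_1.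
have c0 j q : j != ord0 -> hcdot e (hvec j q) = 0.
  move=> j0; rewrite /hcdot hdot_vec mul1r tnth_mktuple eq_sym (negbTE j0) qconj0.
  by apply: complex_eqP.
have cj : hcdot e (hvec ord0 qj) = 0.
  rewrite /hcdot hdot_vec mul1r tnth_mktuple eqxx /qc1 /qconj /=.
  by apply: complex_eqP; rewrite /= ?oppr0.
have E : \int[sigma]_(y in S) (csq e y) = gmom R n 1.
  transitivity (\int[sigma]_(y in S) (csq e y ^+ 1)).
    by apply: eq_Rintegral => y _; rewrite expr1.
  by rewrite Rint_csq e1 expr1n mulr1.
have bM u w : sphere_bounded (fun y => csq u y * csq w y).
  by apply: sphere_boundedM; exact: sb_csq.
have : \int[sigma]_(y in S) (\sum_j (csq e y * csq (hvec j 1) y + csq e y * csq (hvec j qj) y)) =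
    gmom R n 1.
  rewrite -E; apply: eq_Rintegral => y /set_mem /sphereP y1.
  by under eq_bigr do rewrite -mulrDr; rewrite -mulr_sumr csq_sum y1 mulr1.
rewrite sRintegral_sum; last by move=> j; exact: sphere_boundedD.
rewrite big_ord_recl sRintegralD// (@Rint_csq_orth e (hvec ord0 qj))//; last by rewrite hnsq_vec qnsq_j.
rewrite (eq_bigr (fun=> gmom R n 2 / 2 + gmom R n 2 / 2)); last first.
  move=> j _; rewrite sRintegralD//; congr (_ + _); apply: Rint_csq_orth => //.
  - by rewrite hnsq_vec qnsq_1.
  - exact: c0.
  - by rewrite hnsq_vec qnsq_j.
  - exact: c0.
rewrite sumr_const card_ord (_ : Rintegral _ _ _ = gmom R n 2); last first.
  have := Rint_csq 2 e; rewrite e1 expr1n mulr1 => <-.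
  by apply: eq_Rintegral => y _; rewrite expr2.
move=> <-; rewrite -[_ *+ n]mulr_natr natrD natrM; lra.
Qed.

Lemma gmom_ge0 m : 0 <= gmom R n m.
Proof.
by apply: Rintegral_ge0 => y _; rewrite exprn_ge0// addr_ge0 ?sqr_ge0.
Qed.

Lemma gmom_leS m : gmom R n m.+1 <= gmom R n m.
Proof.
have h k : gmom R n k = \int[sigma]_(y in S) (csq (hvec ord0 1) y ^+ k).
  by rewrite Rint_csq hnsq_vec qnsq_1 expr1n mulr1.
rewrite !h; apply: le_Rintegral.
- exact: measurable_sphere.
- by apply: sphere_bounded_integrable; apply: sphere_boundedX; exact: sb_csq.
- by apply: sphere_bounded_integrable; apply: sphere_boundedX; exact: sb_csq.
move=> y /sphereP y1; rewrite exprS ler_piMl ?exprn_ge0 ?csq_ge0//.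
have := csq_sum y; rewrite y1 (bigD1 ord0)//= => <-.
rewrite -addrA lerDl addr_ge0 ?csq_ge0// sumr_ge0// => i _.
by rewrite addr_ge0 ?csq_ge0.
Qed.

Lemma gmom_le i j : (i <= j)%N -> gmom R n j <= gmom R n i.
Proof.
move=> /subnK <-; elim: (j - i)%N => // k IHk.
by rewrite addSn (le_trans (gmom_leS _)).
Qed.

Lemma sb_qnsq z : sphere_bounded (fun y : quatn => qnsq (hdot z y)).
Proof.
have [h _] := csb_monomial z z 0 0 0 1.
by move: h; under eq_fun do rewrite !expr0 !mul1r mulr1 expr1.
Qed.

(** |u|^2 is the sum of the squared moduli of the two complex parts of u, and left multiplication of
    y by j carries the second part to the first. *)
Lemma Rint_qnsq z : \int[sigma]_(y in S) (qnsq (hdot z y)) = 2 * gmom R n 1 * hnsq z.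
Proof.
have ij := isom_lmul n qnsq_j.
have h w : \int[sigma]_(y in S) (csq w y) = gmom R n 1 * hnsq w.
  by rewrite -[X in _ * X]expr1 -Rint_csq; under [in RHS]eq_Rintegral do rewrite expr1.
transitivity (\int[sigma]_(y in S) (csq z y + csq z (hlmul qj y))).
  apply: eq_Rintegral => y _; rewrite /csq hdot_lmulr qmulE /qj /qnsq /=.
  by case: (hdot z y) => [[a b] [c d]] /=; ring.
rewrite sRintegralD; last 2 first.
- exact: sb_csq.
- exact: (sphere_bounded_isom ij (sb_csq z)).
by rewrite (isom_Rintegral ij (sb_csq z)) !h; ring.
Qed.

Lemma Rint_zkernel0 m z : (0 < m)%N -> \int[sigma]_(y in S) (zkernel m z y) = 0.
Proof.
move=> m0; have := @Rint_zkernel_conv R n 0 m z z.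
by rewrite (gtn_eqF m0) !mul0r => <-; apply: eq_Rintegral => y _; rewrite /= mulr1.
Qed.

End moments.

(** * Kernels on the sphere and their positivity *)

Section sphere_kernels.
Context (R : realType) (n : nat).
Notation quatn := (n.+1.-tuple (quat R)).
Notation sigma := (surface_measure R n).
Notation S := (sphere R n).

(** Extension by zero from S x S, so that bounds on the sphere become global and the theory for a
    finite measure on the ambient space applies. *)
Definition skernel (k : quatn -> quatn -> R) (p : quatn * quatn) : R :=
  \1_S p.1 * \1_S p.2 * k p.1 p.2.

Lemma indic_sphere z : S z -> \1_S z = 1 :> R.
Proof. by move=> Sz; rewrite indicE mem_set. Qed.

Lemma indic_nsphere z : ~ S z -> \1_S z = 0 :> R.
Proof. by move=> Sz; rewrite indicE memNset. Qed.

Lemma skernel_in k z w : S z -> S w -> skernel k (z, w) = k z w.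
Proof. by move=> Sz Sw; rewrite /skernel/= !indic_sphere// !mul1r. Qed.

Lemma skernel_out k p : ~ (S p.1 /\ S p.2) -> skernel k p = 0.
Proof.
move=> SS; rewrite /skernel; have [Sz|Sz] := pselect (S p.1); last first.
  by rewrite indic_nsphere// !mul0r.
have [Sw|Sw] := pselect (S p.2); first by exfalso; exact: SS.
by rewrite (indic_nsphere Sw) mulr0 mul0r.
Qed.

Definition measurable_kernel (k : quatn -> quatn -> R) :=
  measurable_fun setT (fun p : quatn * quatn => k p.1 p.2).

Let mS := @measurable_sphere R n.

Lemma measurable_skernel k : measurable_kernel k -> measurable_fun setT (skernel k).
Proof.
move=> mk; apply: measurable_funM => //; apply: measurable_funM.
  by apply: (measurableT_comp (measurable_indic mS)).
by apply: (measurableT_comp (measurable_indic mS)).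
Qed.

Lemma skernel_bounded k M : measurable_kernel k ->
  (forall z w, S z -> S w -> `|k z w| <= M) -> (forall p, `|skernel k p| <= `|M|).
Proof.
move=> mk kM [z w]; have [[Sz Sw]|SS] := pselect (S z /\ S w).
  by rewrite skernel_in// (le_trans (kM _ _ Sz Sw))// ler_norm.
by rewrite skernel_out// normr0.
Qed.

Lemma bounded_skernel k M : measurable_kernel k ->
  (forall z w, S z -> S w -> `|k z w| <= M) -> bounded_kernel (skernel k).
Proof.
move=> mk kM; split; first exact: measurable_skernel.
by exists `|M|; exact: skernel_bounded.
Qed.

Lemma measurable_kernel_coord c : measurable_kernel (fun z w => qcoord c (hdot z w)).
Proof. by apply: measurable_hdot. Qed.

Lemma measurable_kernel_re : measurable_kernel (fun z w => (hdot z w).1.1).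
Proof. by have := measurable_kernel_coord (inord 0); rewrite /qcoord/= inordK. Qed.

Lemma measurable_kernel_nsq : measurable_kernel (fun z w => qnsq (hdot z w)).
Proof.
have h i : measurable_kernel (fun z w => qcoord i (hdot z w) ^+ 2).
  by apply: measurable_funX; exact: measurable_kernel_coord.
have := h (inord 0); have := h (inord 1); have := h (inord 2); have := h (inord 3).
rewrite /qcoord/= !inordK// => h3 h2 h1 h0.
by apply: measurable_funD => //; apply: measurable_funD => //; exact: measurable_funD.
Qed.

Lemma measurable_kernel_zk m : measurable_kernel (@zkernel R n m).
Proof.
rewrite /measurable_kernel /zkernel; elim/nat_ind2: m => [||m IH0 IH1].
- exact: measurable_cst.
- by apply: measurable_funM => //; exact: measurable_kernel_re.
apply: measurable_funB; apply: measurable_funM => //; last exact: measurable_kernel_nsq.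
by apply: measurable_funM => //; exact: measurable_kernel_re.
Qed.

(* The complex number with the trace and the norm of the quaternion u. *)
Lemma quat_complex (u : quat R) : exists y : R,
  (u.1.1 : R) ^+ 2 + y ^+ 2 = qnsq u.
Proof.
exists (Num.sqrt ((u.1.2 : R) ^+ 2 + u.2.1 ^+ 2 + u.2.2 ^+ 2)).
by rewrite sqr_sqrtr ?addr_ge0 ?sqr_ge0// !addrA.
Qed.

Lemma sphere_nsq z w : S z -> S w -> qnsq (hdot z w) <= 1.
Proof.
by move=> /sphereP z1 /sphereP w1; have := hdot_CS z w; rewrite z1 w1 mulr1.
Qed.

Definition schur k m (z w : quatn) : R := qnsq (hdot z w) ^+ k * zkernel m z w.

Lemma measurable_kernel_schur k m : measurable_kernel (schur k m).
Proof.
apply: measurable_funM; last exact: measurable_kernel_zk.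
by apply: measurable_funX; exact: measurable_kernel_nsq.
Qed.

Lemma schur_bound k m z w : S z -> S w -> `|schur k m z w| <= m.+1%:R.
Proof.
move=> Sz Sw; have d1 := sphere_nsq Sz Sw; rewrite /schur /zkernel.
have [y yE] := quat_complex (hdot z w).
have hb : `|hsym (2 * ((hdot z w).1.1 : R)) (qnsq (hdot z w)) m| <= m.+1%:R.
  by rewrite -yE; apply: hsym_bound; rewrite yE.
rewrite normrM (le_trans _ hb)// ler_piMl// normrX ger0_norm ?qnsq_ge0//.
by rewrite exprn_ile1// qnsq_ge0.
Qed.

Lemma bounded_schur k m : bounded_kernel (skernel (schur k m)).
Proof.
exact: (bounded_skernel (measurable_kernel_schur k m) (schur_bound k m)).
Qed.

Lemma Rintegral_indic (f : quatn -> R) :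
  \int[sigma]_z (\1_S z * f z) = \int[sigma]_(z in S) f z.
Proof.
rewrite [RHS]Rintegral_mkcond; apply: eq_Rintegral => z _; rewrite patchE.
case: ifPn => [/set_mem Sz|/negP Sz]; first by rewrite indic_sphere// mul1r.
by rewrite indic_nsphere ?mul0r// => /mem_set.
Qed.

Lemma zkernel_conv_patch i j (x y : quatn) :
  \int[sigma]_z (skernel (schur 0 i) (z, x) * skernel (schur 0 j) (z, y)) =
  (i == j)%:R * gmom R n i * skernel (schur 0 i) (y, x).
Proof.
have E z : skernel (schur 0 i) (z, x) * skernel (schur 0 j) (z, y) =
    \1_S z * (\1_S x * \1_S y * (zkernel i z x * zkernel j z y)).
  rewrite /skernel /schur/= !expr0 !mul1r.
  have [Sz|Sz] := pselect (S z); first by rewrite indic_sphere//; ring.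
  by rewrite indic_nsphere// !mul0r.
under eq_Rintegral do rewrite E.
rewrite Rintegral_indic sRintegralZ; last first.
  under eq_fun do rewrite zkernelC [X in _ * X]zkernelC.
  by apply: sphere_boundedM; exact: sb_zkernel.
transitivity (\1_S x * \1_S y * \int[sigma]_(z in S) (zkernel i x z * zkernel j z y)).
  by congr (_ * _); apply: eq_Rintegral => z _; rewrite zkernelC.
rewrite Rint_zkernel_conv /skernel /schur/= expr0 mul1r.
case: eqP => [->|_]; last by rewrite !mul0r mulr0.
by rewrite (zkernelC j x y); ring.
Qed.

Lemma skernelC k x y : (forall z w, k z w = k w z) -> skernel k (y, x) = skernel k (x, y).
Proof. by move=> kC; rewrite /skernel/= kC (mulrC (\1_S y)). Qed.

Lemma schurC k m z w : schur k m z w = schur k m w z.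
Proof. by rewrite /schur zkernelC hdotC qnsq_conj. Qed.

Let mu_fin := surface_measure_fin R n.

(** Multiplication by |u|^2 preserves positivity because |<z, w>|^2 is a finite Gram kernel: the sum
    over i and j of the real inner products of conj(z_i) z_j and conj(w_i) w_j. The case k = 0 is
    [psd_idempotent]. *)
Lemma psd_schur k m : psd sigma (skernel (schur k m)).
Proof.
elim: k => [|k IHk].
  apply: (@psd_idempotent _ _ _ sigma mu_fin (fun i => skernel (schur 0 i)) (gmom R n)).
  - by move=> i; exact: bounded_schur.
  - by move=> i x y; apply: skernelC; exact: schurC.
  - exact: gmom_ge0.
  - exact: zkernel_conv_patch.
pose I := ('I_n.+1 * 'I_n.+1 * 'I_4)%type.
pose e (i : I) (z : quatn) : R :=
  \1_S z * qcoord i.2 (qconj (tnth z i.1.1) * tnth z i.1.2).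
have eE z w : \sum_(i : I) (e i z * e i w) = \1_S z * \1_S w * qnsq (hdot z w).
  have q4 (p q : quat R) : \sum_(c < 4) qcoord c p * qcoord c q = (p * qconj q).1.1.
    rewrite !big_ord_recl big_ord0 /qcoord /= qmulE /qconj /=; ring.
  rewrite -(pair_big predT predT (fun (ij : 'I_n.+1 * 'I_n.+1) c => e (ij, c) z * e (ij, c) w))/=.
  transitivity (\sum_(ij : 'I_n.+1 * 'I_n.+1) \1_S z * \1_S w *
     ((qconj (tnth z ij.1) * tnth z ij.2) * qconj (qconj (tnth w ij.1) * tnth w ij.2)).1.1).
    apply: eq_bigr => ij _; rewrite -q4 mulr_sumr; apply: eq_bigr => c _.
    by rewrite /e/=; ring.
  rewrite -mulr_sumr; congr (_ * _).
  have -> : qnsq (hdot z w) = (hdot z w * qconj (hdot z w)).1.1 by rewrite qmul_conj.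
  have re_sum J (r : seq J) (F : J -> quat R) :
      (\sum_(j <- r) F j).1.1 = \sum_(j <- r) ((F j).1.1 : R).
    by elim/big_rec2: _ => // j q1 q2 _ <-.
  transitivity (\sum_(j < n.+1) \sum_(i < n.+1)
      ((tnth z j * qconj (tnth w j)) * qconj (tnth z i * qconj (tnth w i))).1.1 : R).
    rewrite exchange_big/= pair_big/=; apply: eq_bigr => -[i j] _ /=.
    (* The real part of a product of quaternions is invariant under cyclic permutation. *)
    by rewrite !qconjM !qconjK -!mulrA re_qmulC !mulrA.
  rewrite /hdot qconj_sum mulr_suml re_sum; apply: eq_bigr => j _.
  by rewrite mulr_sumr re_sum.
have be i : bounded_kernel (e i).
  split.
    apply: measurable_funM; first exact: measurable_indic.
    apply: measurable_qmul => c; last exact: measurable_hcoord.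
    by apply: measurable_qconj => {}c; exact: measurable_hcoord.
  exists 1 => z; rewrite /e; have [Sz|Sz] := pselect (S z); last first.
    by rewrite indic_nsphere// mul0r normr0.
  rewrite indic_sphere// mul1r.
  rewrite -(@ler_pXn2r _ 2)// ?nnegrE// expr1n real_normK ?num_real//.
  apply: le_trans (qcoord_sq_le _ _) _; rewrite qnsqM qnsq_conj.
  move/sphereP: Sz => z1; have zj j : qnsq (tnth z j) <= 1.
    rewrite -z1 /hnsq (bigD1 j)//= lerDl.
    by apply: sumr_ge0 => l _; exact: qnsq_ge0.
  by rewrite mulr_ile1 ?qnsq_ge0.
rewrite (_ : skernel (schur k.+1 m) =
    fun p => skernel (schur k m) p * \sum_(i : I) (e i p.1 * e i p.2)).
  by apply: psd_mul_sum => //; exact: bounded_schur.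
apply/funext => -[z w]; rewrite eE /skernel /schur /= exprS.
have [Sz|Sz] := pselect (S z); last by rewrite indic_nsphere// !mul0r.
have [Sw|Sw] := pselect (S w); last by rewrite (indic_nsphere Sw) !(mul0r, mulr0).
by rewrite !indic_sphere//; ring.
Qed.

End sphere_kernels.

(** * The regularized power kernel and its majorant *)

Section power_kernels.
Context (R : realType) (n : nat) (a : R).
Hypotheses (a_gt0 : 0 < a) (a_lt1 : a < 1).
Notation quatn := (n.+1.-tuple (quat R)).
Notation sigma := (surface_measure R n).
Notation S := (sphere R n).
Let mu_fin := surface_measure_fin R n.

Definition dist2 (t : R) (z w : quatn) : R :=
  1 - 2 * t * (hdot z w).1.1 + t ^+ 2 * qnsq (hdot z w).

(** This is |1 - t u|^(- 2 a). Where [dist2] vanishes, the default values of power and inverse make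
    it 0 for a > 0, not infinite. *)
Definition pkernel (t : R) (z w : quatn) : R := (dist2 t z w `^ a)^-1.

Lemma measurable_kernel_dist2 t : measurable_kernel (dist2 t).
Proof.
apply: measurable_funD; last by apply: measurable_funM => //; exact: measurable_kernel_nsq.
by apply: measurable_funB => //; apply: measurable_funM => //; exact: measurable_kernel_re.
Qed.

Lemma measurable_kernel_pkernel t : measurable_kernel (pkernel t).
Proof.
rewrite /measurable_kernel /pkernel; under eq_fun do rewrite -powRN.
by apply: (measurableT_comp (measurable_powR _)); exact: measurable_kernel_dist2.
Qed.

Lemma dist2_ge t z w : S z -> S w -> 0 <= t -> t <= 1 -> (1 - t) ^+ 2 <= dist2 t z w.
Proof.
move=> Sz Sw t0 t1; have d1 := sphere_nsq Sz Sw.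
have [y yE] := quat_complex (hdot z w).
rewrite -yE in d1; have := ell_ge d1 t0 t1.
by rewrite /dist2 -yE; move=> h; apply: le_trans h _; rewrite le_eqVlt; apply/orP; left;
  apply/eqP; ring.
Qed.

Lemma pkernel_ge0 t z w : 0 <= pkernel t z w.
Proof. by rewrite invr_ge0 powR_ge0. Qed.

Lemma pkernel_bound t z w : S z -> S w -> 0 <= t -> t < 1 ->
  `|pkernel t z w| <= (((1 - t) ^+ 2) `^ a)^-1.
Proof.
move=> Sz Sw t0 t1; have t1p : 0 < (1 - t) ^+ 2 by rewrite exprn_gt0// subr_gt0.
have dp : 0 < dist2 t z w by exact: lt_le_trans (dist2_ge Sz Sw t0 (ltW t1)).
rewrite ger0_norm ?pkernel_ge0// /pkernel lef_pV2 ?posrE ?powR_gt0//.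
by apply: ge0_ler_powR; rewrite ?nnegrE ?(ltW a_gt0) ?(ltW dp) ?(ltW t1p) ?dist2_ge ?(ltW t1).
Qed.

Lemma bounded_pkernel t : 0 <= t -> t < 1 -> bounded_kernel (skernel (pkernel t)).
Proof.
move=> t0 t1; apply: (bounded_skernel (measurable_kernel_pkernel t)) => z w Sz Sw.
exact: pkernel_bound.
Qed.

Section truncations.
Variables (B : nat -> R).
Let nkernel M (p : quatn * quatn) : R := sq_schur B (fun k m => skernel (schur k m) p) M.

Let tkernel k m (p : quatn * quatn) : R := tschur (fun k m => skernel (schur k m) p) k m.

Let bt k m : bounded_kernel (tkernel k m).
Proof.
case: m => [|[|m]]; [exact: bounded_schur|exact: bounded_schur|].
rewrite /tkernel/=; under eq_fun do rewrite -mulN1r.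
by apply: bounded_kernelD; [|apply: bounded_kernelZ]; exact: bounded_schur.
Qed.

Lemma bounded_nkernel M : bounded_kernel (nkernel M).
Proof.
elim: M => [|M IHM]; first exact: bounded_schur.
apply: bounded_kernelD => //; apply: bounded_kernelD.
  by apply: bounded_kernelZ; exact: bounded_schur.
apply: bounded_kernelZ; apply: bounded_kernel_sum => k; apply: bounded_kernelZ; exact: bt.
Qed.

(** [sq_schur] is linear in its argument [q], hence commutes with taking the form at [f]. *)
Lemma qform_nkernel M f : square_integrable sigma f ->
  qform sigma (nkernel M) f =
  sq_schur B (fun k m => qform sigma (skernel (schur k m)) f) M.
Proof.
move=> f2; have qt k m : qform sigma (tkernel k m) f =
    tschur (fun k m => qform sigma (skernel (schur k m)) f) k m.
  case: m => [|[|m]] //; rewrite /tkernel/=.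
  under [X in qform _ X]eq_fun do rewrite -mulN1r.
  rewrite (qformD mu_fin f2 (bounded_schur _ _ _ _)) ?(qformZ mu_fin _ f2) ?mulN1r//;
    try exact: bounded_schur.
  by apply: bounded_kernelZ; exact: bounded_schur.
elim: M => [//|M IHM].
rewrite [RHS]/= -IHM -(qformZ mu_fin _ f2 (bounded_schur _ _ _ _)).
under eq_bigr do rewrite -qt -(qformZ mu_fin _ f2 (bt _ _)).
have bBt k : bounded_kernel (fun p => B k * tkernel k (M.+1 - k) p).
  by apply: bounded_kernelZ; exact: bt.
rewrite -(qform_sum mu_fin (k := fun (k : 'I_M.+1) p => B k * tkernel k (M.+1 - k) p) f2)//.
rewrite -(qformZ mu_fin _ f2); last exact: bounded_kernel_sum.
rewrite -(qformD mu_fin f2); last 2 first.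
- by apply: bounded_kernelZ; exact: bounded_schur.
- by apply: bounded_kernelZ; exact: bounded_kernel_sum.
rewrite -(qformD mu_fin f2)//; first exact: bounded_nkernel.
apply: bounded_kernelD; apply: bounded_kernelZ; first exact: bounded_schur.
exact: bounded_kernel_sum.
Qed.

Lemma nkernel_in M z w : S z -> S w ->
  nkernel M (z, w) = sq_schur B (fun k m => schur k m z w) M.
Proof.
move=> Sz Sw; rewrite /nkernel; congr (sq_schur _ _ _).
by apply/funext => k; apply/funext => m; rewrite skernel_in.
Qed.

Lemma nkernel_out M p : ~ (S p.1 /\ S p.2) -> nkernel M p = 0.
Proof.
move=> SS; rewrite /nkernel (_ : (fun k m => _) = fun _ _ => 0); last first.
  by apply/funext => k; apply/funext => m; rewrite skernel_out.
elim: M => [//|M IHM] /=; rewrite IHM add0r mulr0 add0r big1 ?mulr0// => k _.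
by case: (_ - _)%N => [|[|j]]; rewrite /= ?subrr mulr0.
Qed.

End truncations.

Lemma bcoef_bounds t k : 0 <= t -> t <= 1 -> 0 <= bcoef a t k <= 1.
Proof.
move=> t0 t1; rewrite mulr_ge0 ?exprn_ge0 ?(ltW (acoef_gt0 _ _))//=.
by rewrite mulr_ile1 ?exprn_ge0 ?exprn_ile1 ?acoef_le1// ltW// acoef_gt0.
Qed.

(** The kernel is close to [nk] by [sq_schur_approx]; the form of [nk] is expanded in the
    nonnegative forms [q k m]; and [sq_schur_le] discards those with k > 0. The constant depends on
    [t] and [f] but not on [M]. *)
Lemma qform_pkernel_le (t : R) f : 0 <= t -> t < 1 -> square_integrable sigma f ->
  exists C : R, forall M, qform sigma (skernel (pkernel t)) f <=
    \sum_(j < M.+1) bcoef a t j * qform sigma (skernel (schur 0 j)) f +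
    C * (M.+1%:R ^+ 2 * t ^+ M).
Proof.
move=> t0 t1 f2; pose F := (\int[sigma]_x `|f x|) ^+ 2.
have F0 : 0 <= F by rewrite sqr_ge0.
pose c1 := 48 / (1 - t) ^+ 2 * (((1 - t) ^+ 2) `^ a)^-1.
have c10 : 0 <= c1.
  by rewrite mulr_ge0 ?invr_ge0 ?powR_ge0// divr_ge0 ?sqr_ge0.
(* [c1 * F] pays for the approximation of the kernel, and [F], the square of the L^1 norm of [f],
   for the terms left by truncation. *)
exists ((c1 + 1) * F) => M.
set q := fun k m => qform sigma (skernel (schur k m)) f.
have bB k := bcoef_bounds k t0 (ltW t1).
pose nk (p : quatn * quatn) := sq_schur (bcoef a t) (fun k m => skernel (schur k m) p) M.
have bnk : bounded_kernel nk by exact: bounded_nkernel.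
have bp := bounded_pkernel t0 t1.
have bd : bounded_kernel (fun p => skernel (pkernel t) p + (-1) * nk p).
  by apply: bounded_kernelD => //; exact: bounded_kernelZ.
have near : `|qform sigma (fun p => skernel (pkernel t) p + (-1) * nk p) f| <=
    c1 * (M.+1%:R ^+ 2 * t ^+ M) * F.
  apply: qform_bound => // -[z w].
  have [[Sz Sw]|SS] := pselect (S z /\ S w); last first.
    rewrite skernel_out// /nk nkernel_out// mulr0 addr0 normr0.
    by apply: mulr_ge0 => //; rewrite mulr_ge0 ?exprn_ge0.
  rewrite skernel_in// /nk nkernel_in// mulN1r distrC.
  have [y yE] := quat_complex (hdot z w).
  have d1 := sphere_nsq Sz Sw; rewrite -yE in d1.
  have := sq_schur_approx a_gt0 a_lt1 d1 M t0 t1.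
  rewrite (_ : (1 - t * (hdot z w).1.1) ^+ 2 + (t * y) ^+ 2 = dist2 t z w); last first.
    by rewrite /dist2 -yE; ring.
  rewrite yE; rewrite (_ : 48 * _ * _ / _ * _ = c1 * (M.+1%:R ^+ 2 * t ^+ M)); last first.
    by rewrite /c1; ring.
  exact.
rewrite (qformD mu_fin f2 bp) ?(qformZ mu_fin _ f2 bnk) in near; last exact: bounded_kernelZ.
rewrite mulN1r qform_nkernel// -/q in near.
have q0 k m : 0 <= q k m by exact: psd_schur.
have qb k m : q k m <= m.+1%:R * F.
  apply: le_trans (ler_norm _) _; rewrite /q.
  apply: qform_bound => //; first exact: bounded_schur.
  move=> p; rewrite -[leRHS]ger0_norm//.
  apply: skernel_bounded; first exact: measurable_kernel_schur.
  by move=> z w; exact: schur_bound.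
have ub := @sq_schur_le R (bcoef a t) q M.
have {}ub : sq_schur (bcoef a t) q M <= \sum_(j < M.+1) bcoef a t j * q 0%N j +
    bcoef a t M * \sum_(k < M) bcoef a t k.+1 * q k.+1 (M - k.+1)%N.
  apply: ub => //.
  - by rewrite /bcoef /= mulr1.
  - by move=> j; have /andP[] := bB j.
  - move=> k m km; rewrite /bcoef mulrACA -exprD [leRHS]mulrACA -exprD addnS addSn.
    by rewrite ler_wpM2r ?exprn_ge0// acoef_logconvex.
have bM : bcoef a t M <= t ^+ M.
  by rewrite /bcoef ler_piMl ?exprn_ge0// acoef_le1.
(* Each of the M summands is at most (M + 1) F, and the factor in front is at most t^M. *)
have rest : bcoef a t M * \sum_(k < M) bcoef a t k.+1 * q k.+1 (M - k.+1)%N <=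
    M.+1%:R ^+ 2 * t ^+ M * F.
  have : \sum_(k < M) bcoef a t k.+1 * q k.+1 (M - k.+1)%N <= M.+1%:R ^+ 2 * F.
    apply: (@le_trans _ _ (\sum_(k < M) M.+1%:R * F)).
      apply: ler_sum => k _; have /andP[b0 b1] := bB k.+1.
      rewrite -[leRHS]mul1r; apply: ler_pM => //.
      apply: le_trans (qb _ _) _; rewrite ler_wpM2r// ler_nat ltnS leq_subr//.
    rewrite sumr_const card_ord -[leLHS]mulr_natl expr2 -mulrA.
    by apply: ler_wpM2r; [exact: mulr_ge0|rewrite ler_nat].
  move=> h; rewrite [leRHS]mulrAC mulrC; apply: ler_pM => //.
    by apply: sumr_ge0 => k _; rewrite mulr_ge0//; have /andP[] := bB k.+1.
  by have /andP[] := bB M.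
move: near; rewrite ler_norml => /andP[_ near].
rewrite -/q; move: near ub rest.
set X := qform _ _ f; set Y := sq_schur _ _ _; set Z1 := \sum_(j < M.+1) _; set Z2 := bcoef a t M * _.
set V := M.+1%:R ^+ 2 * t ^+ M.
rewrite (_ : (c1 + 1) * F * V = c1 * V * F + V * F); last by ring.
lra.
Qed.

End power_kernels.

(** * Bounds for t < 1: orthogonal functions and total mass *)

Section power_kernel_bounds.
Context (R : realType) (n : nat) (a : R).
Hypotheses (a_gt0 : 0 < a) (a_lt1 : a < 1).
Notation quatn := (n.+1.-tuple (quat R)).
Notation sigma := (surface_measure R n).
Notation S := (sphere R n).
Let mu_fin := surface_measure_fin R n.
Let mS := @measurable_sphere R n.
Hypothesis area_gt0 : 0 < area R n.

Lemma gmom_gt0 : 0 < gmom R n 2.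
Proof.
have g1 : 0 < gmom R n 1.
  have := area_gt0; rewrite -gmom1E pmulr_lgt0// mulr_gt0//.
have d3 : 0 < (2 * n + 3)%:R :> R by rewrite ltr0n addnS.
rewrite -(pmulr_lgt0 _ d3) gmom2E; apply: mulr_gt0 => //; exact: ltr0n.
Qed.

(** The eigenvalue A_2 g_2 of the term A_2 Z_2 of the majorant sum A_m Z_m. *)
Definition eig2 : R := acoef a 2 * gmom R n 2.

Lemma squeeze_exists (x y C t : R) : 0 <= t -> t < 1 ->
  (forall M, x <= y + C * (M.+1%:R ^+ 2 * t ^+ M)) -> x <= y.
Proof.
move=> t0 t1 h; apply/ler_addgt0Pr => e e0.
have C0 : 0 < `|C| + 1 by rewrite ltr_pwDr.
have [M ME] := exists_small t0 t1 (divr_gt0 e0 C0).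
apply: le_trans (h M) _; rewrite lerD2l.
apply: (@le_trans _ _ ((`|C| + 1) * (M.+1%:R ^+ 2 * t ^+ M))).
  rewrite ler_wpM2r ?mulr_ge0 ?exprn_ge0//.
  by have := ler_norm C; lra.
by rewrite mulrC -ler_pdivlMr// ltW.
Qed.

(** The coefficients of index 0 and 1 may be set to 0, since these forms vanish at [f]. Then beta_i
    g_i <= A_2 g_2 for every i because A_i and g_i decrease, and Bessel's inequality bounds all
    partial sums at once. *)
Lemma qform_pkernel_orth t f : 0 <= t -> t < 1 -> square_integrable sigma f ->
  qform sigma (skernel (schur 0 0)) f = 0 -> qform sigma (skernel (schur 0 1)) f = 0 ->
  qform sigma (skernel (pkernel a t)) f <= eig2 * \int[sigma]_x f x ^+ 2.
Proof.
move=> t0 t1 f2 q0 q1.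
have [C hC] := qform_pkernel_le a_gt0 a_lt1 t0 t1 f2.
apply: (@squeeze_exists _ _ C t) => // M; apply: le_trans (hC M) _.
rewrite lerD2r; pose beta j := if (j < 2)%N then 0 else bcoef a t j.
have bB k := bcoef_bounds a_gt0 a_lt1 k t0 (ltW t1).
rewrite (_ : \sum_(j < M.+1) _ = \sum_(j < M.+1) beta j * qform sigma (skernel (schur 0 j)) f).
  apply: (@bessel _ _ _ sigma mu_fin (fun i => skernel (schur 0 i)) (gmom R n)) => //.
  - by move=> i; exact: bounded_schur.
  - by move=> i x y; apply: skernelC; exact: schurC.
  - exact: gmom_ge0.
  - exact: zkernel_conv_patch.
  - by rewrite mulr_gt0 ?gmom_gt0// acoef_gt0.
  - by move=> i; rewrite /beta; case: ifP => // _; have /andP[] := bB i.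
  move=> i; rewrite /beta; case: ltnP => [_|i2].
    by rewrite mul0r mulr_ge0 ?gmom_ge0// ltW// acoef_gt0.
  apply: ler_pM; rewrite ?gmom_ge0 ?gmom_le//; first by have /andP[] := bB i.
  apply: (@le_trans _ _ (acoef a i)); last exact: acoef_le.
  by rewrite /bcoef ler_piMr ?exprn_ile1 ?(ltW t1)// ltW// acoef_gt0.
apply: eq_bigr => -[[|[|j]] jM] _ /=; rewrite /beta/= ?q0 ?q1 ?mulr0 ?mul0r//.
Qed.

Let one_sq : square_integrable sigma (fun=> 1 : R).
Proof. by apply: (bounded_square_integrable mu_fin); exact: bounded_kernel_cst. Qed.

Lemma qform_one k : bounded_kernel (skernel k) ->
  qform sigma (skernel k) (fun=> 1) =
  \int[sigma]_(x in S) \int[sigma]_(y in S) k x y.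
Proof.
move=> bk; have i1 := square_integrable_int mu_fin one_sq.
rewrite /qform (prod_Rintegral i1 i1 bk).1 -Rintegral_indic.
apply: eq_Rintegral => x _; rewrite mul1r /kop.
under eq_Rintegral do rewrite mulr1.
have [Sx|Sx] := pselect (S x); last first.
  rewrite indic_nsphere// mul0r -[RHS](mul0r (fine (sigma setT))) -Rintegral_cst//.
  by apply: eq_Rintegral => y _; rewrite skernel_out//= => -[].
rewrite indic_sphere// mul1r -Rintegral_indic; apply: eq_Rintegral => y _.
by rewrite /skernel/= (indic_sphere Sx) mul1r.
Qed.

Lemma qform_schur_one j : qform sigma (skernel (schur 0 j)) (fun=> 1) =
  (j == 0)%:R * area R n ^+ 2.
Proof.
rewrite qform_one; last exact: bounded_schur.
have E x : \int[sigma]_(y in S) schur 0 j x y = (j == 0)%:R * area R n.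
  transitivity (\int[sigma]_(y in S) zkernel j x y).
    by apply: eq_Rintegral => y _; rewrite /schur expr0 mul1r.
  case: j => [|j]; last by rewrite Rint_zkernel0// mul0r.
  by rewrite /= Rintegral_cst// !mul1r.
under eq_Rintegral do rewrite E.
by rewrite Rintegral_cst// expr2 mulrA.
Qed.

(** Constants are orthogonal to Z_j for j > 0, so the majorant reduces to its term j = 0. *)
Lemma qform_pkernel_one t : 0 <= t -> t < 1 ->
  qform sigma (skernel (pkernel a t)) (fun=> 1) <= area R n ^+ 2.
Proof.
move=> t0 t1; have [C hC] := qform_pkernel_le a_gt0 a_lt1 t0 t1 one_sq.
apply: (@squeeze_exists _ _ C t) => // M; apply: le_trans (hC M) _.
rewrite lerD2r; under eq_bigr do rewrite qform_schur_one.
rewrite big_ord_recl big1 ?addr0 => [|j _]; last by rewrite mul0r mulr0.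
by rewrite /bcoef /= !mul1r.
Qed.

Lemma sb_pkernel t z : S z -> 0 <= t -> t < 1 -> exists g : quatn -> R,
  sphere_bounded g /\ forall y, S y -> g y = pkernel a t z y.
Proof.
move=> Sz t0 t1; exists (fun y => skernel (pkernel a t) (z, y)); split.
  have [mk [M kM]] := bounded_section z (bounded_pkernel n a_gt0 t0 t1).
  by split=> //; exists M.
by move=> y Sy; rewrite skernel_in.
Qed.

Lemma dist2_isom (T : quatn -> quatn) t z y : (forall x y, hdot (T x) (T y) = hdot x y) ->
  dist2 t (T z) (T y) = dist2 t z y :> R.
Proof. by move=> Td; rewrite /dist2 Td. Qed.

Lemma sphere_base : S (hbase R n).
Proof. by apply/sphereP; exact: hnsq_base. Qed.

Lemma Rint_pkernel_const t z : S z -> 0 <= t -> t < 1 ->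
  \int[sigma]_(y in S) pkernel a t z y = \int[sigma]_(y in S) pkernel a t (hbase R n) y.
Proof.
move=> Sz t0 t1; have [T [iT Td Tz]] := sp_transitive z.
have z1 : hnorm z = 1 by [].
have {}Tz : T z = hbase R n.
  rewrite Tz z1; apply: eq_from_tnth => j; rewrite tnth_mktuple qscaleE.
  by rewrite (_ : qreal 1 = 1)// mul1r.
have [g [bg gE]] := sb_pkernel sphere_base t0 t1.
transitivity (\int[sigma]_(y in S) g (T y)).
  apply: eq_Rintegral => y /set_mem Sy; rewrite gE; last first.
    by rewrite -(isom_sphere iT) in Sy.
  by rewrite /pkernel -Tz dist2_isom.
rewrite isom_Rintegral//; apply: eq_Rintegral => y /set_mem Sy; exact: gE.
Qed.

(** All rows have the same integral by transitivity, so the double integral is the area times that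
    of one row. *)
Lemma Rint_pkernel_le t z : S z -> 0 <= t -> t < 1 ->
  \int[sigma]_(y in S) pkernel a t z y <= area R n.
Proof.
move=> Sz t0 t1; have := qform_pkernel_one t0 t1.
rewrite qform_one; last exact: (bounded_pkernel n a_gt0 t0 t1).
have -> : \int[sigma]_(x in S) \int[sigma]_(y in S) pkernel a t x y =
    \int[sigma]_(x in S) (fun=> \int[sigma]_(y in S) pkernel a t z y) x.
  by apply: eq_Rintegral => x /set_mem Sx; rewrite (Rint_pkernel_const Sx t0 t1) (Rint_pkernel_const Sz t0 t1).
by rewrite Rintegral_cst// expr2 -/(area R n) ler_pM2r.
Qed.

(** From exp(s) >= 1 + s at s = - a ln x, and ln x <= x - 1. *)
Lemma powR_ge_tangent (x : R) : 0 < x -> 1 - a * (x - 1) <= (x `^ a)^-1.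
Proof.
move=> x0; rewrite -powRN /powR gt_eqF// mulNr.
apply: le_trans (expR_ge1Dx _); rewrite lerD2l lerN2 ler_pM2l//.
have := @le_ln1Dx R (x - 1); rewrite [1 + _]addrC subrK; apply; lra.
Qed.

Lemma qform_pkernel_one_ge t : 0 <= t -> t < 1 ->
  (1 - a / n.+1%:R) * area R n ^+ 2 <= qform sigma (skernel (pkernel a t)) (fun=> 1).
Proof.
move=> t0 t1; rewrite qform_one; last exact: (bounded_pkernel n a_gt0 t0 t1).
have I z : S z -> (1 - a / n.+1%:R) * area R n <= \int[sigma]_(y in S) pkernel a t z y.
  move=> Sz; have [g [bg gE]] := sb_pkernel Sz t0 t1.
  have -> : \int[sigma]_(y in S) pkernel a t z y = \int[sigma]_(y in S) g y.
    by apply: eq_Rintegral => y /set_mem Sy; rewrite gE.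
  (* The tangent bound at |1 - t u|^2 = 1 - t Z_1 + t^2 |u|^2. The integral of Z_1 is 0 and that of
     |u|^2 is 2 g_1 = |S| / (n + 1). *)
  pose h y := 1 + (- a * t ^+ 2) * qnsq (hdot z y) + (a * t) * zkernel 1 z y.
  have bC (c : R) f : sphere_bounded f -> sphere_bounded (fun y : quatn => c * f y).
    by move=> bf; apply: sphere_boundedM => //; exact: sphere_bounded_cst.
  have bd := sb_qnsq z; have bz := @sb_zkernel R n 1 z.
  have b1 := @sphere_bounded_cst R n 1.
  have bh1 := sphere_boundedD b1 (bC (- a * t ^+ 2) _ bd).
  have bh2 := bC (a * t) _ bz.
  have bh : sphere_bounded h by exact: sphere_boundedD bh1 bh2.
  apply: (@le_trans _ _ (\int[sigma]_(y in S) h y)).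
    rewrite /h (sRintegralD bh1 bh2) (sRintegralD b1 (bC _ _ bd)).
    rewrite (sRintegralZ _ bd) (sRintegralZ _ bz) Rint_zkernel0// Rint_qnsq Rintegral_cst// mul1r mulr0 addr0.
    move/sphereP: Sz => ->; rewrite mulr1.
    have := gmom1E R n; rewrite -/(area R n); move: (gmom R n 1) => g1 gA.
    have t2 : t ^+ 2 <= 1 by rewrite exprn_ile1// ltW.
    have N0 : 0 < n.+1%:R :> R by rewrite ltr0n.
    rewrite mulrBl mul1r lerD2l -gA mulNr mulNr lerN2.
    rewrite (_ : a / n.+1%:R * _ = a * (2 * g1)); last by field; rewrite gt_eqF.
    rewrite -mulrA ler_pM2l// ler_piMl// mulr_ge0//.
    by rewrite -(@pmulr_lge0 _ (2 * n.+1%:R)) ?gA ?(ltW area_gt0)// mulr_gt0.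
  have ih := sphere_bounded_integrable bh; have ig := sphere_bounded_integrable bg.
  refine (le_Rintegral mS ih ig _).
  move=> y Sy; rewrite gE// /pkernel.
  have dp : 0 < dist2 t z y.
    apply: lt_le_trans (dist2_ge Sz Sy t0 (ltW t1)); rewrite exprn_gt0// subr_gt0//.
  apply: le_trans (powR_ge_tangent dp); rewrite /h /dist2 /zkernel /= le_eqVlt.
  by apply/orP; left; apply/eqP; ring.
have Ie : \int[sigma]_(x in S) \int[sigma]_(y in S) pkernel a t x y =
    (\int[sigma]_(y in S) pkernel a t (hbase R n) y) * area R n.
  transitivity (\int[sigma]_(x in S) (fun=> \int[sigma]_(y in S) pkernel a t (hbase R n) y) x).
    by apply: eq_Rintegral => x /set_mem Sx; rewrite (Rint_pkernel_const Sx t0 t1).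
  by rewrite Rintegral_cst.
rewrite Ie expr2 mulrA ler_pM2r//; apply: I; exact: sphere_base.
Qed.

End power_kernel_bounds.

(** * Passage to the limit for kernels with bounded rows *)

Section kernel_limits.
Context d (T : measurableType d) (R : realType).
Variable mu : {sigma_finite_measure set T -> \bar R}.
Hypothesis mu_fin : (mu setT < +oo)%E.
Implicit Types (f g : T -> R).

Let ge0_EFin (r : R) : 0 <= r -> (0 <= r%:E)%E.
Proof. by []. Qed.

Let limn_einf_ge0 (u : (\bar R)^nat) : (forall i, 0 <= u i)%E -> (0 <= limn_einf u)%E.
Proof.
move=> u0; rewrite limn_einf_lim; apply: lime_ge; first exact: is_cvg_einfs.
by apply: nearW => m; apply: le_ereal_inf_tmp => _ [i _ <-]; exact: u0.
Qed.

Let limn_einf_le (u : (\bar R)^nat) l : (forall i, u i <= l)%E -> (limn_einf u <= l)%E.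
Proof.
move=> ul; rewrite limn_einf_lim; apply: lime_le; first exact: is_cvg_einfs.
by apply: nearW => m; apply: le_trans (ul m); apply: ereal_inf_lbound; exists m => /=.
Qed.

Let normM_le_sqr (x u v y : R) : `|x| * `|y| <= x ^+ 2 + u ^+ 2 + (v ^+ 2 + y ^+ 2).
Proof.
rewrite -(real_normK (num_real x)) -(real_normK (num_real y)).
have := sqr_ge0 (`|x| - `|y|); have := sqr_ge0 u; have := sqr_ge0 v.
have := mulr_ge0 (normr_ge0 x) (normr_ge0 y); rewrite sqrrB.
by move: `|x| `|y| => X Y; lra.
Qed.

Section row_bounds.
Variables (k : T * T -> R) (A : R).
Hypotheses (mk : measurable_fun setT k) (k0 : forall p, 0 <= k p).
Hypothesis kC : forall x y, k (y, x) = k (x, y).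
Hypothesis kA : forall x, (\int[mu]_y (k (x, y))%:E <= A%:E)%E.

Let row_int f : square_integrable mu f ->
  (\int[mu]_x \int[mu]_y ((f x ^+ 2) * k (x, y))%:E < +oo)%E.
Proof.
move=> [mf f2]; have A0 : (0 <= A%:E)%E.
  apply: le_trans (kA point); apply: integral_ge0 => y _; exact: k0.
have msec x : measurable_fun setT (fun y => (k (x, y))%:E).
  by apply/measurable_EFinP; exact: (measurableT_comp mk (pair1_measurable x)).
have mf2 : measurable_fun setT (fun x => (f x ^+ 2)%:E).
  by apply/measurable_EFinP; exact: measurable_funX.
have F0 : (0 <= \int[mu]_x (f x ^+ 2)%:E)%E.
  by apply: integral_ge0 => x _; apply: ge0_EFin; rewrite sqr_ge0.
apply: (@le_lt_trans _ _ ((\int[mu]_x (f x ^+ 2)%:E) * A%:E)%E); last first.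
  by rewrite lte_mul_pinfty ?ge0_fin_numE// ltry.
have E x : (\int[mu]_y ((f x ^+ 2) * k (x, y))%:E =
    (f x ^+ 2)%:E * \int[mu]_y (k (x, y))%:E)%E.
  by rewrite -ge0_integralZl// => [y _|]; apply: ge0_EFin; rewrite ?sqr_ge0.
rewrite -ge0_integralZr//; last by move=> x _; apply: ge0_EFin; rewrite sqr_ge0.
apply: ge0_le_integral => //.
- by move=> x _; apply: integral_ge0 => y _; apply: ge0_EFin; rewrite mulr_ge0 ?sqr_ge0.
- apply: (measurable_fun_fubini_tonelli_F (fun p => ((f p.1 ^+ 2) * k p)%:E)).
    apply/measurable_EFinP; apply: measurable_funM => //; apply: measurable_funX.
    exact: (measurableT_comp mf).
  by move=> p; apply: ge0_EFin; rewrite mulr_ge0 ?sqr_ge0.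
- exact: emeasurable_funM.
by move=> x _; rewrite E lee_wpmul2l//; apply: ge0_EFin; rewrite sqr_ge0.
Qed.

(** As in the Schur test, the row bound makes f(x)^2 k integrable and symmetry does the same for
    f(y)^2 k. The sum dominates f(x) f(y) k. *)
Lemma integrable_row_bound f : square_integrable mu f ->
  (mu \x mu)%E.-integrable setT (EFin \o (fun p => (f p.1 ^+ 2 + f p.2 ^+ 2) * k p)).
Proof.
move=> f2; have [mf _] := f2.
have m1 : measurable_fun setT (fun p : T * T => f p.1 ^+ 2 * k p).
  by apply: measurable_funM => //; apply: measurable_funX; exact: (measurableT_comp mf).
have m2 : measurable_fun setT (fun p : T * T => f p.2 ^+ 2 * k p).
  by apply: measurable_funM => //; apply: measurable_funX; exact: (measurableT_comp mf).
have /measurable_EFinP e1 := m1; have /measurable_EFinP e2 := m2.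
have n1 x p : (0 <= (f x ^+ 2 * k p)%:E)%E by exact: mulr_ge0 (sqr_ge0 _) (k0 _).
have i1 : (mu \x mu)%E.-integrable setT (EFin \o (fun p => f p.1 ^+ 2 * k p)).
  apply/integrableP; split; first exact/measurable_EFinP.
  rewrite (eq_integral (fun p => (f p.1 ^+ 2 * k p)%:E)); last first.
    by move=> p _ /=; congr EFin; apply: ger0_norm; exact: mulr_ge0 (sqr_ge0 _) (k0 _).
  rewrite (fubini_tonelli1 _ e1 (fun p => n1 p.1 p)); exact: (row_int f2).
have i2 : (mu \x mu)%E.-integrable setT (EFin \o (fun p => f p.2 ^+ 2 * k p)).
  apply/integrableP; split; first exact/measurable_EFinP.
  rewrite (eq_integral (fun p => (f p.2 ^+ 2 * k p)%:E)); last first.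
    by move=> p _ /=; congr EFin; apply: ger0_norm; exact: mulr_ge0 (sqr_ge0 _) (k0 _).
  rewrite (fubini_tonelli2 _ e2 (fun p => n1 p.2 p)); apply: le_lt_trans (row_int f2); rewrite le_eqVlt; apply/orP; left; apply/eqP.
  by apply: eq_integral => y _; apply: eq_integral => x _ /=; rewrite kC.
have -> : EFin \o (fun p => (f p.1 ^+ 2 + f p.2 ^+ 2) * k p) =
    ((EFin \o (fun p => f p.1 ^+ 2 * k p)%R) \+ (EFin \o (fun p => f p.2 ^+ 2 * k p)%R))%E.
  by apply/funext => p /=; rewrite mulrDl EFinD.
exact: integrableD.
Qed.

Lemma integrable_form f g : square_integrable mu f -> square_integrable mu g ->
  (mu \x mu)%E.-integrable setT (EFin \o (fun p => f p.1 * g p.2 * k p)).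
Proof.
move=> f2 g2; have [mf _] := f2; have [mg _] := g2.
apply: (le_integrable measurableT _ _
  (integrableD measurableT (integrable_row_bound f2) (integrable_row_bound g2))).
  apply/measurable_EFinP; apply: measurable_funM => //.
  by apply: measurable_funM; [exact: (measurableT_comp mf)|exact: (measurableT_comp mg)].
move=> p _ /=; rewrite lee_fin -mulrDl !normrM ler_wpM2r//.
rewrite [leRHS]ger0_norm ?addr_ge0 ?sqr_ge0//; exact: normM_le_sqr.
Qed.

Lemma form_swap f g : square_integrable mu f -> square_integrable mu g ->
  \int[(mu \x mu)%E]_p (f p.1 * g p.2 * k p) =
  \int[(mu \x mu)%E]_p (g p.1 * f p.2 * k p).
Proof.
move=> f2 g2; rewrite /Rintegral; congr fine.
rewrite -(integral12_prod_meas1 (integrable_form f2 g2)).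
rewrite -(integral21_prod_meas1 (integrable_form g2 f2)).
apply: eq_integral => x _; apply: eq_integral => y _ /=.
by rewrite kC (mulrC (f x)).
Qed.

End row_bounds.

Section limits.
Variables (k_ : nat -> T * T -> R) (k : T * T -> R) (A c : R).
Hypotheses (mk_ : forall i, measurable_fun setT (k_ i)) (mk : measurable_fun setT k).
Hypotheses (k_0 : forall i p, 0 <= k_ i p) (k0 : forall p, 0 <= k p).
Hypothesis kC : forall x y, k (y, x) = k (x, y).
Hypothesis k_A : forall i x, (\int[mu]_y (k_ i (x, y))%:E <= A%:E)%E.
Hypothesis k_cvg : forall p, k p = 0 \/ k_ ^~ p @ \oo --> k p.

(** Fatou's lemma along each row. Where the approximations fail to converge, k = 0, and
    nonnegativity of the lower limit suffices. *)
Lemma row_bound_limit x : (\int[mu]_y (k (x, y))%:E <= A%:E)%E.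
Proof.
have mk_x i : measurable_fun setT (fun y => (k_ i (x, y))%:E).
  by apply/measurable_EFinP; exact: (measurableT_comp (mk_ i) (pair1_measurable x)).
have h := fatou mu measurableT mk_x (fun i y _ => k_0 i (x, y)).
apply: le_trans (le_trans h (limn_einf_le (fun i => k_A i x))).
apply: ge0_le_integral => //.
- by move=> y _; exact: k0.
- by apply/measurable_EFinP; exact: (measurableT_comp mk (pair1_measurable x)).
- rewrite /limn_einf; apply: measurableT_comp => //.
  by apply: measurable_fun_limn_esup => i; exact: measurableT_comp.
move=> y _; have [->|kxy] := k_cvg (x, y).
  by apply: limn_einf_ge0 => i; exact: k_0.
have /cvg_limn_einf_sup[E _] : (fun i => (k_ i (x, y))%:E) @ \oo --> (k (x, y))%:E.
  by apply: cvg_EFin => //; exact: nearW.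
by rewrite /= E.
Qed.

Hypothesis ae_cvg : {ae (mu \x mu)%E, forall p, k_ ^~ p @ \oo --> k p}.
Hypothesis ae_le : {ae (mu \x mu)%E, forall p, forall i, k_ i p <= c * k p}.

(** Dominated convergence with majorant c (f(x)^2 + f(y)^2) k, integrable by the row bound for the
    limit kernel. *)
Lemma qform_cvg f : square_integrable mu f ->
  (fun i => qform mu (k_ i) f) @ \oo --> qform mu k f.
Proof.
move=> f2; have [mf _] := f2.
have mff : measurable_fun setT (fun p : T * T => f p.1 * f p.2).
  by apply: measurable_funM; exact: (measurableT_comp mf).
have kA := row_bound_limit.
have gi := integrableZl measurableT c (integrable_row_bound mk k0 kC kA f2).
have mF i : measurable_fun setT (fun p => (f p.1 * f p.2 * k_ i p)%:E).
  by apply/measurable_EFinP; exact: measurable_funM.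
have mF0 : measurable_fun setT (fun p => (f p.1 * f p.2 * k p)%:E).
  by apply/measurable_EFinP; exact: measurable_funM.
have Fcvg : {ae (mu \x mu)%E, forall p, setT p ->
    (fun i => (f p.1 * f p.2 * k_ i p)%:E) @ \oo --> (f p.1 * f p.2 * k p)%:E}.
  apply: filterS ae_cvg => p kp _; apply: cvg_EFin; first exact: nearW.
  by apply: cvgM => //; exact: cvg_cst.
have Fle : {ae (mu \x mu)%E, forall p, forall i, setT p ->
    (`|(f p.1 * f p.2 * k_ i p)%:E| <= c%:E * ((f p.1 ^+ 2 + f p.2 ^+ 2) * k p)%:E)%E}.
  apply: filterS ae_le => p kp i _; rewrite -EFinM lee_fin normrM (ger0_norm (k_0 i p)).
  rewrite mulrCA; apply: ler_pM => //; rewrite normrM.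
  by have := normM_le_sqr (f p.1) 0 0 (f p.2); rewrite expr0n/= addr0 add0r.
have [_ _ h] := dominated_convergence measurableT mF mF0 Fcvg gi Fle.
have fi : (mu \x mu)%E.-integrable setT (EFin \o (fun p => f p.1 * f p.2 * k p)).
  exact: (integrable_form mk k0 kC kA f2 f2).
apply: fine_cvg; rewrite fineK; last exact: (integrable_fin_num measurableT fi).
exact: h.
Qed.
End limits.
End kernel_limits.

Lemma prod_null_xsection d (T : measurableType d) (R : realType)
    (mu : {sigma_finite_measure set T -> \bar R}) (D : set (T * T)) :
  (forall x, mu (xsection D x) = 0%E) -> (mu \x mu)%E D = 0%E.
Proof. by move=> D0; apply: integral0_eq => x _; exact: D0. Qed.

Lemma powRV_cvg (R : realType) (a : R) (u : nat -> R) (l : R) :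
  (forall i, 0 < u i) -> 0 < l -> u @ \oo --> l ->
  (fun i => (u i `^ a)^-1) @ \oo --> (l `^ a)^-1.
Proof.
move=> u0 l0 ul; have E x : 0 < x -> (x `^ a)^-1 = expR (- a * ln x).
  by move=> x0; rewrite -powRN /powR gt_eqF.
under eq_fun do rewrite E//; rewrite E//.
apply: continuous_cvg; first exact: continuous_expR.
apply: cvgM; first exact: cvg_cst.
by apply: continuous_cvg => //; exact: continuous_ln.
Qed.

(** * The singular kernel *)

Section singular_kernel.
Context (R : realType) (n : nat) (a : R).
Hypotheses (a_gt0 : 0 < a) (a_lt1 : a < 1).
Notation quatn := (n.+1.-tuple (quat R)).
Notation sigma := (surface_measure R n).
Notation S := (sphere R n).
Let mu_fin := surface_measure_fin R n.
Let mS := @measurable_sphere R n.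
Hypothesis area_gt0 : 0 < area R n.

(** The offset 2 keeps these parameters in [1/2, 1), the range in which [dist2_quarter] gives
    domination. *)
Let tt (i : nat) : R := 1 - i.+2%:R^-1.

Let tt_half i : 2^-1 <= tt i.
Proof.
rewrite /tt; have : i.+2%:R^-1 <= 2^-1 :> R by rewrite lef_pV2 ?posrE// ler_nat.
by move: (i.+2%:R^-1) => x xle; lra.
Qed.

Let tt_ge0 i : 0 <= tt i.
Proof. by apply: le_trans (tt_half i); rewrite invr_ge0. Qed.

Let tt_lt1 i : tt i < 1.
Proof. by rewrite /tt ltrBlDr ltrDl invr_gt0. Qed.

Let tt_cvg : tt @ \oo --> (1 : R).
Proof.
rewrite -[X in _ --> X]subr0; apply: cvgB; first exact: cvg_cst.
by have := @cvg_harmonic R; rewrite -(cvg_shiftS (@harmonic R)).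
Qed.

(** With c = Re u and e = |u|^2, 4 |1 - t u|^2 - |1 - u|^2 is the difference of squares (2 - 2 t
    c)^2 - (1 - c)^2 plus (4 t^2 - 1) (e - c^2). The comparison provides the dominating function. *)
Lemma dist2_quarter t (z w : quatn) : S z -> S w -> 2^-1 <= t -> t <= 1 ->
  dist2 1 z w <= 4 * dist2 t z w.
Proof.
move=> Sz Sw th t1; have d1 := sphere_nsq Sz Sw; rewrite /dist2.
have dc : ((hdot z w).1.1 : R) ^+ 2 <= qnsq (hdot z w).
  by have [y <-] := quat_complex (hdot z w); rewrite lerDl sqr_ge0.
have c1 : ((hdot z w).1.1 : R) ^+ 2 <= 1 by exact: le_trans dc d1.
move: ((hdot z w).1.1 : R) (qnsq (hdot z w)) d1 dc c1 => c e d1 dc c1.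
have [c2 c3] : -1 <= c /\ c <= 1 by split; nra.
have h1 : 0 <= 1 + c - 2 * t * c by nra.
have h2 : 0 <= 3 - c - 2 * t * c by nra.
have h3 := mulr_ge0 h1 h2.
have h4 : 0 <= (4 * t ^+ 2 - 1) * (e - c ^+ 2) by rewrite mulr_ge0 ?subr_ge0//; nra.
rewrite -subr_ge0; apply: le_trans (addr_ge0 h3 h4) _.
by rewrite le_eqVlt; apply/orP; left; apply/eqP; ring.
Qed.

Lemma dist2_1_ge0 (z w : quatn) : S z -> S w -> 0 <= dist2 1 z w.
Proof.
by move=> Sz Sw; have := dist2_ge Sz Sw ler01 (lexx 1); rewrite subrr expr0n.
Qed.

Lemma dist2_cvg (z w : quatn) : (fun i => dist2 (tt i) z w) @ \oo --> dist2 1 z w.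
Proof.
apply: cvgD; last by apply: cvgM; [rewrite expr2; apply: cvgM|exact: cvg_cst].
apply: cvgB; first exact: cvg_cst.
apply: cvgM; last exact: cvg_cst.
by apply: cvgM => //; exact: cvg_cst.
Qed.

Lemma pkernel_cvg (z w : quatn) : S z -> S w -> dist2 1 z w != 0 ->
  (fun i => pkernel a (tt i) z w) @ \oo --> pkernel a 1 z w.
Proof.
move=> Sz Sw d0; have dp : 0 < dist2 1 z w by rewrite lt0r d0 dist2_1_ge0.
apply: powRV_cvg => //; last exact: dist2_cvg.
move=> i; have := dist2_quarter Sz Sw (tt_half i) (ltW (tt_lt1 i)).
by move=> h; have := lt_le_trans dp h; rewrite pmulr_rgt0.
Qed.

Lemma pkernel_le t (z w : quatn) : S z -> S w -> dist2 1 z w != 0 ->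
  2^-1 <= t -> t < 1 -> pkernel a t z w <= 4 `^ a * pkernel a 1 z w.
Proof.
move=> Sz Sw d0 th t1; have dp : 0 < dist2 1 z w by rewrite lt0r d0 dist2_1_ge0.
have h := dist2_quarter Sz Sw th (ltW t1).
have tp : 0 < dist2 t z w by have := lt_le_trans dp h; rewrite pmulr_rgt0.
have q0 : 0 < 4 `^ a by exact: powR_gt0.
rewrite /pkernel -ler_pdivrMl// -invfM lef_pV2 ?posrE ?mulr_gt0 ?powR_gt0//.
rewrite -powRM ?(ltW tp)//; apply: ge0_ler_powR => //; rewrite ?nnegrE ?mulr_ge0 ?ltW//.
Qed.

Lemma skernel_pkernel_ge0 t (p : quatn * quatn) : 0 <= skernel (pkernel a t) p :> R.
Proof. by rewrite /skernel mulr_ge0 ?pkernel_ge0// mulr_ge0// indicE. Qed.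

Definition diagonal : set (quatn * quatn) :=
  [set p | S p.1 /\ S p.2 /\ dist2 1 p.1 p.2 = 0].

Lemma measurable_diagonal : measurable diagonal.
Proof.
have -> : diagonal = (fst @^-1` S) `&` ((snd @^-1` S) `&`
    ((fun p => dist2 1 p.1 p.2) @^-1` [set 0])) by [].
have h d (X : measurableType d) (f : quatn * quatn -> X) (B : set X) :
    measurable_fun setT f -> measurable B -> measurable (f @^-1` B).
  by move=> mf mB; rewrite -[X in measurable X]setTI; exact: mf.
apply: measurableI; first exact: h.
by apply: measurableI; apply: h => //; exact: measurable_kernel_dist2.
Qed.

Lemma row_pkernel_le t z : 0 <= t -> t < 1 ->
  (\int[sigma]_y (skernel (pkernel a t) (z, y))%:E <= (area R n)%:E)%E.
Proof.
move=> t0 t1; have bk := bounded_section z (bounded_pkernel n a_gt0 t0 t1).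
have ik := bounded_kernel_int mu_fin bk.
have kfin := integrable_fin_num measurableT ik.
rewrite -(fineK kfin) lee_fin.
have [Sz|Sz] := pselect (S z); last first.
  rewrite (_ : fine _ = 0) ?(ltW area_gt0)//.
  by rewrite integral0_eq// => y _; rewrite /= skernel_out//= => -[/Sz].
apply: le_trans (Rint_pkernel_le a_gt0 a_lt1 area_gt0 Sz t0 t1).
rewrite le_eqVlt; apply/orP; left; apply/eqP; rewrite -Rintegral_indic.
by apply: eq_Rintegral => y _; rewrite /skernel/= (indic_sphere Sz) mul1r.
Qed.

(** On this set |1 - t u| = 1 - t = r, so the kernel equals r^(- 2 a) there, while its row integral
    is at most the area. Hence the measure is at most r^(2 a) |S|, for all small r. *)
Lemma diagonal_row z : sigma (xsection diagonal z) = 0%E.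
Proof.
have mD := measurable_xsection z measurable_diagonal.
have finD : sigma (xsection diagonal z) \is a fin_num.
  rewrite ge0_fin_numE//; apply: le_lt_trans mu_fin; apply: le_measure => //; rewrite inE//.
rewrite -(fineK finD); congr EFin; apply/eqP; rewrite eq_le fine_ge0// andbT.
apply/ler_addgt0Pr => e e0; rewrite add0r.
(* The second entry solves r^(2 a) |S| = e; the minimum with 1/2 keeps 1 - r in [0, 1). *)
pose r := Num.min 2^-1 ((e / area R n) `^ (a^-1 / 2)).
have r0 : 0 < r by rewrite lt_min invr_gt0 ltr0n/= powR_gt0 ?divr_gt0.
have r1 : r < 1 by rewrite gt_min; apply/orP; left; lra.
have rE : (r ^+ 2) `^ a <= e / area R n.
  apply: (@le_trans _ _ ((((e / area R n) `^ (a^-1 / 2)) ^+ 2) `^ a)).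
    apply: ge0_ler_powR; rewrite ?(ltW a_gt0)// ?nnegrE ?exprn_ge0 ?powR_ge0 ?(ltW r0)//.
    by rewrite ler_pXn2r ?nnegrE ?powR_ge0 ?(ltW r0)// ge_min lexx orbT.
  have aE : a^-1 / 2 * (2 * a) = 1 by field; rewrite gt_eqF.
  by rewrite -powR_mulrn ?powR_ge0// -!powRrM aE powRr1// divr_ge0// ltW.
have t0 : 0 <= 1 - r by lra.
have t1 : 1 - r < 1 by lra.
have q0 : 0 < (r ^+ 2) `^ a by apply: powR_gt0; exact: exprn_gt0.
have h : ((((r ^+ 2) `^ a)^-1)%:E * sigma (xsection diagonal z) <= (area R n)%:E)%E.
  apply: le_trans (row_pkernel_le z t0 t1).
  rewrite -(integral_cst sigma mD) integral_mkcond; apply: ge0_le_integral => //.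
  - by move=> y _; rewrite patchE; case: ifP => // _; rewrite lee_fin invr_ge0 ltW.
  - by apply/(measurable_restrictT _ mD); exact: measurable_cst.
  - apply/measurable_EFinP.
    by have [] := bounded_section z (bounded_pkernel n a_gt0 t0 t1).
  move=> y _; rewrite patchE; case: ifPn => [|_].
    rewrite inE /xsection/= inE => -[/= Sz [Sy d0]]; rewrite lee_fin skernel_in//.
    (* The relations (Re u)^2 <= |u|^2 and 1 - 2 Re u + |u|^2 = 0 force Re u = |u|^2 = 1. *)
    have dE : dist2 (1 - r) z y = r ^+ 2.
      move: d0; have := sphere_nsq Sz Sy; rewrite /dist2.
      have : ((hdot z y).1.1 : R) ^+ 2 <= qnsq (hdot z y).
        by have [x <-] := quat_complex (hdot z y); rewrite lerDl sqr_ge0.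
      move: ((hdot z y).1.1 : R) (qnsq (hdot z y)) => c q cq q1 d0.
      have c1 : c = 1.
        apply/eqP; rewrite -subr_eq0 -sqrf_eq0 eq_le sqr_ge0 andbT; nra.
      have qE : q = 1 by move: d0; rewrite c1 expr1n; lra.
      by rewrite c1 qE; ring.
    by rewrite /pkernel dE.
  exact: skernel_pkernel_ge0.
move: h; rewrite -(fineK finD) -EFinM lee_fin ler_pdivrMl// => h.
by apply: le_trans h _; rewrite -ler_pdivlMr.
Qed.

Lemma diagonal_null : (sigma \x sigma)%E diagonal = 0%E.
Proof. by apply: prod_null_xsection => x; exact: diagonal_row. Qed.

Lemma ae_off_diagonal : {ae (sigma \x sigma)%E, forall p, ~ diagonal p}.
Proof.
exists diagonal; split; [exact: measurable_diagonal|exact: diagonal_null|].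
by move=> p /contrapT.
Qed.

Lemma skernel_pkernelC t (x y : quatn) :
  skernel (pkernel a t) (y, x) = skernel (pkernel a t) (x, y) :> R.
Proof. by apply: skernelC => z w; rewrite /pkernel /dist2 hdotC qnsq_conj. Qed.

Let k_ i : quatn * quatn -> R := skernel (pkernel a (tt i)).
Let k : quatn * quatn -> R := skernel (pkernel a 1).

Let mk_ i : measurable_fun setT (k_ i).
Proof. exact: measurable_skernel (measurable_kernel_pkernel _ _). Qed.

Let mk : measurable_fun setT k.
Proof. exact: measurable_skernel (measurable_kernel_pkernel _ _). Qed.

Let k_cvg p : ~ diagonal p -> k_ ^~ p @ \oo --> k p.
Proof.
case: p => z w nd; rewrite /k_ /k; have [[Sz Sw]|SS] := pselect (S z /\ S w); last first.
  by under eq_fun do rewrite skernel_out//; rewrite skernel_out//; exact: cvg_cst.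
under eq_fun do rewrite skernel_in//; rewrite skernel_in//; apply: pkernel_cvg => //.
by apply/eqP => d0; exact: nd.
Qed.

Let k_diag p : k p = 0 \/ k_ ^~ p @ \oo --> k p.
Proof.
have [[Sz [Sw d0]]|nd] := pselect (diagonal p); last by right; exact: k_cvg.
left; rewrite /k /skernel /pkernel d0 powR0 ?gt_eqF// invr0 mulr0//.
Qed.

Let k_A i x : (\int[sigma]_y (k_ i (x, y))%:E <= (area R n)%:E)%E.
Proof. exact: row_pkernel_le. Qed.

Lemma pkernel1_row x : (\int[sigma]_y (k (x, y))%:E <= (area R n)%:E)%E.
Proof.
apply: (row_bound_limit mk_ mk _ _ k_A k_diag) => // [i p|p]; exact: skernel_pkernel_ge0.
Qed.

Lemma pkernel1_integrable f g : square_integrable sigma f -> square_integrable sigma g ->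
  (sigma \x sigma)%E.-integrable setT
    (EFin \o (fun p => f p.1 * g p.2 * skernel (pkernel a 1) p)).
Proof.
move=> f2 g2; apply: (integrable_form mk _ _ pkernel1_row f2 g2).
  by move=> p; exact: skernel_pkernel_ge0.
by move=> x y; exact: skernel_pkernelC.
Qed.

Lemma pkernel1_swap f g : square_integrable sigma f -> square_integrable sigma g ->
  \int[(sigma \x sigma)%E]_p (f p.1 * g p.2 * skernel (pkernel a 1) p) =
  \int[(sigma \x sigma)%E]_p (g p.1 * f p.2 * skernel (pkernel a 1) p).
Proof.
move=> f2 g2; apply: (form_swap mk _ _ pkernel1_row f2 g2).
  by move=> p; exact: skernel_pkernel_ge0.
by move=> x y; exact: skernel_pkernelC.
Qed.

Lemma qform_pkernel1_cvg f : square_integrable sigma f ->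
  (fun i => qform sigma (skernel (pkernel a (tt i))) f) @ \oo -->
  qform sigma (skernel (pkernel a 1)) f.
Proof.
move=> f2; apply: (@qform_cvg _ _ _ sigma k_ k (area R n) (4 `^ a)) => //.
- by move=> i p; exact: skernel_pkernel_ge0.
- by move=> p; exact: skernel_pkernel_ge0.
- by move=> x y; exact: skernel_pkernelC.
- by apply: filterS ae_off_diagonal; exact: k_cvg.
apply: filterS ae_off_diagonal => -[z w] nd i; rewrite /k_ /k.
have [[Sz Sw]|SS] := pselect (S z /\ S w); last by rewrite !skernel_out// mulr0.
by rewrite !skernel_in//; apply: pkernel_le => //; apply/eqP => d0; exact: nd.
Qed.

Lemma qform_pkernel1_orth f : square_integrable sigma f ->
  qform sigma (skernel (schur 0 0)) f = 0 -> qform sigma (skernel (schur 0 1)) f = 0 ->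
  qform sigma (skernel (pkernel a 1)) f <= eig2 n a * \int[sigma]_x f x ^+ 2.
Proof.
move=> f2 q0 q1; apply: (cvgr_to_le (qform_pkernel1_cvg f2)); apply: nearW => i.
exact: qform_pkernel_orth.
Qed.

Lemma qform_pkernel1_one_ge :
  (1 - a / n.+1%:R) * area R n ^+ 2 <= qform sigma (skernel (pkernel a 1)) (fun=> 1).
Proof.
have one2 : square_integrable sigma (fun=> 1 : R).
  by apply: (bounded_square_integrable mu_fin); exact: bounded_kernel_cst.
apply: (cvgr_to_ge (qform_pkernel1_cvg one2)); apply: nearW => i.
exact: qform_pkernel_one_ge.
Qed.

End singular_kernel.

Lemma hdot_re (R : realType) (n : nat) (x y : n.+1.-tuple (quat R)) :
  (hdot x y).1.1 = \sum_j \sum_c qcoord c (tnth x j) * qcoord c (tnth y j) :> R.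
Proof.
rewrite (_ : (hdot x y).1.1 = qcoord ord0 (hdot x y))// /hdot.
rewrite (big_morph (qcoord ord0) (qcoordD ord0) (@qcoord0 R ord0)).
apply: eq_bigr => j _; rewrite !big_ord_recl big_ord0 /qcoord/= qmulE /qconj /=; ring.
Qed.

(** * Orthogonality to constants and coordinates *)

Section orthogonality.
Context (R : realType) (n : nat).
Notation quatn := (n.+1.-tuple (quat R)).
Notation sigma := (surface_measure R n).
Notation S := (sphere R n).
Let mu_fin := surface_measure_fin R n.
Let mS := @measurable_sphere R n.
Variable f : quatn -> R.
Hypothesis f2 : square_integrable sigma f.
Hypothesis f_mean : \int[sigma]_(y in S) f y = 0.
Hypothesis f_coord : forall j c, \int[sigma]_(y in S) (f y * qcoord c (tnth y j)) = 0.

(** The integrability clause makes the class stable under sums, where additivity of the integral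
    requires it. *)
Let orth (h : quatn -> R) :=
  sigma.-integrable S (EFin \o (fun y => f y * h y)) /\ \int[sigma]_(y in S) (f y * h y) = 0.

Let fi : sigma.-integrable S (EFin \o f).
Proof.
exact: (integrableS measurableT mS (@subsetT _ S) (square_integrable_int mu_fin f2)).
Qed.

Let orthZ c h : orth h -> orth (fun y => c * h y).
Proof.
move=> [ih h0]; split.
  rewrite (_ : EFin \o _ = (fun y => c%:E * (EFin \o (fun y => f y * h y)%R) y)%E).
    exact: integrableZl.
  by apply/funext => y /=; rewrite -EFinM mulrCA.
under eq_Rintegral do rewrite mulrCA.
by rewrite RintegralZl// h0 mulr0.
Qed.

Let orth_sum m (h : 'I_m -> quatn -> R) :
  (forall i, orth (h i)) -> orth (fun y => \sum_i h i y).
Proof.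
elim: m h => [|m IHm] h oh.
  have -> : (fun y => \sum_i h i y) = (fun=> 0).
    by apply/funext => y; rewrite big_ord0.
  split; last by under eq_Rintegral do rewrite mulr0; rewrite Rintegral_cst// mul0r.
  under eq_fun do rewrite mulr0; exact: integrable0.
have -> : (fun y => \sum_i h i y) =
    (fun y => \sum_(i < m) h (widen_ord (leqnSn m) i) y + h ord_max y).
  by apply/funext => y; rewrite big_ord_recr.
have [i1 e1] := IHm (fun i => h (widen_ord (leqnSn m) i)) (fun i => oh _).
have [i2 e2] := oh ord_max; split.
  under eq_fun do rewrite mulrDr; exact: (integrableD mS i1 i2).
by under eq_Rintegral do rewrite mulrDr; rewrite RintegralD// e1 e2 addr0.
Qed.

Let orth_coord j c : orth (fun y => qcoord c (tnth y j)).
Proof.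
split; last exact: f_coord.
have [mc [M cM]] := @sphere_bounded_hcoord R n c j.
have mf := f2.1.
apply: (le_integrable mS _ _ (integrableZl mS M fi)).
  apply/measurable_EFinP; apply: measurable_funM; exact: measurable_funTS.
move=> y Sy /=; rewrite lee_fin !normrM mulrC ler_wpM2r//.
by apply: le_trans (cM y Sy) _; exact: ler_norm.
Qed.

Let kop_schur j x : \int[sigma]_(y in S) (f y * schur 0 j x y) = 0 ->
  kop sigma (skernel (schur 0 j)) f x = 0.
Proof.
move=> h; rewrite /kop (_ : Rintegral _ _ _ =
    \int[sigma]_y (\1_S y * (\1_S x * (f y * schur 0 j x y)))); last first.
  by apply: eq_Rintegral => y _; rewrite /skernel/=; ring.
rewrite Rintegral_indic; have [Sx|Sx] := pselect (S x).
  by rewrite -[RHS]h; apply: eq_Rintegral => y _; rewrite indic_sphere// mul1r.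
under eq_Rintegral do rewrite indic_nsphere// mul0r.
by rewrite Rintegral_cst// mul0r.
Qed.

Let qform_kop0 j : (forall x, kop sigma (skernel (schur 0 j)) f x = 0) ->
  qform sigma (skernel (schur 0 j)) f = 0.
Proof.
move=> k0; have i := square_integrable_int mu_fin f2.
rewrite /qform (prod_Rintegral i i (@bounded_schur R n 0 j)).1.
by under eq_Rintegral do rewrite k0 mulr0; rewrite Rintegral_cst// mul0r.
Qed.

Lemma qform_schur0 : qform sigma (skernel (schur 0 0)) f = 0.
Proof.
apply: qform_kop0 => x; apply: kop_schur; rewrite -[RHS]f_mean.
by apply: eq_Rintegral => y _; rewrite /schur /zkernel /= expr0 !mulr1.
Qed.

(** Z_1 is twice the real inner product, so its row at x is a combination of the 4 n + 4
    coordinates. *)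
Lemma qform_schur1 : qform sigma (skernel (schur 0 1)) f = 0.
Proof.
apply: qform_kop0 => x; apply: kop_schur.
have [_ h] : orth (fun y => 2 * \sum_j \sum_c qcoord c (tnth x j) * qcoord c (tnth y j)).
  by apply: orthZ; apply: orth_sum => j; apply: orth_sum => c; apply: orthZ; exact: orth_coord.
rewrite -[RHS]h; apply: eq_Rintegral => y _.
by rewrite /schur /zkernel /= expr0 mul1r hdot_re.
Qed.

End orthogonality.

(** * The numerical inequality *)

Section constants.
Context (R : realType) (n : nat) (a : R).
Hypotheses (a_gt0 : 0 < a) (a_lt1 : a < 1).

Lemma eig2E : eig2 n a * (n.+1%:R * (2 * n%:R + 3)) = a * (a + 1) / 2 * area R n.
Proof.
have := gmom1E R n; have := gmom2E R n; rewrite /eig2 /area.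
rewrite (_ : (2 * n + 3)%:R = 2 * n%:R + 3 :> R); last by rewrite natrD natrM.
rewrite /acoef /=; move: (gmom R n 2) (gmom R n 1) (fine _) => g2 g1 A E2 E1.
rewrite -E1; move: E2; move: n%:R => m E2.
have -> : g1 = g2 * (2 * m + 3) / 2 by lra.
by rewrite !mul1r addr0 divr1; field.
Qed.

Lemma eig2_lt : (1 <= n)%N -> 0 < area R n ->
  area R n * eig2 n a < a / (2 * n%:R + 3 - a) * ((1 - a / n.+1%:R) * area R n ^+ 2).
Proof.
have [a0 a1] := (a_gt0, a_lt1); move=> n1 A0; have := eig2E; rewrite -[n.+1%:R]natr1.
have m1 : 1 <= n%:R :> R by rewrite ler1n.
move: (eig2 n a) (area R n) A0 m1 => e A A0; move: (n%:R : R) => m m1 E.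
have m3 : 0 < (m + 1) * (2 * m + 3) by nra.
have -> : e = a * (a + 1) / 2 * A / ((m + 1) * (2 * m + 3)).
  by rewrite -E mulfK// gt_eqF.
have q0 : 0 < 2 * m + 3 - a by lra.
have key : (a + 1) * (2 * m + 3 - a) < 2 * (2 * m + 3) * (m + 1 - a).
  (* The difference of the two sides increases with m, and at m = 1 it equals (1 - a) (14 - a) + 1 +
     a. The bound m >= 1 matters: at m = 0 the inequality fails for a near 1. *)
  have : 0 < (1 - a) * (14 - a) by apply: mulr_gt0; lra.
  nra.
rewrite -subr_gt0 (_ : _ - _ = a * A ^+ 2 *
  (2 * (2 * m + 3) * (m + 1 - a) - (a + 1) * (2 * m + 3 - a)) /
  (2 * (m + 1) * (2 * m + 3) * (2 * m + 3 - a))); last first.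
  by field; rewrite !gt_eqF//=; lra.
rewrite divr_gt0 ?mulr_gt0 ?exprn_gt0 ?subr_gt0//; lra.
Qed.

End constants.

(** * Complex-valued functions and the second variation *)

Local Open Scope complex_scope.
Lemma normc_sq (R : realType) (z : R[i]) :
  ComplexField.Normc.normc z ^+ 2 = complex.Re z ^+ 2 + complex.Im z ^+ 2.
Proof. by case: z => x y; rewrite /= sqr_sqrtr// addr_ge0 ?sqr_ge0. Qed.

Lemma conj_mul_real (R : realType) (z w : R[i]) (r : R) :
  (Num.conj z * w / r%:C) =
  ((complex.Re z * complex.Re w + complex.Im z * complex.Im w) / r) +i*
  ((complex.Re z * complex.Im w - complex.Im z * complex.Re w) / r).
Proof.
rewrite (_ : r%:C^-1 = (r^-1)%:C); last by rewrite fmorphV.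
rewrite (_ : Num.conj z = conjc z)//.
by case: z w => [x y] [u v]; apply: complex_eqP => /=; ring.
Qed.

Lemma qnorm_powR (R : realType) (n : nat) (b : R) (z w : n.+1.-tuple (quat R)) :
  qnorm (1 - hdot z w) `^ (b / 2) = dist2 1 z w `^ (b / 4).
Proof.
have -> : dist2 1 z w = qnorm (1 - hdot z w) `^ 2.
  rewrite powR_mulrn ?sqrtr_ge0// qnormE /dist2 /qnsq qoppE.
  by move: (hdot z w) => [[p q] [r s]] /=; ring.
by rewrite -powRrM; congr (_ `^ _); field.
Qed.

Section square_integrable_parts.
Context (R : realType) (n : nat).
Notation quatn := (n.+1.-tuple (quat R)).
Notation sigma := (surface_measure R n).
Notation S := (sphere R n).
Let mS := @measurable_sphere R n.

Let restrictE (h : quatn -> R) : h \_ S = (fun z => \1_S z * h z).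
Proof.
apply/funext => z; rewrite patchE; case: ifPn => [/set_mem Sz|/negP Sz].
  by rewrite indic_sphere// mul1r.
by rewrite indic_nsphere ?mul0r// => /mem_set.
Qed.

Lemma indic_square_integrable (phi : quatn -> R[i]) (h : quatn -> R) : sphere_L2 phi ->
  measurable_fun S h -> (forall z, h z ^+ 2 <= ComplexField.Normc.normc (phi z) ^+ 2) ->
  square_integrable sigma (fun z => \1_S z * h z).
Proof.
move=> [mRe mIm fin] mh hle; have mf : measurable_fun setT (fun z => \1_S z * h z).
  by rewrite -restrictE; exact/(measurable_restrictT _ mS).
split=> //; apply: le_lt_trans fin; rewrite [leRHS]integral_mkcond.
apply: ge0_le_integral => //.
- by move=> z _; exact: sqr_ge0.
- by apply/measurable_EFinP; exact: measurable_funX.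
- apply/(measurable_restrictT _ mS); apply/measurable_EFinP.
  under eq_fun do rewrite normc_sq.
  by apply: measurable_funD; exact: measurable_funX.
move=> z _; rewrite patchE; case: ifPn => [/set_mem Sz|/negP Sz].
  by rewrite indic_sphere// mul1r lee_fin.
by rewrite indic_nsphere ?mul0r ?expr0n// => /mem_set.
Qed.

Lemma indic_Rintegral (h k : quatn -> R) :
  \int[sigma]_(z in S) (\1_S z * h z * k z) = \int[sigma]_(z in S) (h z * k z).
Proof. by apply: eq_Rintegral => z /set_mem Sz; rewrite indic_sphere// mul1r. Qed.

Lemma Rintegral_sphere2 (K : quatn * quatn -> R) (h : quatn * quatn -> R) :
  (forall z w, S z -> S w -> K (z, w) = h (z, w)) ->
  (forall p, ~ (S p.1 /\ S p.2) -> h p = 0) ->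
  \int[(sigma \x sigma)%E]_(p in S `*` S) K p = \int[(sigma \x sigma)%E]_p h p.
Proof.
move=> Kh h0; rewrite Rintegral_mkcond; apply: eq_Rintegral => -[z w] _; rewrite patchE.
case: ifPn => [|/negP SS]; first by rewrite inE => -[/= Sz Sw]; exact: Kh.
by rewrite h0// => -[Sz Sw]; apply: SS; rewrite inE.
Qed.

End square_integrable_parts.

Section second_variation.
Context (R : realType) (n : nat) (lambda : R).
Notation quatn := (n.+1.-tuple (quat R)).
Notation sigma := (surface_measure R n).
Notation S := (sphere R n).
Let mu_fin := surface_measure_fin R n.
Let mS := @measurable_sphere R n.
Hypotheses (n_ge1 : (1 <= n)%N) (lambda_gt0 : 0 < lambda) (lambda_lt4 : lambda < 4).
Variable phi : quatn -> R[i].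
Hypothesis phi_L2 : sphere_L2 phi.
Hypothesis phi_neq0 : ~ {ae sigma, forall z, S z -> phi z = 0}.
Hypothesis phi_mean0 : cintegral sigma S phi = 0.
Hypothesis phi_coord0 : forall (j : 'I_n.+1) (c : 'I_4),
  cintegral sigma S (fun z => phi z * (qcoord c (tnth z j))%:C) = 0.

Let a := lambda / 4.
Let a_gt0 : 0 < a. Proof. by rewrite divr_gt0. Qed.
Let a_lt1 : a < 1. Proof. by rewrite ltr_pdivrMr// mul1r. Qed.

Let f z := \1_S z * complex.Re (phi z).
Let g z := \1_S z * complex.Im (phi z).
Let k : quatn * quatn -> R := skernel (pkernel a 1).

Let f2 : square_integrable sigma f.
Proof.
have [mRe _ _] := phi_L2; apply: (indic_square_integrable phi_L2 mRe) => z.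
by rewrite normc_sq lerDl sqr_ge0.
Qed.

Let g2 : square_integrable sigma g.
Proof.
have [_ mIm _] := phi_L2; apply: (indic_square_integrable phi_L2 mIm) => z.
by rewrite normc_sq lerDr sqr_ge0.
Qed.

Let fg_mean : \int[sigma]_(y in S) f y = 0 /\ \int[sigma]_(y in S) g y = 0.
Proof.
move: phi_mean0; rewrite /cintegral => -[re0 im0].
split; [rewrite -[RHS]re0|rewrite -[RHS]im0]; apply: eq_Rintegral => z /set_mem Sz.
  by rewrite /f indic_sphere// mul1r.
by rewrite /g indic_sphere// mul1r.
Qed.

Let fg_coord j c : \int[sigma]_(y in S) (f y * qcoord c (tnth y j)) = 0 /\
  \int[sigma]_(y in S) (g y * qcoord c (tnth y j)) = 0.
Proof.
move: (phi_coord0 j c); rewrite /cintegral => -[re0 im0].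
rewrite !indic_Rintegral; split; [rewrite -[RHS]re0|rewrite -[RHS]im0].
  by apply: eq_Rintegral => z _; rewrite ReM/= mulr0 subr0.
by apply: eq_Rintegral => z _; rewrite ImM/= mulr0 add0r.
Qed.

Let normE : \int[sigma]_(z in S) ComplexField.Normc.normc (phi z) ^+ 2 =
  \int[sigma]_z f z ^+ 2 + \int[sigma]_z g z ^+ 2.
Proof.
rewrite -RintegralD//; [|exact: square_integrable_sq..].
rewrite Rintegral_mkcond; apply: eq_Rintegral => z _; rewrite patchE /f /g.
case: ifPn => [/set_mem Sz|/negP Sz]; first by rewrite indic_sphere// !mul1r normc_sq.
by rewrite indic_nsphere ?mul0r ?expr0n ?addr0// => /mem_set.
Qed.

Let norm_gt0 : 0 < \int[sigma]_(z in S) ComplexField.Normc.normc (phi z) ^+ 2.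
Proof.
have [mRe mIm fin] := phi_L2.
have mN : measurable_fun S (fun z => (ComplexField.Normc.normc (phi z) ^+ 2)%:E).
  apply/measurable_EFinP; under eq_fun do rewrite normc_sq.
  by apply: measurable_funD; exact: measurable_funX.
rewrite lt_neqAle Rintegral_ge0 ?andbT; last by move=> z _; exact: sqr_ge0.
apply/eqP => /esym N0; apply: phi_neq0.
have : (\int[sigma]_(z in S) `|(ComplexField.Normc.normc (phi z) ^+ 2)%:E| = 0)%E.
  have E : (\int[sigma]_(z in S) `|(ComplexField.Normc.normc (phi z) ^+ 2)%:E| =
      \int[sigma]_(z in S) (ComplexField.Normc.normc (phi z) ^+ 2)%:E)%E.
    by apply: eq_integral => z _; rewrite gee0_abs// lee_fin sqr_ge0.
  rewrite E -[LHS]fineK; last first.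
    by rewrite ge0_fin_numE//; apply: integral_ge0 => z _; exact: sqr_ge0.
  by congr EFin.
move/(ae_eq_integral_abs sigma mS mN); apply: filterS => z h Sz; have {h} := h Sz.
move=> -[]; rewrite normc_sq; case: (phi z) => x y /=.
move/eqP; rewrite paddr_eq0 ?sqr_ge0// !sqrf_eq0 => /andP[/eqP -> /eqP ->] //.
Qed.

(** If the sphere were null, [phi] would vanish almost everywhere on it. *)
Let area_gt0 : 0 < area R n.
Proof.
rewrite lt_neqAle fine_ge0// andbT; apply/eqP => /esym A0; apply: phi_neq0.
exists S; split=> //; last first.
  by move=> z /= h; apply: contrapT => Sz; apply: h.
rewrite -[LHS]fineK ?[fine _]A0//.
rewrite ge0_fin_numE//; apply: le_lt_trans mu_fin; apply: le_measure => //; rewrite inE//.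
Qed.

(** The imaginary part is a difference of two integrals exchanged by swapping the variables, so
    symmetry of the kernel cancels it; the real part separates into the forms of [f] and [g]. *)
Let doubleE : cintegral (sigma \x sigma)%E (S `*` S)
    (fun zw => (phi zw.1)^* * phi zw.2 /
               (qnorm (1 - hdot zw.1 zw.2) `^ (lambda / 2))%:C) =
  (qform sigma k f + qform sigma k g)%:C.
Proof.
have iff := pkernel1_integrable a_gt0 a_lt1 area_gt0 f2 f2.
have igg := pkernel1_integrable a_gt0 a_lt1 area_gt0 g2 g2.
have ifg := pkernel1_integrable a_gt0 a_lt1 area_gt0 f2 g2.
have igf := pkernel1_integrable a_gt0 a_lt1 area_gt0 g2 f2.
rewrite /cintegral; congr (_ +i* _).
  rewrite /qform -RintegralD//.
  apply: Rintegral_sphere2 => [z w Sz Sw|p SS]; last by rewrite /k skernel_out// !mulr0 addr0.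
  rewrite conj_mul_real /= /k skernel_in// /f /g !indic_sphere// !mul1r -mulrDl.
  by rewrite /pkernel qnorm_powR.
transitivity (\int[(sigma \x sigma)%E]_p (f p.1 * g p.2 * k p - g p.1 * f p.2 * k p)).
  apply: Rintegral_sphere2 => [z w Sz Sw|p SS]; last by rewrite /k skernel_out// !mulr0 subr0.
  rewrite conj_mul_real /= /k skernel_in// /f /g !indic_sphere// !mul1r -mulrBl.
  by rewrite /pkernel qnorm_powR.
by rewrite RintegralB// (pkernel1_swap a_gt0 a_lt1 area_gt0 f2 g2) subrr.
Qed.

Let kernelE : \int[(sigma \x sigma)%E]_(zw in S `*` S)
    (qnorm (1 - hdot zw.1 zw.2) `^ (lambda / 2))^-1 = qform sigma k (fun=> 1).
Proof.
apply: Rintegral_sphere2 => [z w Sz Sw|p SS]; last by rewrite /k skernel_out// mulr0.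
by rewrite /k skernel_in// !mul1r /pkernel qnorm_powR.
Qed.

(** The bounds for [f] and [g] add up to |S| A_2 g_2 |phi|^2, and [eig2_lt] compares this with the
    lower bound for the total mass. Strictness uses that the norm of [phi] is positive. *)
Lemma second_variation_lt0 (p : R) : p - 1 = a / (2 * n%:R + 3 - a) ->
  area R n * (qform sigma k f + qform sigma k g) -
  (p - 1) * qform sigma k (fun=> 1) *
    (\int[sigma]_(z in S) ComplexField.Normc.normc (phi z) ^+ 2) < 0.
Proof.
move=> pE; have N0 := norm_gt0.
have hf := qform_pkernel1_orth a_gt0 a_lt1 area_gt0 f2
  (qform_schur0 f2 fg_mean.1) (qform_schur1 f2 (fun j c => (fg_coord j c).1)).
have hg := qform_pkernel1_orth a_gt0 a_lt1 area_gt0 g2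
  (qform_schur0 g2 fg_mean.2) (qform_schur1 g2 (fun j c => (fg_coord j c).2)).
have h1 := qform_pkernel1_one_ge a_gt0 a_lt1 area_gt0.
have e2 := eig2_lt a_gt0 a_lt1 n_ge1 area_gt0.
have p0 : 0 <= p - 1.
  have n0 : 0 <= n%:R :> R by []; have a1 := a_lt1.
  by rewrite pE divr_ge0 ?(ltW a_gt0)//; move: (n%:R : R) n0 => m m0; lra.
rewrite subr_lt0; move: N0; rewrite normE => N0.
set F := \int[sigma]_z f z ^+ 2 + _ in N0 *.
apply: (@le_lt_trans _ _ (area R n * eig2 n a * F)).
  by rewrite -mulrA ler_pM2l// /F mulrDr lerD.
rewrite ltr_pM2r//; apply: lt_le_trans e2 _.
by rewrite -pE ler_wpM2l.
Qed.

Lemma second_variation_complex (p : R) : p - 1 = a / (2 * n%:R + 3 - a) ->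
  (fine (sigma S))%:C *
    cintegral (sigma \x sigma)%E (S `*` S)
      (fun zw => (phi zw.1)^* * phi zw.2 /
                 (qnorm (1 - hdot zw.1 zw.2) `^ (lambda / 2))%:C)
  - ((p - 1) *
     (\int[(sigma \x sigma)%E]_(zw in S `*` S)
        (qnorm (1 - hdot zw.1 zw.2) `^ (lambda / 2))^-1) *
     (\int[sigma]_(z in S) ComplexField.Normc.normc (phi z) ^+ 2))%:C
  < 0.
Proof.
move=> pE; rewrite doubleE kernelE -rmorphM -rmorphB/= -[0]/(0%:C) ltcR.
exact: second_variation_lt0.
Qed.

End second_variation.

Theorem mainTheorem5 (R : realType) (n : nat) (Q lambda p : R)
    (n_ge1 : (1 <= n)%N)
    (QE : Q = (4 * n + 6)%:R)
    (lambda_gt0 : 0 < lambda) (lambda_lt4 : lambda < 4)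
    (pE : p = 2 * Q / (2 * Q - lambda))
    (phi : n.+1.-tuple (quat R) -> R[i])
    (phi_L2 : sphere_L2 phi)
    (phi_neq0 : ~ {ae surface_measure R n, forall z, sphere R n z -> phi z = 0})
    (phi_mean0 : cintegral (surface_measure R n) (sphere R n) phi = 0)
    (phi_coord0 : forall (j : 'I_n.+1) (c : 'I_4),
      cintegral (surface_measure R n) (sphere R n)
        (fun z => phi z * (qcoord c (tnth z j))%:C) = 0) :
  (fine (surface_measure R n (sphere R n)))%:C *
    cintegral (surface_measure R n \x surface_measure R n)%E
      (sphere R n `*` sphere R n)
      (fun zw => (phi zw.1)^* * phi zw.2 /
                 (qnorm (1 - hdot zw.1 zw.2) `^ (lambda / 2))%:C)
  - ((p - 1) *
     (\int[(surface_measure R n \x surface_measure R n)%E]_(zw in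
         sphere R n `*` sphere R n)
        (qnorm (1 - hdot zw.1 zw.2) `^ (lambda / 2))^-1) *
     (\int[surface_measure R n]_(z in sphere R n) ComplexField.Normc.normc (phi z) ^+ 2))%:C
  < 0.
Proof.
apply: second_variation_complex => //.
(* p - 1 = lambda / (2 Q - lambda), with 2 Q = 8 n + 12 and lambda = 4 a. *)
rewrite pE QE natrD natrM.
have n0 : 0 <= n%:R :> R by [].
move: (n%:R : R) n0 => m m0.
by field; rewrite gt_eqF//; lra.
Qed.
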